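(* Let $\mu$ be the standard Gaussian measure on $\mathbb R$ and let $(\mathbf r_m,\mathbf c_n)$ be a sequence of $m\times n$ margins converging to a continuum margin $(\mathbf r,\mathbf c)$ in $L^1$, with $m/n\to\kappa\in(0,\infty)$. Let $X\sim\lambda_{\mathbf r_m,\mathbf c_n}$ (for $\nu$-almost all margins) and let $Z=(z_{ij})$ be the $m\times n$ matrix $$z_{ij}=\frac{\mathbf r_m(i)}n+\frac{\mathbf c_n(j)}m-\frac N{mn},\qquad N=\sum_i\mathbf r_m(i)=\sum_j\mathbf c_n(j).$$ Then the empirical eigenvalue distribution of $\frac1n(X-Z)(X-Z)^\top$ converges weakly in probability to the Marchenko–Pastur distribution $$\Big(1-\frac1\kappa\Big)\mathbf 1(\kappa>1)\,\delta_0(dx)+\frac{\sqrt{(\lambda_+-x)(x-\lambda_-)}}{2\pi\kappa x}\,\mathbf 1(\lambda_-\le x\le\lambda_+)\,dx,\qquad\lambda_\pm=(1\pm\sqrt\kappa)^2.$$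
   Context: An $m\times n$ margin is a pair $(\mathbf r,\mathbf c)\in\mathbb R^m\times\mathbb R^n$ (here with equal totals). For a matrix $\mathbf x\in\mathbb R^{m\times n}$, $\pi(\mathbf x)$ is its pair of row-sum and column-sum vectors; $\nu=\pi_\#(\mu^{\otimes(m\times n)})$. $\{\lambda_{\mathbf t}\}$ is the ($\nu$-a.e. unique) disintegration of $\mu^{\otimes(m\times n)}$ with respect to $\pi$ (the regular conditional law of a matrix with i.i.d. standard Gaussian entries given its row and column sums): for $\nu$-a.e. $\mathbf t$, $\lambda_{\mathbf t}$ is a probability measure concentrated on $\{\pi=\mathbf t\}$, and $\int h\,d\mu^{\otimes(m\times n)}=\iint h\,d\lambda_{\mathbf t}\,\nu(d\mathbf t)$ for nonnegative measurable $h$. ''For $\nu$-almost all margins'' means that the margins $(\mathbf r_m,\mathbf c_n)$ are taken outside exceptional $\nu$-null sets of $m\times n$ margins. A continuum margin is a pair of integrable functions $\mathbf r,\mathbf c:(0,1]\to\mathbb R$ with equal integrals; $L^1$-convergence of $(\mathbf r_m,\mathbf c_n)$ to $(\mathbf r,\mathbf c)$ means $\|\mathbf r-\bar{\mathbf r}_m\|_1+\|\mathbf c-\bar{\mathbf c}_n\|_1\to0$ as $m,n\to\infty$, where $\bar{\mathbf r}_m(t)=n^{-1}\mathbf r_m(\lceil mt\rceil)$ and $\bar{\mathbf c}_n(t)=m^{-1}\mathbf c_n(\lceil nt\rceil)$. The empirical eigenvalue distribution of an $m\times m$ symmetric matrix is the uniform probability measure on its $m$ eigenvalues. *)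

(* Defs.v *)
From HB Require Import structures.
From mathcomp Require Import all_boot all_order all_algebra.
From mathcomp Require Import all_classical all_reals all_analysis.
From mathcomp Require Import measurable_realfun.
From mathcomp Require Import complex.

Set Implicit Arguments.
Unset Strict Implicit.
Unset Printing Implicit Defensive.

Import Order.TTheory GRing.Theory Num.Theory.
Import numFieldNormedType.Exports.

Local Open Scope classical_set_scope.
Local Open Scope ring_scope.

Definition measure_matrix_display : measure_display -> measure_display.
Proof. exact. Qed.

Section measurable_matrix.
Context d (T : measurableType d) (m n : nat).

Definition mx_cylinders : set (set 'M[T]_(m, n)) :=
  [set B | exists i j, exists2 C : set T,
     measurable C & B = [set A : 'M[T]_(m, n) | C (A i j)]].

Definition mx_measurable : set (set 'M[T]_(m, n)) := <<s mx_cylinders >>.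

Let mx_set0 : mx_measurable set0. Proof. exact: sigma_algebra0. Qed.

Let mx_setC A : mx_measurable A -> mx_measurable (~` A).
Proof. exact: sigma_algebraC. Qed.

Let mx_bigcup (F : (set 'M[T]_(m, n))^nat) :
  (forall i, mx_measurable (F i)) -> mx_measurable (\bigcup_i (F i)).
Proof. exact: sigma_algebra_bigcup. Qed.

HB.instance Definition _ :=
  @isMeasurable.Build (measure_matrix_display d) 'M[T]_(m, n)
    mx_measurable mx_set0 mx_setC mx_bigcup.

Lemma measurable_mx_coef (i : 'I_m) (j : 'I_n) :
  measurable_fun [set: 'M[T]_(m, n)] (fun A : 'M[T]_(m, n) => A i j).
Proof.
move=> _ C mC; rewrite setTI; apply: sub_sigma_algebra.
by exists i, j; exists C.
Qed.

End measurable_matrix.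

Lemma measurable_fun_mxP d d' (S : measurableType d) (T : measurableType d')
    (m n : nat) (f : S -> 'M[T]_(m, n)) :
  (forall i j, measurable_fun [set: S] (fun x => f x i j)) ->
  measurable_fun [set: S] f.
Proof.
move=> mf; apply: (measurability (@mx_cylinders _ T m n)) => //.
move=> _ [_ [i [j [C mC ->]]] <-].
exact: (mf i j measurableT C mC).
Qed.

Section iid_tuple.
Context d (T : measurableType d) (R : realType) (P : probability T R).

Definition tcons n (x : T * n.-tuple T) : n.+1.-tuple T := [tuple of x.1 :: x.2].

Lemma measurable_tcons n : measurable_fun [set: T * n.-tuple T] (@tcons n).
Proof. exact: measurable_cons. Qed.

HB.instance Definition _ n :=
  isMeasurableFun.Build _ _ _ _ (@tcons n) (@measurable_tcons n).

Fixpoint iid_tuple n : probability (n.-tuple T) R :=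
  match n with
  | 0 => dirac [tuple]
  | k.+1 => distribution (P \x iid_tuple k)%E (@tcons k)
  end.

End iid_tuple.

Section iid_mx.
Context d (T : measurableType d) (R : realType) (P : probability T R).
Variables m n : nat.

Definition mx_of_tuples (t : m.-tuple (n.-tuple T)) : 'M[T]_(m, n) :=
  \matrix_(i, j) tnth (tnth t i) j.

Lemma measurable_mx_of_tuples : measurable_fun setT mx_of_tuples.
Proof.
apply: measurable_fun_mxP => i j.
rewrite (_ : (fun _ => _) = (fun u => tnth u j) \o
  (fun t : m.-tuple (n.-tuple T) => tnth t i)); last first.
  by apply/funext => t; rewrite mxE.
by apply: measurableT_comp; exact: measurable_tnth.
Qed.

HB.instance Definition _ :=
  isMeasurableFun.Build _ _ _ _ mx_of_tuples measurable_mx_of_tuples.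

Definition iid_mx : probability 'M[T]_(m, n) R :=
  distribution (iid_tuple (iid_tuple P n) m) mx_of_tuples.

End iid_mx.

Lemma iid_tuple_box d (T : measurableType d) (R : realType)
    (P : probability T R) n (B : 'I_n -> set T) :
  (forall i, measurable (B i)) ->
  iid_tuple P n [set t | forall i, B i (tnth t i)] = (\prod_(i < n) P (B i))%E.
Proof.
elim: n B => [|n IH] B mB.
  rewrite big_ord0 (_ : [set t | _] = setT) ?probability_setT//.
  by apply/seteqP; split => // t _ [].
rewrite big_ord_recl -IH// /iid_tuple -/iid_tuple /= /distribution /pushforward.
rewrite -product_measure1E//; last first.
  rewrite (_ : [set _ | _] =
      \big[setI/setT]_(i < n) ((@tnth n T)^~ i @^-1` B (lift ord0 i))); last first.
    rewrite -bigcap_seq; apply/seteqP; split => [t tB i _|t tB i]; first exact: tB.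
    by apply: (tB i); rewrite /= mem_index_enum.
  apply: bigsetI_measurable => i _; rewrite -[X in measurable X]setTI.
  exact: measurable_tnth.
congr (_ _); apply/seteqP; split => [[x t] h|[x t] [Bx h] i].
  by split => [|i]; [have := h ord0|have := h (lift ord0 i); rewrite /= tnthS].
by have [j ->|->] := unliftP ord0 i; [rewrite /= tnthS; exact: h|].
Qed.

Lemma iid_mx_box d (T : measurableType d) (R : realType)
    (P : probability T R) m n (B : 'I_m -> 'I_n -> set T) :
  (forall i j, measurable (B i j)) ->
  iid_mx P m n [set A : 'M[T]_(m, n) | forall i j, B i j (A i j)] =
  (\prod_(i < m) \prod_(j < n) P (B i j))%E.
Proof.
move=> mB; rewrite /iid_mx /distribution /pushforward.
have mBi i : measurable [set t : n.-tuple T | forall j, B i j (tnth t j)].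
  rewrite (_ : [set _ | _] =
      \big[setI/setT]_(j < n) ((@tnth n T)^~ j @^-1` B i j)); last first.
    rewrite -bigcap_seq; apply/seteqP; split => [t tB j _|t tB j]; first exact: tB.
    by apply: (tB j); rewrite /= mem_index_enum.
  apply: bigsetI_measurable => j _; rewrite -[X in measurable X]setTI.
  exact: measurable_tnth.
transitivity (\prod_(i < m)
    iid_tuple P n [set t | forall j, B i j (tnth t j)])%E; last first.
  by apply: eq_bigr => i _; rewrite iid_tuple_box.
rewrite -(iid_tuple_box (iid_tuple P n) mBi); rewrite /=; congr (iid_tuple _ _ _); apply/seteqP.
by split => [t h i j|t h i j]; have := h i j; rewrite /= mxE.
Qed.

(* [normal_prob] lives on [measurableTypeR R], which has the same measurable sets
   as the canonical measurable type on [R] but another display. *)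
Section std_gaussian.
Context (R : realType).

Definition of_measurableTypeR (x : measurableTypeR R) : R := x.

Lemma measurable_of_measurableTypeR : measurable_fun setT of_measurableTypeR.
Proof. by move=> _ A mA; rewrite setTI. Qed.

HB.instance Definition _ := isMeasurableFun.Build _ _ _ _
  of_measurableTypeR measurable_of_measurableTypeR.

Definition std_gaussian : probability R R :=
  distribution (normal_prob (0 : R) 1) of_measurableTypeR.

Lemma std_gaussianE (A : set R) : std_gaussian A = normal_prob 0 1 A.
Proof. by []. Qed.

End std_gaussian.

(* A margin is the column vector of row sums paired with the row vector of column
   sums; equality of the two totals is a separate hypothesis. *)
Notation margin R m n := ('cV[R]_m * 'rV[R]_n)%type.

Section margins.
Context (R : realType).

Definition margin_of m n (x : 'M[R]_(m, n)) : margin R m n :=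
  (\col_i (\sum_j x i j), \row_j (\sum_i x i j)).

Lemma measurable_margin_of m n : measurable_fun setT (@margin_of m n).
Proof.
apply/measurable_fun_pairP; split; apply: measurable_fun_mxP => i j.
  rewrite (_ : (fun _ => _) = (fun x : 'M[R]_(m, n) => \sum_j x i j)); last first.
    by apply/funext => x; rewrite mxE.
  by apply: measurable_sum => k; exact: measurable_mx_coef.
rewrite (_ : (fun _ => _) = (fun x : 'M[R]_(m, n) => \sum_i x i j)); last first.
  by apply/funext => x; rewrite mxE.
by apply: measurable_sum => k; exact: measurable_mx_coef.
Qed.

HB.instance Definition _ m n :=
  isMeasurableFun.Build _ _ _ _ (@margin_of m n) (@measurable_margin_of m n).

Definition margin_law (mu : probability R R) m n :
    probability (margin R m n) R :=
  distribution (iid_mx mu m n) (@margin_of m n).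

End margins.

Definition is_disintegration d d' (X : measurableType d) (T : measurableType d')
    (R : realType) (P : probability X R) (lam : R.-ker T ~> X)
    (f : {mfun X >-> T}) : Prop :=
  {ae distribution P f, forall t,
     lam t [set: X] = 1%E /\ lam t (~` (f @^-1` [set t])) = 0%E} /\
  forall h : X -> \bar R, measurable_fun [set: X] h -> (forall x, 0 <= h x)%E ->
    (\int[P]_x h x = \int[distribution P f]_t \int[lam t]_x h x)%E.

Section continuum.
Context (R : realType).

(* With 0-based indices, the entry numbered `ceil (k * t)` from 1 is [v i] for
   the unique [i] with [i.+1 = ceil (k * t)]; it exists when [0 < t <= 1]. *)
Definition step_fun k (v : 'I_k -> R) (t : R) : R :=
  \sum_(i < k | Num.ceil (k%:R * t) == i.+1%:Z) v i.

Definition row_step m n (r : 'cV[R]_m) (t : R) : R :=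
  n%:R^-1 * step_fun (fun i => r i 0) t.

Definition col_step m n (c : 'rV[R]_n) (t : R) : R :=
  m%:R^-1 * step_fun (fun j => c 0 j) t.

Definition continuum_margin (r c : R -> R) : Prop :=
  [/\ lebesgue_measure.-integrable `]0%R, 1%R] (EFin \o r),
      lebesgue_measure.-integrable `]0%R, 1%R] (EFin \o c) &
      (\int[lebesgue_measure]_(t in `]0%R, 1%R]) (r t)%:E =
       \int[lebesgue_measure]_(t in `]0%R, 1%R]) (c t)%:E)%E].

Definition L1_dist (f g : R -> R) : \bar R :=
  (\int[lebesgue_measure]_(t in `]0%R, 1%R]) `|f t - g t|%:E)%E.

Definition margins_cvg_L1 (m n : nat -> nat)
    (rm : forall k, 'cV[R]_(m k)) (cn : forall k, 'rV[R]_(n k))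
    (r c : R -> R) : Prop :=
  (fun k => L1_dist r (row_step (n k) (rm k)) +
            L1_dist c (col_step (m k) (cn k)))%E @ \oo --> 0%E.

Definition margin_mean m n (r : 'cV[R]_m) (c : 'rV[R]_n) : 'M[R]_(m, n) :=
  \matrix_(i, j)
    (r i 0 / n%:R + c 0 j / m%:R - (\sum_k r k 0) / (m * n)%:R).

End continuum.

(* The roots of the characteristic polynomial, listed with multiplicity, when it
   splits over [R]; this holds for symmetric [A] by [char_poly_eigenvalues]. *)
Definition eigenvalues (R : realType) m (A : 'M[R]_m) : seq R :=
  xget [::] [set s : seq R | char_poly A = \prod_(a <- s) ('X - a%:P)].

Lemma char_poly_eigenvalues (R : realType) m (A : 'M[R]_m) : A^T = A ->
  char_poly A = \prod_(a <- eigenvalues A) ('X - a%:P).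
Proof.
move=> symA; apply: (@xgetPex _ [::]
  [set s : seq R | char_poly A = \prod_(a <- s) ('X - a%:P)]).
pose toC : {rmorphism R -> complex R} := real_complex R.
pose B := map_mx toC A.
have [s sE] := closed_field_poly_normal (char_poly B).
move: sE; rewrite (monicP (char_poly_monic B)) scale1r => sE.
have realB : B \is a mxOver Num.real.
  by apply/mxOverP => i j; rewrite mxE complex_real.
have hermB : B \is hermsymmx.
  apply: realsym_hermsym => //; apply/is_hermitianmxP.
  by rewrite expr0 scale1r; apply/matrixP => i j; rewrite !mxE /= -[in LHS]symA mxE.
have /hermitian_normalmx/orthomx_spectralP BE := hermB.
have reals z : z \in s -> z \is Num.real.
  move=> zs; have : root (char_poly B) z by rewrite sE root_prod_XsubC.
  rewrite -eigenvalue_root_char => /eigenvalueP[v vB v0].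
  have Pu := spectral_unit B.
  pose w := v *m invmx (spectralmx B).
  have w0 : w != 0.
    by apply: contra v0 => /eqP w0; rewrite -[v](mulmxKV Pu) -/w w0 mul0mx.
  have wD : w *m diag_mx (spectral_diag B) = z *: w.
    by rewrite /w scalemxAl -vB [X in _ = v *m X *m _]BE !mulmxA mulmxK.
  have /rV0Pn[i wi0] := w0.
  have := congr1 (fun u : 'rV_m => u 0 i) wD.
  clearbody w; rewrite mul_mx_diag !mxE mulrC => /(mulIf wi0) <-.
  exact: (mxOverP (hermitian_spectral_diag_real hermB)).
exists (map (@complex.Re R) s).
apply: (@map_poly_inj _ _ toC); rewrite map_char_poly -/B sE map_prod_XsubC.
rewrite big_map; apply: eq_big_seq => z /reals zR.
by rewrite /toC /= RRe_real.
Qed.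

Definition esd (R : realType) m (A : 'M[R]_m) : {measure set R -> \bar R} :=
  mscale (m%:R^-1)%:nng (msum (fun k => \d_((eigenvalues A)`_k)) m).

Section marchenko_pastur.
Context (R : realType) (kappa : R).

Definition mp_lower : R := (1 - Num.sqrt kappa) ^+ 2.
Definition mp_upper : R := (1 + Num.sqrt kappa) ^+ 2.

Definition mp_pdf (x : R) : R :=
  if mp_lower <= x <= mp_upper then
    Num.sqrt ((mp_upper - x) * (x - mp_lower)) / (2 * pi * kappa * x)
  else 0.

Definition mp_atom : R := if 1 < kappa then 1 - kappa^-1 else 0.

Lemma mp_atom_ge0 : 0 <= mp_atom.
Proof.
rewrite /mp_atom; case: ifPn => // k1.
by rewrite subr_ge0 invf_le1 ?(ltW k1)// (lt_trans _ k1).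
Qed.

Lemma mp_pdf_ge0 x : 0 <= mp_pdf x.
Proof.
rewrite /mp_pdf; case: ifPn => // /andP[xl xu].
have x0 : 0 <= x by apply: le_trans xl; exact: sqr_ge0.
have [k0|k0] := leP 0 kappa.
  by rewrite divr_ge0 ?sqrtr_ge0// !mulr_ge0 ?pi_ge0.
move: xl xu; rewrite /mp_lower /mp_upper ler0_sqrtr ?(ltW k0)//.
rewrite subr0 addr0 expr1n => x1 x1'.
have -> : x = 1 by apply/eqP; rewrite eq_le x1 x1'.
by rewrite subrr mul0r sqrtr0 mul0r.
Qed.

Lemma measurable_mp_pdf : measurable_fun [set: R] mp_pdf.
Proof.
have minv : measurable_fun [set: R] (fun x : R => x^-1).
  rewrite (_ : [set: R] = [set 0] `|` ~` [set 0]); last by rewrite setUv.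
  apply/measurable_funU => //; first exact: measurableC.
  split; first exact: measurable_fun_set1.
  apply: open_continuous_measurable_fun; first exact: closed_openC.
  move=> x /set_mem /= /eqP x0.
  exact: inv_continuous.
have msqrt : measurable_fun [set: R] (@Num.sqrt R).
  by apply: continuous_measurable_fun; exact: sqrt_continuous.
apply: measurable_fun_ifT => //.
  by apply: measurable_and; exact: measurable_fun_ler.
apply: measurable_funM.
  apply: (measurableT_comp msqrt).
  by apply: measurable_funM; apply: measurable_funB.
by apply: (measurableT_comp minv); apply: measurable_funM.
Qed.

(* Absolutely continuous part of the law. *)
Definition mp_ac (A : set R) : \bar R :=
  (\int[lebesgue_measure]_(x in A) (mp_pdf x)%:E)%E.

Let mp_ac0 : mp_ac set0 = 0%E. Proof. by rewrite /mp_ac integral_set0. Qed.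

Let mp_ac_ge0 A : (0 <= mp_ac A)%E.
Proof. by apply: integral_ge0 => x _; rewrite lee_fin mp_pdf_ge0. Qed.

Let mp_ac_sigma_additive : semi_sigma_additive mp_ac.
Proof.
move=> /= F mF tF mUF; rewrite /mp_ac; apply: cvg_toP.
  apply: ereal_nondecreasing_is_cvgn => m n mn.
  by apply: lee_sum_nneg_natr => // k _ _; exact: mp_ac_ge0.
rewrite ge0_integral_bigcup//=.
- apply: measurable_funTS; apply: measurableT_comp => //.
  exact: measurable_mp_pdf.
- by move=> x _; rewrite lee_fin mp_pdf_ge0.
Qed.

HB.instance Definition _ := isMeasure.Build _ _ _ mp_ac
  mp_ac0 mp_ac_ge0 mp_ac_sigma_additive.

Definition mp_law : {measure set R -> \bar R} :=
  measure_add (mscale (NngNum mp_atom_ge0) \d_(0 : R)) mp_ac.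

End marchenko_pastur.

(* The random measure [M k] on the probability space [(X k, P k)] converges to
   [L] weakly in probability: its integrals against bounded continuous test
   functions converge in probability. *)
Definition cvg_weakly_in_prob (R : realType) (d : nat -> measure_display)
    (X : forall k, measurableType (d k)) (P : forall k, {measure set (X k) -> \bar R})
    (M : forall k, X k -> {measure set R -> \bar R})
    (L : {measure set R -> \bar R}) : Prop :=
  forall f : R -> R, continuous f -> (exists C, forall x, `|f x| <= C) ->
  forall eps : R, 0 < eps ->
    (fun k => P k [set x |
       eps < `| \int[M k x]_y f y - \int[L]_y f y |]) @ \oo --> 0%E.

(* Main.v *)
(* The matrix X - Z is X with its row and column means removed, so under the
   conditional law it is distributed, for almost every margin, as P G P' where G has
   i.i.d. Gaussian entries and P, P' are the centering projections: an orthogonal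
   change of basis on each side (preserving the law of G) makes the entries that
   determine P G P' disjoint from those that determine the margin, hence independent.

   Convergence of the spectrum is read off the normalized trace s(z) of the resolvent
   of the Gram matrix at -z < 0. Removing the centering costs two perturbations of
   rank one, so O(1/m) in s. Removing one column of G at a time and using the
   variance of a Gaussian quadratic form gives 1 - z s - s / (1 + kappa s) -> 0 in
   L1; the left-hand side is decreasing in s with slope at most -z, so s converges
   in L1 to the nonnegative zero of this function, with no concentration inequality.
   An explicit primitive shows that this zero is the Stieltjes transform of the
   Marchenko-Pastur law. Difference quotients in z yield all powers of 1/(x + z), and
   Weierstrass approximation in w = 1/(1 + x) together with a cutoff beyond the
   support of the limit yields all bounded continuous test functions. *)
Require Import Defs.
From HB Require Import structures.
From mathcomp Require Import all_boot all_order all_algebra.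
From mathcomp Require Import all_classical all_reals all_analysis.
From mathcomp Require Import measurable_realfun ring lra complex.

Set Implicit Arguments.
Unset Strict Implicit.
Unset Printing Implicit Defensive.

Import Order.TTheory GRing.Theory Num.Theory.
Import numFieldNormedType.Exports.

Local Open Scope classical_set_scope.
Local Open Scope ring_scope.

(** The equation for s comes from one trace. With A = (1/n) G G^T and Q = (A + z)^-1, tr (Q A) = m -
    z tr Q; column by column the same trace is the sum of q_j / (1 + q_j), where q_j is 1/n times
    the quadratic form of column j in the resolvent that omits this column. Given the other columns,
    q_j has mean (1/n) times a trace, which up to O(1/n) is (m/n) s; summing over the n columns and
    dividing by m gives 1 - z s = s / (1 + kappa s) in the limit. Two obstacles shape the rest. The
    null sets of margins must be fixed before the sizes, kappa and the limit of s are known, so the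
    conditional law is tested only at rational z and against rational centers, and density of the
    rationals does the remainder. The list of eigenvalues is chosen by [xget], with no measurability
    in the matrix, so measurability of spectral averages is itself carried through every
    approximation, starting from the resolvent trace, a rational function of the entries. *)

Section derive_wrappers.
Context (R : realType).
Implicit Types (f g : R -> R) (x a b c : R).

(** These rules speak of explicit lambda terms, so the derivative of a concrete expression is built
    as one term and only its value remains to be checked, through [is_derive_eq]. *)
Lemma derive1_add f g x a b : is_derive x 1 f a -> is_derive x 1 g b ->
  is_derive x 1 (fun y => f y + g y) (a + b).
Proof. by move=> df dg; exact: is_deriveD. Qed.

Lemma derive1_opp f x a : is_derive x 1 f a ->
  is_derive x 1 (fun y => - f y) (- a).
Proof. by move=> df; exact: is_deriveN. Qed.

Lemma derive1_mul f g x a b : is_derive x 1 f a -> is_derive x 1 g b ->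
  is_derive x 1 (fun y => f y * g y) (a * g x + f x * b).
Proof.
move=> df dg; have := is_deriveM df dg => /is_derive_eq; apply.
by rewrite /GRing.scale /= addrC (mulrC a).
Qed.

Lemma derive1_cstl c f x a : is_derive x 1 f a ->
  is_derive x 1 (fun y => c * f y) (c * a).
Proof. by move=> df; exact: (is_deriveZ c df). Qed.

Lemma derive1_pow f x a n : is_derive x 1 f a ->
  is_derive x 1 (fun y => f y ^+ n) (n%:R * f x ^+ n.-1 * a).
Proof.
move=> df; rewrite (_ : (fun y => _) = f ^+ n); first exact: is_deriveX.
by apply/funext => y; rewrite exprfctE.
Qed.

Lemma derive1_chain f g x a b : is_derive x 1 f a -> is_derive (f x) 1 g b ->
  is_derive x 1 (fun y => g (f y)) (b * a).
Proof. by move=> df dg; apply: is_derive1_comp. Qed.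

Lemma derive1_inv f x a : f x != 0 -> is_derive x 1 f a ->
  is_derive x 1 (fun y => (f y)^-1) (- a / f x ^+ 2).
Proof.
move=> fx0 df; have := is_deriveV fx0 df => /is_derive_eq; apply.
by rewrite /GRing.scale /= !mulNr mulrC.
Qed.

End derive_wrappers.

(** * Resolvents of positive semidefinite matrices *)

Section resolvent.
Context (R : realFieldType).

Definition qform m (M : 'M[R]_m) (x : 'cV[R]_m) : R := (x^T *m M *m x) 0 0.

Definition psdmx m (A : 'M[R]_m) : Prop :=
  A^T = A /\ forall x, 0 <= qform A x.

Definition resolvent m (A : 'M[R]_m) (z : R) : 'M[R]_m := invmx (A + z%:M).

Lemma qformD m (M N : 'M[R]_m) x : qform (M + N) x = qform M x + qform N x.
Proof. by rewrite /qform mulmxDr mulmxDl mxE. Qed.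

Lemma qformZ m a (M : 'M[R]_m) x : qform (a *: M) x = a * qform M x.
Proof. by rewrite /qform -scalemxAr -scalemxAl mxE. Qed.

Lemma qform1 m (x : 'cV[R]_m) : qform 1%:M x = \sum_i x i 0 ^+ 2.
Proof.
by rewrite /qform mulmx1 mxE; apply: eq_bigr => i _; rewrite mxE expr2.
Qed.

Lemma qform1_ge0 m (x : 'cV[R]_m) : 0 <= qform 1%:M x.
Proof. by rewrite qform1; apply: sumr_ge0 => i _; exact: sqr_ge0. Qed.

Lemma qform1_eq0 m (x : 'cV[R]_m) : qform 1%:M x = 0 -> x = 0.
Proof.
rewrite qform1 => /eqP; rewrite psumr_eq0; last by move=> i _; exact: sqr_ge0.
move=> /allP x0; apply/colP => i; apply/eqP; rewrite mxE.
by have := x0 i (mem_index_enum i); rewrite sqrf_eq0.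
Qed.

Lemma qform_gram m n (B : 'M[R]_(m, n)) x :
  qform (B *m B^T) x = qform 1%:M (B^T *m x).
Proof. by rewrite /qform mulmx1 trmx_mul trmxK !mulmxA. Qed.

Lemma qform_rank1 m (M : 'M[R]_m) (g x : 'cV[R]_m) : M^T = M ->
  qform (M *m g *m g^T *m M) x = (x^T *m M *m g) 0 0 ^+ 2.
Proof.
move=> sM; rewrite /qform.
have -> : x^T *m (M *m g *m g^T *m M) *m x =
    (x^T *m M *m g) *m (x^T *m M *m g)^T.
  by rewrite !trmx_mul trmxK sM !mulmxA.
by rewrite mxE big_ord1 expr2 [X in _ * X]mxE.
Qed.

Lemma psdmx_gram m n (B : 'M[R]_(m, n)) c : 0 <= c -> psdmx (c *: (B *m B^T)).
Proof.
move=> c0; split; first by rewrite linearZ /= trmx_mul trmxK.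
by move=> x; rewrite qformZ qform_gram mulr_ge0 ?qform1_ge0.
Qed.

Lemma mxtrace_qform m (M : 'M[R]_m) :
  \tr M = \sum_i qform M (delta_mx i 0).
Proof.
apply: eq_bigr => i _; rewrite /qform trmx_delta -rowE -colE.
by rewrite !mxE.
Qed.

Lemma qform1_delta m (i : 'I_m) : qform 1%:M (delta_mx i 0) = 1.
Proof.
rewrite qform1 (bigD1 i)//= big1 ?addr0 ?mxE ?eqxx ?expr1n// => j /negPf ji.
by rewrite mxE ji expr0n.
Qed.

Section psd.
Context m (A : 'M[R]_m) (z : R).
Hypotheses (psdA : psdmx A) (z0 : 0 < z).
Let Q := resolvent A z.

(** A row vector v killed by A + z satisfies v A v^T + z |v|^2 = 0 with both terms nonnegative,
    which forces v = 0. *)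
Lemma resolvent_unit : A + z%:M \in unitmx.
Proof.
rewrite -row_free_unit -kermx_eq0; apply/eqP/row_matrixP => i; rewrite row0.
set v := row i _.
have vA : v *m (A + z%:M) = 0 by apply/sub_kermxP; exact: row_sub.
suff : v^T = 0 by move=> v0; rewrite -[v]trmxK v0 trmx0.
apply: qform1_eq0; apply/eqP; rewrite eq_le qform1_ge0 andbT.
have : qform A v^T + z * qform 1%:M v^T = 0.
  by rewrite -qformZ scalemx1 -qformD /qform trmxK vA mul0mx mxE.
move=> h; rewrite leNgt; apply/negP => /(mulr_gt0 z0); have := psdA.2 v^T; lra.
Qed.

Lemma resolventE : Q *m A = 1%:M - z *: Q.
Proof.
have := mulVmx resolvent_unit; rewrite -/Q mulmxDr mul_mx_scalar => <-.
by rewrite addrK.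
Qed.

Lemma resolvent_sym : Q^T = Q.
Proof. by rewrite /Q /resolvent trmx_inv linearD /= tr_scalar_mx psdA.1. Qed.

(** Sandwiching A + z between two copies of Q gives Q = Q A Q + z Q^2; dropping the first,
    nonnegative, term bounds z Q^2 by Q. *)
Lemma qform_resolventE x : qform Q x = qform A (Q *m x) + z * qform 1%:M (Q *m x).
Proof.
rewrite -qformZ scalemx1 -qformD /qform trmx_mul resolvent_sym.
by rewrite -!mulmxA [(_ + _) *m _]mulmxA mulmxV ?resolvent_unit// mul1mx.
Qed.

Lemma qform_resolvent_sqr x : qform (Q *m Q) x = qform 1%:M (Q *m x).
Proof. by rewrite -{2}resolvent_sym qform_gram resolvent_sym. Qed.

Lemma qform_resolvent_sqr_le x : z * qform (Q *m Q) x <= qform Q x.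
Proof. by rewrite qform_resolvent_sqr qform_resolventE lerDr; exact: psdA.2. Qed.

Lemma qform_resolvent_ge0 x : 0 <= qform Q x.
Proof.
rewrite (le_trans _ (qform_resolvent_sqr_le x))// qform_resolvent_sqr.
by rewrite mulr_ge0 ?qform1_ge0 ?ltW.
Qed.

Lemma qform_resolvent_le x : z * qform Q x <= qform 1%:M x.
Proof.
have h : 0 <= qform 1%:M (x - z *: (Q *m x)) by exact: qform1_ge0.
have e : qform 1%:M (x - z *: (Q *m x)) =
    qform 1%:M x - 2 * z * qform Q x + z ^+ 2 * qform 1%:M (Q *m x).
  have -> : qform Q x = (x^T *m (Q *m x)) 0 0 by rewrite /qform mulmxA.
  have : ((Q *m x)^T *m x) 0 0 = (x^T *m (Q *m x)) 0 0.
    by rewrite trmx_mul resolvent_sym mulmxA.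
  move: (Q *m x) => y yx; rewrite /qform !mulmx1.
  have -> : (x - z *: y)^T = x^T - z *: y^T by apply/rowP => i; rewrite !mxE.
  rewrite mulmxBl !mulmxBr -!scalemxAl -!scalemxAr.
  have mB (M N : 'M[R]_1) : (M - N) 0 0 = M 0 0 - N 0 0 by rewrite !mxE.
  have mZ a (M : 'M[R]_1) : (a *: M) 0 0 = a * M 0 0 by rewrite mxE.
  by rewrite !(mB, mZ) yx; ring.
have := qform_resolvent_sqr_le x; rewrite qform_resolvent_sqr => h2.
have := ler_wpM2l (ltW z0) h2; lra.
Qed.

Lemma mxtrace_resolvent_ge0 : 0 <= \tr Q.
Proof.
by rewrite mxtrace_qform; apply: sumr_ge0 => i _; exact: qform_resolvent_ge0.
Qed.

Lemma mxtrace_resolvent_le : \tr Q <= m%:R / z.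
Proof.
rewrite ler_pdivlMr// mulrC mxtrace_qform mulr_sumr.
rewrite (@le_trans _ _ (\sum_(i < m) 1))//; last by rewrite sumr_const card_ord.
apply: ler_sum => i _; rewrite (le_trans (qform_resolvent_le _))//.
by rewrite qform1_delta.
Qed.

(** Q is symmetric, so its squared Frobenius norm is tr (Q^2), and z Q^2 <= Q reduces this to the
    trace bound. It will control the variance of a Gaussian quadratic form in Q. *)
Lemma resolvent_frobenius_le : \sum_i \sum_j Q i j ^+ 2 <= m%:R / z ^+ 2.
Proof.
have -> : \sum_i \sum_j Q i j ^+ 2 = \tr (Q *m Q).
  apply: eq_bigr => i _; rewrite mxE; apply: eq_bigr => j _.
  by rewrite expr2 -{2}resolvent_sym mxE.
rewrite expr2 invfM mulrA ler_pdivlMr//.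
apply: le_trans mxtrace_resolvent_le.
rewrite !mxtrace_qform mulr_suml; apply: ler_sum => i _.
by rewrite mulrC qform_resolvent_sqr_le.
Qed.

(* Sherman-Morrison: [Q' = Q - c / (1 + c g^T Q g) * Q g g^T Q]. *)
Section rank_one.
Context (c : R) (g : 'cV[R]_m).
Hypothesis c0 : 0 <= c.
Let A' := A + c *: (g *m g^T).
Let q := c * qform Q g.

Let q0 : 0 <= q. Proof. by rewrite mulr_ge0 ?qform_resolvent_ge0. Qed.

Lemma sherman_morrison :
  resolvent A' z = Q - (c / (1 + q)) *: (Q *m g *m g^T *m Q).
Proof.
have u : A + z%:M \in unitmx := resolvent_unit.
have q1 : 1 + q != 0 by rewrite gt_eqF// ltr_wpDr.
set W := RHS.
have gQg : g^T *m Q *m g = (qform Q g)%:M.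
  by rewrite [LHS]mx11_scalar.
suff h : (A' + z%:M) *m W = 1%:M.
  by rewrite /resolvent -[W]mul1mx -(mulVmx (mulmx1_unit h).1) -mulmxA h mulmx1.
rewrite /A' addrAC /W mulmxDl mulmxBr -/Q (mulmxV u) -!scalemxAr !mulmxA (mulmxV u) mul1mx.
rewrite mulmxBr -!scalemxAl -!scalemxAr !mulmxA.
have -> : g *m g^T *m Q *m g *m g^T *m Q = qform Q g *: (g *m g^T *m Q).
  by rewrite -!(mulmxA g) gQg -!mulmxA mul_scalar_mx -scalemxAr.
move: (g *m g^T *m Q) => X.
rewrite -[RHS]addr0 -addrA; congr (_ + _).
rewrite !scalerA -scaleNr -scalerBl -scalerDl (_ : _ + _ = 0) ?scale0r//.
by rewrite /q; field; rewrite -/q.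
Qed.

Lemma qform_resolvent_rank1 : c * qform (resolvent A' z) g = q / (1 + q).
Proof.
rewrite sherman_morrison qformD -scaleNr qformZ (qform_rank1 _ _ resolvent_sym).
rewrite -/(qform Q g) /q.
have q1 : 1 + c * qform Q g != 0 by rewrite gt_eqF// ltr_wpDr.
by field.
Qed.

(** The difference is c / (1 + q) times g^T Q^2 g, at most (q / (1 + q)) / z. The bound ignores the
    size of the perturbation, which is why a column or a centering costs only O(1) in the trace. *)
Lemma mxtrace_resolvent_rank1 :
  0 <= \tr Q - \tr (resolvent A' z) <= z^-1.
Proof.
have q1 : 0 < 1 + q by have := q0; lra.
have -> : \tr Q - \tr (resolvent A' z) = c / (1 + q) * qform (Q *m Q) g.
  rewrite sherman_morrison linearB /= linearZ /= opprB addrC subrK.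
  congr (_ * _); rewrite -mulmxA mxtrace_mulC /qform !mulmxA.
  by rewrite [X in \tr X]mx11_scalar mxtrace_scalar mulr1n.
have h := qform_resolvent_sqr_le g.
have h0 : 0 <= qform (Q *m Q) g by rewrite qform_resolvent_sqr qform1_ge0.
rewrite mulr_ge0 ?divr_ge0 ?(ltW q1)//=.
rewrite -(ler_pM2l z0) mulfV ?gt_eqF// mulrCA.
rewrite (@le_trans _ _ (c / (1 + q) * qform Q g))//.
  by rewrite ler_wpM2l// divr_ge0 ?(ltW q1).
by rewrite mulrAC ler_pdivrMr// mul1r -/q; lra.
Qed.

End rank_one.
End psd.

(** The two Gram matrices share their nonzero eigenvalues, and each zero eigenvalue contributes 1/z.
    The proof avoids spectra: tr (Q A) = m - z tr Q on either side, and cyclicity equates the two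
    traces. *)
Lemma mxtrace_resolvent_gramC m n (C : 'M[R]_(m, n)) (c z : R) : 0 <= c -> 0 < z ->
  \tr (resolvent (c *: (C *m C^T)) z) - m%:R / z =
  \tr (resolvent (c *: (C^T *m C)) z) - n%:R / z.
Proof.
move=> c0 z0; have pA := psdmx_gram C c0.
have pB : psdmx (c *: (C^T *m C)) by rewrite -{2}[C]trmxK; exact: psdmx_gram.
set A := c *: (C *m C^T) in pA *; set B := c *: (C^T *m C) in pB *.
have uA := resolvent_unit pA z0; have uB := resolvent_unit pB z0.
(* Push-through: A C = C B gives (A + z) C = C (B + z), then both inverses are applied. *)
have e : resolvent A z *m C = C *m resolvent B z.
  rewrite /resolvent -[LHS]mulmx1 -(mulmxV uB) [LHS]mulmxA; congr (_ *m _).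
  rewrite -[RHS](mulKmx uA) -mulmxA; congr (_ *m _).
  rewrite mulmxDl mulmxDr mul_scalar_mx mul_mx_scalar; congr (_ + _).
  by rewrite /A /B -scalemxAl -scalemxAr mulmxA.
have : \tr (resolvent A z *m A) = \tr (resolvent B z *m B).
  rewrite /A /B -!scalemxAr !linearZ /= mulmxA e -mulmxA mxtrace_mulC.
  by rewrite -mulmxA mxtrace_mulC -mulmxA mxtrace_mulC.
rewrite !resolventE// !linearB /= !mxtraceZ !mxtrace1 => h.
apply: (mulfI (lt0r_neq0 z0)); rewrite !mulrBr !(mulrCA z _ z^-1) divff ?lt0r_neq0// !mulr1.
by rewrite -[LHS]opprB h opprB.
Qed.

Lemma psdmx0 m : psdmx (0 : 'M[R]_m).
Proof. by split; [rewrite trmx0|move=> x; rewrite /qform mulmx0 mul0mx mxE]. Qed.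

Lemma psdmxD m (A B : 'M[R]_m) : psdmx A -> psdmx B -> psdmx (A + B).
Proof.
move=> [sA pA] [sB pB]; split; first by rewrite linearD /= sA sB.
by move=> x; rewrite qformD addr_ge0.
Qed.

Lemma psdmx_sum m (I : eqType) (s : seq I) (P : pred I) (F : I -> 'M[R]_m) :
  (forall i, P i -> psdmx (F i)) -> psdmx (\sum_(i <- s | P i) F i).
Proof.
move=> h; elim/big_ind : _ => //; [exact: psdmx0|exact: psdmxD].
Qed.

Lemma mulmx_sum_col m n p (G : 'M[R]_(m, n)) (H : 'M[R]_(n, p)) :
  G *m H = \sum_j col j G *m row j H.
Proof.
apply/matrixP => i k; rewrite mxE summxE; apply: eq_bigr => j _.
by rewrite !mxE big_ord1 !mxE.
Qed.

(** Column [j] is left out of the sum, not of the matrix: the result keeps its size and remains a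
    function of the same random [G]. *)
Definition loo_gram m n c (G : 'M[R]_(m, n)) (j : 'I_n) : 'M[R]_m :=
  \sum_(k | k != j) c *: (col k G *m (col k G)^T).

(** * Leave-one-out expansion of the resolvent trace *)

Section leave_one_out.
Context m n (G : 'M[R]_(m, n)) (z : R).
Hypotheses (m0 : (0 < m)%N) (n0 : (0 < n)%N) (z0 : 0 < z).
Let c : R := n%:R^-1.
Let s := (m%:R^-1 * \tr (resolvent (c *: (G *m G^T)) z)).
Let kappa : R := m%:R / n%:R.

Let c0 : 0 <= c. Proof. by rewrite invr_ge0. Qed.

Lemma psdmx_loo j : psdmx (loo_gram c G j).
Proof. by apply: psdmx_sum => k _; exact: psdmx_gram. Qed.

Lemma gram_loo j : c *: (G *m G^T) =
  loo_gram c G j + c *: (col j G *m (col j G)^T).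
Proof.
rewrite mulmx_sum_col scaler_sumr (bigD1 j)//= addrC tr_col; congr (_ + _).
by apply: eq_bigr => k _; rewrite tr_col.
Qed.

Let q j := c * qform (resolvent (loo_gram c G j) z) (col j G).
Let t j := c * \tr (resolvent (loo_gram c G j) z).

(** Both sides are the trace of Q A: once by Q A = 1 - z Q, once by writing A as a sum of rank-one
    terms, where [qform_resolvent_rank1] trades the full resolvent for the one that does not see
    column [j]. *)
Lemma loo_identity : m%:R * (1 - z * s) = \sum_j q j / (1 + q j).
Proof.
have pA := psdmx_gram G c0.
have mR : m%:R != 0 :> R by rewrite pnatr_eq0 -lt0n.
transitivity (\tr (resolvent (c *: (G *m G^T)) z *m (c *: (G *m G^T)))).
  rewrite resolventE// linearB /= mxtraceZ mxtrace1 /s mulrBr mulr1; congr (_ - _).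
  by field.
rewrite [X in _ *m (_ *: X)]mulmx_sum_col scaler_sumr mulmx_sumr linear_sum /=.
apply: eq_bigr => j _; rewrite /q.
rewrite -(qform_resolvent_rank1 (psdmx_loo j) z0 _ c0) -gram_loo.
rewrite -scalemxAr mxtraceZ; congr (_ * _).
rewrite mulmxA mxtrace_mulC mulmxA -tr_col.
by rewrite [X in \tr X]mx11_scalar mxtrace_scalar mulr1n.
Qed.

Lemma ler_dist_frac (x y : R) : 0 <= x -> 0 <= y ->
  `|x / (1 + x) - y / (1 + y)| <= `|x - y|.
Proof.
move=> x0 y0.
have x1 : 0 < 1 + x by lra.
have y1 : 0 < 1 + y by lra.
have -> : x / (1 + x) - y / (1 + y) = (x - y) / ((1 + x) * (1 + y)).
  by field; rewrite !gt_eqF.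
have xy : 0 <= x * y by rewrite mulr_ge0.
have xy1 : 1 <= (1 + x) * (1 + y) by lra.
rewrite normrM ler_piMr// ger0_norm ?invr_ge0 ?(le_trans ler01)//.
by rewrite invf_le1// (lt_le_trans ltr01).
Qed.

(** [t j] differs from [u] = (1/n) tr Q by at most 1/(n z), by the rank-one bound; over n columns
    this gives the single z^-1. Since [u] = kappa s with kappa = m/n, the n copies of u / (1 + u)
    add up to m s / (1 + kappa s). *)
Lemma loo_bound :
  `|(1 - z * s) - s / (1 + kappa * s)| <=
  m%:R^-1 * (\sum_j `|q j - t j| + z^-1).
Proof.
have pA := psdmx_gram G c0.
have mR : m%:R != 0 :> R by rewrite pnatr_eq0 -lt0n.
have nR : n%:R != 0 :> R by rewrite pnatr_eq0 -lt0n.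
pose u := c * \tr (resolvent (c *: (G *m G^T)) z).
have u0 : 0 <= u by rewrite mulr_ge0// mxtrace_resolvent_ge0.
have su : s = u / kappa.
  by rewrite /s /u /kappa /c; field; rewrite mR nR.
have k0 : kappa != 0 by rewrite mulf_neq0// invr_eq0.
rewrite [X in `|X|](_ : _ = m%:R^-1 * \sum_j (q j / (1 + q j) - u / (1 + u))); last first.
  rewrite sumrB -loo_identity sumr_const card_ord mulrBr mulKf//; congr (_ - _).
  rewrite su mulrCA mulfV// mulr1 -mulr_natl /kappa; field.
  by rewrite mR nR gt_eqF// ltr_wpDr.
rewrite normrM ger0_norm ?invr_ge0// ler_wpM2l ?invr_ge0//.
rewrite (le_trans (ler_norm_sum _ _ _))//.
have -> : z^-1 = \sum_(j < n) c * z^-1.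
  by rewrite sumr_const card_ord -mulrnAl -mulr_natl /c mulfV ?mul1r.
rewrite -big_split; apply: ler_sum => j _ /=.
have q0 : 0 <= q j.
  by rewrite mulr_ge0// qform_resolvent_ge0//; exact: psdmx_loo.
rewrite (le_trans (ler_dist_frac _ _))// (le_trans (ler_distD (t j) _ _))//.
rewrite lerD2l /t /u -mulrBr normrM ger0_norm// ler_wpM2l// (gram_loo j).
by have /andP[h1 h2] := mxtrace_resolvent_rank1 (psdmx_loo j) z0 (col j G) c0;
   rewrite ger0_norm.
Qed.

End leave_one_out.

(** * Perturbation of the resolvent by centering *)

Section centering.
Context m n (G : 'M[R]_(m, n)) (c z : R).
Hypotheses (m0 : (0 < m)%N) (n0 : (0 < n)%N) (c0 : 0 <= c) (z0 : 0 < z).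

Definition center_mx k : 'M[R]_k := 1%:M - k%:R^-1 *: const_mx 1.

Lemma center_mx_sym k : (center_mx k)^T = center_mx k.
Proof. by rewrite /center_mx linearB /= trmx1 linearZ /= trmx_const. Qed.

Lemma center_mx_idem k : (0 < k)%N -> center_mx k *m center_mx k = center_mx k.
Proof.
move=> k0; have kR : k%:R != 0 :> R by rewrite pnatr_eq0 -lt0n.
have JJ : const_mx 1 *m (const_mx 1 : 'M[R]_k) = k%:R *: const_mx 1 :> 'M[R]_k.
  apply/matrixP => i j; rewrite !mxE mulr1.
  by under eq_bigr do rewrite !mxE mulr1; rewrite sumr_const card_ord.
rewrite {1}/center_mx mulmxBl mul1mx -scalemxAl /center_mx mulmxBr mulmx1.
by rewrite -scalemxAr JJ scalerA mulVf// scale1r subrr scaler0 subr0.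
Qed.

(** The complement of the centering projection is 1 1^T / k, so its contribution to the Gram matrix
    has rank one. *)
Lemma gram_center p k (H : 'M[R]_(p, k)) : (0 < k)%N ->
  c *: (H *m H^T) = c *: (H *m center_mx k *m (H *m center_mx k)^T) +
    (c / k%:R) *: ((H *m const_mx 1 : 'cV_p) *m (H *m const_mx 1)^T).
Proof.
move=> k0; rewrite trmx_mul center_mx_sym mulmxA -(mulmxA H) center_mx_idem//.
rewrite /center_mx mulmxBr mulmx1 mulmxBl scalerBr -scalemxAr -scalemxAl scalerA.
rewrite trmx_mul trmx_const mulmxA -(mulmxA H).
have -> : (const_mx 1 : 'cV[R]_k) *m const_mx 1 = const_mx 1 :> 'M[R]_k.
  by apply/matrixP => i j; rewrite !mxE big_ord1 !mxE mulr1.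
by rewrite subrK.
Qed.

Lemma resolvent_center_le p k (H : 'M[R]_(p, k)) : (0 < k)%N ->
  `|\tr (resolvent (c *: (H *m center_mx k *m (H *m center_mx k)^T)) z) -
    \tr (resolvent (c *: (H *m H^T)) z)| <= z^-1.
Proof.
move=> k0; rewrite (gram_center H k0).
have ck : 0 <= c / k%:R by rewrite divr_ge0.
have /andP[h1 h2] := mxtrace_resolvent_rank1
  (psdmx_gram (H *m center_mx k) c0) z0 (H *m const_mx 1 : 'cV_p) ck.
by rewrite ger0_norm.
Qed.

(** The projection on the right is a rank-one change of the Gram matrix. The one on the left becomes
    a projection on the right after transposition, and [mxtrace_resolvent_gramC] transfers the
    estimate back: both matrices have the same size, so its offsets cancel. *)
Lemma mxtrace_resolvent_center (Y : 'M[R]_(m, n)) :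
  Y = center_mx m *m G *m center_mx n ->
  `|\tr (resolvent (c *: (Y *m Y^T)) z) -
    \tr (resolvent (c *: (G *m G^T)) z)| <= 2 / z.
Proof.
move=> YE; set H := G *m center_mx n.
rewrite (le_trans (ler_distD (\tr (resolvent (c *: (H *m H^T)) z)) _ _))//.
have -> : 2 / z = z^-1 + z^-1 by rewrite -mulr2n mulr_natl.
apply: lerD; last exact: resolvent_center_le.
have h := mxtrace_resolvent_gramC H c0 z0.
have hY := mxtrace_resolvent_gramC Y c0 z0.
have := resolvent_center_le H^T m0.
have YH : Y^T = H^T *m center_mx m.
  by rewrite YE -mulmxA trmx_mul center_mx_sym.
rewrite -YH.
rewrite !trmxK; move: h hY; move: (\tr _) (\tr _) (\tr _) (\tr _) => a b d e.
move: (m%:R / z) (n%:R / z) => x y h1 h2.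
by have -> : b - e = a - d by lra.
Qed.

End centering.

End resolvent.

(** * Gaussian integrals *)

Section density.
Context d (T : measurableType d) (R : realType).
Variables (mu nu : {measure set T -> \bar R}) (f : T -> R).
Hypotheses (mf : measurable_fun setT f) (f0 : forall x, 0 <= f x).
Hypothesis nuE : forall A, measurable A -> nu A = (\int[mu]_(x in A) (f x)%:E)%E.
Local Open Scope ereal_scope.

Import HBNNSimple.

Let density_nnsfun (h : {nnsfun T >-> R}) :
  \int[nu]_x (h x)%:E = \int[mu]_x ((h x)%:E * (f x)%:E).
Proof.
under [LHS]eq_integral do rewrite fimfunE -fsumEFin//.
rewrite [LHS]ge0_integral_fsum//; last 2 first.
  - by move=> r; exact/measurable_EFinP/measurableT_comp.
  - by move=> n x _; rewrite EFinM nnfun_muleindic_ge0.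
under [RHS]eq_integral.
  move=> x _; rewrite fimfunE -fsumEFin// ge0_mule_fsuml; last first.
    by move=> r; rewrite EFinM nnfun_muleindic_ge0.
  over.
rewrite [RHS]ge0_integral_fsum//; last 2 first.
  - move=> r; apply: emeasurable_funM; last exact/measurable_EFinP.
    exact/measurable_EFinP/measurableT_comp.
  - move=> n x _; rewrite mule_ge0//; last by rewrite lee_fin.
    by rewrite EFinM nnfun_muleindic_ge0.
apply: eq_fsbigr => r _.
(* A nonnegative simple function has an empty preimage at a negative value. *)
have [r0|r0] := leP 0%R r; last first.
  have hr := preimage_nnfun0 h r0.
  rewrite [LHS]integral0_eq ?[RHS]integral0_eq// => x _.
    by rewrite hr indic0 mulr0 mul0e.
  by rewrite hr indic0 mulr0.
under [RHS]eq_integral do rewrite EFinM -muleA.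
rewrite integralZl_indic_nnsfun// ge0_integralZl//; last 2 first.
  - apply: emeasurable_funM; last exact/measurable_EFinP.
    exact/measurable_EFinP/measurable_indic.
  - by move=> x _; rewrite mule_ge0 ?lee_fin.
congr (_ * _); rewrite integral_indic// setIT nuE// integral_mkcond.
apply: eq_integral => x _; rewrite patchE indicE.
by case: ifPn => _; rewrite ?mul1e ?mul0e.
Qed.

(** Simple functions first, then monotone convergence. It serves both the Gaussian density and the
    absolutely continuous part of the limit law. *)
Lemma ge0_integral_density (F : T -> \bar R) :
  measurable_fun setT F -> (forall x, 0 <= F x) ->
  \int[nu]_x F x = \int[mu]_x (F x * (f x)%:E).
Proof.
move=> mF F0; pose F_ := nnsfun_approx measurableT mF.
have FE x : (F_ n x)%:E @[n --> \oo] --> F x by exact: cvg_nnsfun_approx.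
transitivity (limn (fun n => \int[nu]_x (F_ n x)%:E)).
  rewrite -monotone_convergence//=.
  - by apply: eq_integral => x _; apply/esym/cvg_lim => //; exact: FE.
  - by move=> n; exact/measurable_EFinP.
  - by move=> n x _; rewrite lee_fin.
  - by move=> x _ a b ab; rewrite lee_fin; exact/lefP/nd_nnsfun_approx.
under eq_fun do rewrite density_nnsfun.
rewrite -monotone_convergence//=.
- apply: eq_integral => x _; apply/cvg_lim => //.
  by apply: cvgeZr => //; exact: FE.
- move=> n; apply: emeasurable_funM; exact/measurable_EFinP.
- by move=> n x _; rewrite mule_ge0 ?lee_fin.
- move=> x _ a b ab; rewrite lee_wpmul2r ?lee_fin//.
  exact/lefP/nd_nnsfun_approx.
Qed.

End density.

Section affine.
Context (R : realType).
Local Notation mu := (@lebesgue_measure R).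
Variables (a b : R).
Hypothesis a0 : 0 < a.

Definition affine_fun (x : measurableTypeR R) : measurableTypeR R := a * x + b.

Lemma measurable_affine_fun : measurable_fun setT affine_fun.
Proof.
apply: measurable_funD; last exact: measurable_cst.
by apply: measurable_funM; [exact: measurable_cst|exact: measurable_id].
Qed.

HB.instance Definition _ := isMeasurableFun.Build _ _ _ _
  affine_fun measurable_affine_fun.

Let image_mu : {measure set (measurableTypeR R) -> \bar R} :=
  measure_function_pushforward__canonical__measure_function_Measure
    mu measurable_affine_fun.

(** The image measure, rescaled by [a], has the right value on half-open intervals, and these
    determine Lebesgue measure. *)
Lemma lebesgue_measure_affine A : measurable A ->
  (mu A = mscale (NngNum (ltW a0)) image_mu A)%E.
Proof.
move=> mA; apply: lebesgue_measure_unique => // _ [[p q]] _ <-.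
transitivity (a%:E * mu (affine_fun @^-1` `]p, q]))%E; last by [].
have -> : affine_fun @^-1` `]p, q] = `](p - b) / a, (q - b) / a]%classic.
  apply/seteqP; split => x /=; rewrite !in_itv /= /affine_fun
    ltr_pdivrMr// ler_pdivlMr// ltrBlDr lerBrDr (mulrC a) //.
rewrite !lebesgue_measure_itv /= !lte_fin ltr_pM2r ?invr_gt0// ltrD2r.
case: ifPn => _; last by rewrite mule0.
by rewrite -!EFinD -EFinM; congr (_%:E); field; rewrite gt_eqF.
Qed.

Lemma ge0_integral_affine (F : R -> \bar R) :
  measurable_fun setT F -> (forall x, 0 <= F x)%E ->
  (\int[mu]_x F x = a%:E * \int[mu]_x F (a * x + b)%R)%E.
Proof.
move=> mF F0.
rewrite (eq_measure_integral
  (mscale (NngNum (ltW a0)) image_mu)); last first.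
  by move=> A mA _; exact: lebesgue_measure_affine.
by rewrite ge0_integral_mscale//= ge0_integral_pushforward.
Qed.

End affine.

(** * Moments of the standard Gaussian *)

Section gaussian.
Context (R : realType).
Local Notation mu := (@lebesgue_measure R).
Local Notation phi := (normal_pdf (0 : R) 1).
Local Notation gamma := (std_gaussian R).

Lemma measurable_phi : measurable_fun setT phi.
Proof. exact: measurable_normal_pdf. Qed.

Lemma phi_ge0 x : 0 <= phi x. Proof. exact: normal_pdf_ge0. Qed.

Lemma phiE x : phi x = normal_peak 1 * expR (- (x ^+ 2 / 2)).
Proof.
rewrite /normal_pdf (negbTE (oner_neq0 _)) /normal_fun.
by rewrite subr0 expr1n -mulr_natl mulr1 mulNr.
Qed.

Lemma integral_std_gaussian (F : R -> \bar R) :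
  measurable_fun setT F -> (forall x, 0 <= F x)%E ->
  (\int[gamma]_x F x = \int[mu]_x (F x * (phi x)%:E))%E.
Proof.
move=> mF F0; rewrite /std_gaussian /distribution ge0_integral_pushforward//.
rewrite (ge0_integral_density (mu := mu) (f := phi))//.
- exact: measurable_normal_pdf.
- exact: phi_ge0.
Qed.

Lemma derive_phi (x : R) : is_derive x 1 phi (- x * phi x).
Proof.
have -> : phi = (fun x => normal_peak 1 * expR (- (x * x / 2))).
  by apply/funext => y; rewrite phiE expr2.
have dx := is_derive_id x 1.
have dh : is_derive x 1 (fun y : R => - (y * y / 2)) (- x).
  have := derive1_opp (derive1_mul (derive1_mul dx dx) (is_derive_cst (2^-1 : R) x 1)).
  by move/is_derive_eq; apply; rewrite /cst/=; field.
have := derive1_cstl (normal_peak 1) (derive1_chain dh (is_derive_expR _)).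
by move/is_derive_eq; apply; ring.
Qed.

Lemma continuous_phi : continuous phi.
Proof. by apply: continuous_normal_pdf; exact: oner_neq0. Qed.

Let G k (x : R) : R := x ^+ k * phi x.

Let cG k : continuous (G k).
Proof.
by move=> x; apply: cvgM; [exact: exprn_continuous|exact: continuous_phi].
Qed.

Let mG k : measurable_fun setT (G k).
Proof. exact: continuous_measurable_fun. Qed.

Let iG k (a b : R) : mu.-integrable `[a, b] (EFin \o G k).
Proof.
apply: continuous_compact_integrable; first exact: segment_compact.
by apply: continuous_subspaceT => x; exact: cG.
Qed.

(** Since phi' = - x phi, this is integration by parts in differential form: it links the moments of
    order k + 2 and k. *)
Let derive_G k (x : R) :
  is_derive x 1 (fun x => - G k.+1 x) (G k.+2 x - k.+1%:R * G k x).
Proof.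
have := derive1_opp (derive1_mul (derive1_pow k.+1 (is_derive_id x 1)) (derive_phi x)).
by move/is_derive_eq; apply; rewrite /G /= !exprS; ring.
Qed.

Let J n : set R := `[- (n.+1%:R : R), n.+1%:R]%classic.

Let ibp k n :
  (\int[mu]_(x in J n) (G k.+2 x)%:E =
   k.+1%:R%:E * \int[mu]_(x in J n) (G k x)%:E +
   (G k.+1 (- n.+1%:R) - G k.+1 n.+1%:R)%:E)%E.
Proof.
have n0 : - n.+1%:R < n.+1%:R :> R by rewrite gtrN.
have cF : continuous (fun x => - G k.+1 x).
  by move=> x; apply: cvgN; exact: cG.
have FTC := @continuous_FTC2 R (fun x => G k.+2 x - k.+1%:R * G k x)
  (fun x => - G k.+1 x) _ _ n0.
rewrite [in RHS](addrC (G _ _)) -[in RHS](opprK (G k.+1 (- _))) EFinB -FTC; last 3 first.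
- apply: continuous_subspaceT => x; apply: cvgB; first exact: cG.
  by apply: cvgM; [exact: cvg_cst|exact: cG].
- split.
  + by move=> x _; case: (derive_G k x).
  + by apply: cvg_at_right_filter; exact: cF.
  + by apply: cvg_at_left_filter; exact: cF.
- by move=> x _; rewrite derive1E; case: (derive_G k x).
have iZ : mu.-integrable (J n) (fun x => (k.+1%:R * G k x)%:E).
  by under eq_fun do rewrite EFinM; apply: integrableZl; [exact: measurable_itv|exact: iG].
rewrite -integralZl//; last exact: iG.
have iD : mu.-integrable (J n) (fun x => (G k.+2 x - k.+1%:R * G k x)%:E).
  under eq_fun do rewrite EFinB.
  by apply: integrableB => //; [exact: measurable_itv|exact: iG].
rewrite -integralD//=; last exact: measurable_itv.
by apply: eq_integral => x _; rewrite -EFinM -EFinD; congr (_%:E); ring.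
exact: measurable_itv.
Qed.

Let tail k n : (k <= 2)%N ->
  `|G k.+1 (- n.+1%:R) - G k.+1 n.+1%:R| <= 16 * normal_peak 1 / n.+1%:R.
Proof.
move=> k2; set N : R := n.+1%:R.
have N1 : 1 <= N by rewrite ler1n.
have N0 : 0 < N by exact: lt_le_trans N1.
have p0 : 0 <= normal_peak (1 : R) by exact: normal_peak_ge0.
have hG : G k.+1 N <= 8 * normal_peak 1 / N.
  rewrite ler_pdivlMr// /G phiE.
  rewrite (@le_trans _ _ (N ^+ 3 * (normal_peak 1 * expR (- (N ^+ 2 / 2))) * N))//.
    apply: ler_wpM2r; first exact: ltW.
    apply: ler_wpM2r; first by rewrite mulr_ge0// expR_ge0.
    by rewrite ler_weXn2l.
  have -> : N ^+ 3 * (normal_peak 1 * expR (- (N ^+ 2 / 2))) * N =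
      N ^+ 4 * expR (- (N ^+ 2 / 2)) * normal_peak 1 by ring.
  rewrite ler_wpM2r// expRN ler_pdivrMr ?expR_gt0//.
  have h0 : 0 <= N ^+ 2 / 2 by rewrite divr_ge0 ?sqr_ge0.
  (* exp y >= 1 + y^2 / 2 at y = N^2 / 2 gives N^4 exp (- N^2 / 2) <= 8; the two end points together
     account for 16. *)
  have := expR_ge1Dxn 1 h0; rewrite (_ : 2`!%:R = 2)//.
  have -> : (N ^+ 2 / 2) ^+ 2 / 2 = N ^+ 4 / 8 by field.
  by move=> ?; lra.
have -> : G k.+1 (- N) = (-1) ^+ k.+1 * G k.+1 N.
  by rewrite /G (exprNn N) !phiE sqrrN !mulrA.
rewrite (le_trans (ler_normB _ _))// normrM normrX normrN1 expr1n mul1r.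
have G0 : 0 <= G k.+1 N by rewrite mulr_ge0 ?phi_ge0// exprn_ge0// ltW.
have -> : 16 * normal_peak 1 / N = 8 * normal_peak 1 / N + 8 * normal_peak 1 / N by ring.
by rewrite ger0_norm// lerD.
Qed.

(** Even powers make the integrands nonnegative, so the integrals over [-N, N] increase to the full
    ones while the boundary terms vanish like 1/N. Finiteness of the lower moment licenses the sum
    of the limits. *)
Let moment_rec k : (k <= 2)%N -> ~~ odd k ->
  (\int[mu]_x (G k x)%:E)%E \is a fin_num ->
  (\int[mu]_x (G k.+2 x)%:E = k.+1%:R%:E * \int[mu]_x (G k x)%:E)%E.
Proof.
move=> k2 ek fk.
have G0 j x : ~~ odd j -> 0 <= G j x.
  by move=> ej; rewrite mulr_ge0 ?phi_ge0// exprn_even_ge0.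
have UJ : \bigcup_n J n = setT.
  apply/seteqP; split => // x _; exists (Num.truncn `|x|) => //=.
  by rewrite /J /= in_itv /= -ler_norml ltW// truncnS_gt.
have cvgJ j : ~~ odd j -> (\int[mu]_(x in J n) (G j x)%:E)%E @[n --> \oo] -->
    (\int[mu]_x (G j x)%:E)%E.
  move=> ej; rewrite -UJ; apply: ge0_nondecreasing_set_cvg_integral => //.
  - move=> a b ab; apply/subsetPset => x; rewrite /J /= !in_itv /= -!ler_norml.
    by move=> /le_trans; apply; rewrite ler_nat ltnS.
  - by move=> n; exact: measurable_itv.
  - by move=> n; apply: measurable_funTS; apply/measurable_EFinP; exact: mG.
  - by move=> n x _; rewrite lee_fin G0.
have h1 := cvgJ k.+2 _; have h0 := cvgJ k ek.
have {}h1 := h1 ltac:(by rewrite /= negbK).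
rewrite -(cvg_lim _ h1)//; apply/cvg_lim => //.
under eq_fun do rewrite ibp.
rewrite -(adde0 (k.+1%:R%:E * \int[mu]_x (G k x)%:E)%E).
apply: cvgeD; first by rewrite fin_num_adde_defl.
- by apply: cvgeZl => //; exact: h0.
- apply: cvg_EFin; first exact: nearW.
  apply: (@squeeze_cvgr _ _ _ _ (fun n : nat => - (16 * normal_peak 1 / n.+1%:R))
    (fun n : nat => 16 * normal_peak 1 / n.+1%:R)).
  + by apply: nearW => n; rewrite -ler_norml tail.
  + rewrite -[X in _ --> X]oppr0; apply: cvgN; rewrite -(mulr0 (16 * normal_peak 1)).
    by apply: cvgM; [exact: cvg_cst|exact: cvg_harmonic].
  + rewrite -(mulr0 (16 * normal_peak 1)).
    by apply: cvgM; [exact: cvg_cst|exact: cvg_harmonic].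
Qed.

Lemma gaussian_moment0 : (\int[mu]_x (phi x)%:E = 1)%E.
Proof. exact: integral_normal_pdf. Qed.

Lemma gaussian_moment2 : (\int[mu]_x (x ^+ 2 * phi x)%:E = 1)%E.
Proof.
have m0 : (\int[mu]_x (G 0 x)%:E = 1)%E.
  by under eq_integral do rewrite /G expr0 mul1r; exact: gaussian_moment0.
by rewrite -/(G 2 _) (@moment_rec 0%N)// m0 ?mule1.
Qed.

Lemma gaussian_moment4 : (\int[mu]_x (x ^+ 4 * phi x)%:E = 3%:E)%E.
Proof.
have m2 : (\int[mu]_x (G 2 x)%:E = 1)%E by exact: gaussian_moment2.
by rewrite (@moment_rec 2%N)// m2 ?mule1.
Qed.

Lemma ge0_integral_oppr (F : R -> \bar R) :
  measurable_fun setT F -> (forall x, 0 <= F x)%E ->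
  (\int[mu]_x F x = \int[mu]_x F (- x)%R)%E.
Proof.
move=> mF F0.
have mN : measurable_fun setT (-%R : measurableTypeR R -> measurableTypeR R).
  exact: measurable_funN.
pose nu := measure_function_pushforward__canonical__measure_function_Measure mu mN.
rewrite (eq_measure_integral nu); last first.
  by move=> A mA _; apply/esym/lebesgue_measureN.
by rewrite ge0_integral_pushforward.
Qed.

(** x^2 - 1, x and 1 are orthogonal Hermite polynomials of squared norms 2, 1, 1. Apart from
    measurability, this is all that the variance of a quadratic form will require of the law. *)
Lemma std_gaussian_quadratic (a b c : R) :
  (\int[gamma]_x ((a * (x ^+ 2 - 1) + b * x + c) ^+ 2)%:E =
   (2 * a ^+ 2 + b ^+ 2 + c ^+ 2)%:E)%E.
Proof.
pose P x : R := (a * (x ^+ 2 - 1) + b * x + c) ^+ 2.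
have cP : continuous P.
  move=> x; rewrite /P.
  suff cp : continuous (fun x : R => a * (x ^+ 2 - 1) + b * x + c).
    exact: (continuous_comp (cp x) (@exprn_continuous _ 2 _)).
  move=> y; apply: cvgD; last exact: cvg_cst.
  apply: cvgD; apply: cvgM; [exact: cvg_cst| |exact: cvg_cst|exact: cvg_id].
  by apply: cvgB; [exact: exprn_continuous|exact: cvg_cst].
have mP : measurable_fun setT P by exact: continuous_measurable_fun.
have P0 x : 0 <= P x by exact: sqr_ge0.
rewrite integral_std_gaussian//; last exact/measurable_EFinP.
have mPphi : measurable_fun setT (fun x => (P x)%:E * (phi x)%:E)%E.
  by apply: emeasurable_funM; apply/measurable_EFinP => //; exact: measurable_phi.
have Pphi0 x : (0 <= (P x)%:E * (phi x)%:E)%E.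
  by rewrite mule_ge0 ?lee_fin ?phi_ge0.
rewrite -/P; set I := LHS.
(* Doubling and reflecting x keeps only the even part of the integrand, so no odd moment is
   needed. *)
have I2 : (I + I = \int[mu]_x ((P x + P (- x)) * phi x)%:E)%E.
  rewrite {2}/I (ge0_integral_oppr mPphi Pphi0) -ge0_integralD//.
  - apply: eq_integral => x _; rewrite !phiE sqrrN -!EFinM -EFinD.
    by rewrite mulrDl.
  - by move=> x _; exact: Pphi0.
  - have mN : measurable_fun [set: R] (fun x : R => - x) by exact: measurable_funN.
    exact: (measurableT_comp mPphi mN).
have i0 : mu.-integrable setT (fun x => (phi x)%:E).
  exact: integrable_normal_pdf.
have ix k : (\int[mu]_x (x ^+ k * phi x)%:E < +oo)%E -> ~~ odd k ->
    mu.-integrable setT (fun x => (x ^+ k * phi x)%:E).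
  move=> fk ek; apply/integrableP; split; first by apply/measurable_EFinP; exact: (mG k).
  apply: le_lt_trans fk; under eq_integral => x _.
    by rewrite gee0_abs ?lee_fin ?mulr_ge0 ?phi_ge0 ?exprn_even_ge0//; over.
  done.
have i2 := ix 2%N ltac:(by rewrite gaussian_moment2 ltry) isT.
have i4 := ix 4%N ltac:(by rewrite gaussian_moment4 ltry) isT.
have : (I + I = (4 * a ^+ 2 + 2 * b ^+ 2 + 2 * c ^+ 2)%:E)%E.
  rewrite I2.
  transitivity (\int[mu]_x ((2 * a ^+ 2)%:E * (x ^+ 4 * phi x)%:E +
    ((4 * a * (c - a) + 2 * b ^+ 2)%:E * (x ^+ 2 * phi x)%:E +
     (2 * (c - a) ^+ 2)%:E * (phi x)%:E)))%E.
    apply: eq_integral => x _; rewrite -!EFinM -!EFinD /P; congr (_%:E); ring.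
  have j4 := integrableZl measurableT (2 * a ^+ 2) i4.
  have j2 := integrableZl measurableT (4 * a * (c - a) + 2 * b ^+ 2) i2.
  have j0 := integrableZl measurableT (2 * (c - a) ^+ 2) i0.
  rewrite integralD//; last exact: integrableD.
  rewrite integralD// !integralZl//.
  rewrite gaussian_moment0 gaussian_moment2 gaussian_moment4.
  by rewrite -!EFinM -!EFinD; congr (_%:E); ring.
have : (0 <= I)%E by apply: integral_ge0 => x _; exact: Pphi0.
case: I {I2} => // r _ [] h.
by congr (_%:E); lra.
Qed.

End gaussian.

(** * Invariance of a pair of Gaussians under plane reflections *)

Section reflection.
Context (R : realType).
Local Notation mu := (@lebesgue_measure R).
Local Notation phi := (normal_pdf (0 : R) 1).
Local Notation gamma := (std_gaussian R).
Local Open Scope ereal_scope.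

Let phi2 (x y : R) : R := (phi x * phi y)%R.

Lemma measurable_phi2 : measurable_fun setT (fun p : R * R => phi2 p.1 p.2).
Proof.
by apply: measurable_funM; apply: measurableT_comp => //; exact: measurable_phi.
Qed.

Lemma integral_std_gaussian2 (F : R * R -> \bar R) :
  measurable_fun setT F -> (forall p, 0 <= F p) ->
  \int[gamma]_x \int[gamma]_y F (x, y) =
  \int[mu]_x \int[mu]_y (F (x, y) * (phi2 x y)%:E).
Proof.
move=> mF F0.
have mFx x : measurable_fun setT (fun y => F (x, y)).
  exact: measurable_fun_pair2.
rewrite integral_std_gaussian; last 2 first.
- by apply: (measurable_fun_fubini_tonelli_F (m2 := gamma) F).
- by move=> x; exact: integral_ge0.
apply: eq_integral => x _; rewrite integral_std_gaussian//.
rewrite -ge0_integralZr//=.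
- by apply: eq_integral => y _; rewrite -muleA -EFinM /phi2 mulrC.
- apply: emeasurable_funM; first exact: (mFx x).
  by apply/measurable_EFinP; exact: measurable_normal_pdf.
- by move=> y _; rewrite mule_ge0// lee_fin phi_ge0.
- by rewrite lee_fin phi_ge0.
Qed.

Lemma lebesgue_fubini_tonelli (F : R * R -> \bar R) :
  measurable_fun setT F -> (forall p, 0 <= F p) ->
  \int[mu]_x \int[mu]_y F (x, y) = \int[mu]_y \int[mu]_x F (x, y).
Proof.
move=> mF F0.
have mF' : measurable_fun [set: measurableTypeR R * measurableTypeR R] F.
  exact: mF.
exact: (fubini_tonelli (m1 := mu) (m2 := mu) F mF' F0).
Qed.

(** Two one-dimensional affine substitutions replace a change of variables in the plane: u = c x + s
    y for fixed x, then, after exchanging the integrals, x = s v + c u. The factors 1/s and s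
    cancel, and c^2 + s^2 = 1 preserves the density. *)
Lemma std_gaussian_reflection (c s : R) (F : R * R -> \bar R) :
  (0 < s)%R -> (c ^+ 2 + s ^+ 2 = 1)%R ->
  measurable_fun setT F -> (forall p, 0 <= F p) ->
  \int[gamma]_x \int[gamma]_y F (c * x + s * y, s * x - c * y)%R =
  \int[gamma]_x \int[gamma]_y F (x, y).
Proof.
move=> s0 cs mF F0.
pose H (p : R * R) := F (c * p.1 + s * p.2, s * p.1 - c * p.2)%R.
have mH : measurable_fun setT H.
  apply: (measurableT_comp mF); apply/measurable_fun_pairP; split.
    by apply: measurable_funD; apply: measurable_funM.
  by apply: measurable_funB; apply: measurable_funM.
have H0 p : 0 <= H p by exact: F0.
apply: (etrans (integral_std_gaussian2 mH H0)).
apply: (etrans _ (esym (integral_std_gaussian2 mF F0))).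
pose K (p : R * R) := H p * (phi2 p.1 p.2)%:E.
have mK : measurable_fun setT K.
  by apply: emeasurable_funM => //; apply/measurable_EFinP; exact: measurable_phi2.
have K0 p : 0 <= K p by rewrite mule_ge0// lee_fin mulr_ge0 ?phi_ge0.
pose L (p : R * R) := K (p.1, s^-1 * p.2 + - (c * p.1 / s))%R.
have mL : measurable_fun setT L.
  apply: (measurableT_comp mK); apply/measurable_fun_pairP; split.
    exact: measurable_fst.
  apply: measurable_funD; first by apply: measurable_funM.
  apply: measurable_funN; apply: measurable_funM => //.
  by apply: measurable_funM.
have L0 p : 0 <= L p by exact: K0.
have sV : (0 < s^-1)%R by rewrite invr_gt0.
transitivity (\int[mu]_x ((s^-1)%:E * \int[mu]_u L (x, u))).
  apply: eq_integral => x _.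
  rewrite -(@ge0_integral_affine _ _ (- (c * x / s)) sV (fun y => K (x, y)))//.
  exact: measurable_fun_pair2.
rewrite ge0_integralZl//=; last 3 first.
- by apply: (measurable_fun_fubini_tonelli_F (m2 := mu) L).
- by move=> x _; exact: integral_ge0.
- by rewrite lee_fin ltW.
transitivity ((s^-1)%:E * \int[mu]_u \int[mu]_x L (x, u)).
  have e := lebesgue_fubini_tonelli mL L0. exact: (congr1 (mule (s^-1)%:E) e).
transitivity ((s^-1)%:E * \int[mu]_u (s%:E * \int[mu]_v L (s * v + c * u, u)%R)).
  congr (_ * _); apply: eq_integral => u _.
  by rewrite (@ge0_integral_affine _ s (c * u) s0 (fun x => L (x, u)))//;
    exact: measurable_fun_pair1.
pose M (p : R * R) := L (s * p.2 + c * p.1, p.1)%R.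
have M0 p : 0 <= M p by exact: L0.
have mM : measurable_fun setT M.
  apply: (measurableT_comp mL); apply/measurable_fun_pairP.
  split; last exact: measurable_fst.
  by apply: measurable_funD; apply: measurable_funM.
rewrite ge0_integralZl//=; last 3 first.
- by apply: (measurable_fun_fubini_tonelli_F (m2 := mu) M).
- by move=> x _; exact: integral_ge0.
- by rewrite lee_fin ltW.
rewrite muleA -EFinM mulVf ?gt_eqF// mul1e.
apply: eq_integral => u _; apply: eq_integral => v _.
rewrite /L /K /H /= /phi2.
have s1 : s != 0%R by rewrite gt_eqF.
have -> : (s^-1 * u + - (c * (s * v + c * u) / s) = s * u - c * v)%R.
  rewrite (_ : s^-1 * u = (c ^+ 2 + s ^+ 2) * u / s)%R; first by field.
  by rewrite cs mul1r mulrC.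
congr (F (_, _) * _%:E).
- transitivity ((c ^+ 2 + s ^+ 2) * u)%R; first by ring.
  by rewrite cs mul1r.
- transitivity ((c ^+ 2 + s ^+ 2) * v)%R; first by ring.
  by rewrite cs mul1r.
- rewrite !phiE mulrACA [RHS]mulrACA -!expRD; congr (_ * expR _)%R.
  transitivity (- ((c ^+ 2 + s ^+ 2) * (u ^+ 2 + v ^+ 2)) / 2)%R; first by field.
  by rewrite cs; field.
Qed.

End reflection.

(** * Laws of i.i.d. vectors and matrices *)

Lemma measurable_fun_tcons d1 d2 (S : measurableType d1) (T : measurableType d2)
    n (f : S -> T) (g : S -> n.-tuple T) :
  measurable_fun setT f -> measurable_fun setT g ->
  measurable_fun setT (fun x => tcons (f x, g x)).
Proof.
move=> mf mg; apply: (measurableT_comp (@measurable_tcons _ T n)).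
exact/measurable_fun_pairP.
Qed.

Section iid_integrals.
Context d (T : measurableType d) (R : realType) (P : probability T R).
Local Open Scope ereal_scope.

Lemma ge0_integral_iid_tupleS n (F : n.+1.-tuple T -> \bar R) :
  measurable_fun setT F -> (forall t, 0 <= F t) ->
  \int[iid_tuple P n.+1]_t F t =
  \int[P]_x \int[iid_tuple P n]_t F (tcons (x, t)).
Proof.
move=> mF F0; rewrite /iid_tuple -/iid_tuple /distribution ge0_integral_pushforward//.
rewrite preimage_setT (fubini_tonelli1 (m1 := P) (m2 := iid_tuple P n))//.
  by apply: measurableT_comp => //; exact: measurable_tcons.
by move=> x; exact: F0.
Qed.

Lemma ge0_integral_iid_mx m n (F : 'M[T]_(m, n) -> \bar R) :
  measurable_fun setT F -> (forall t, 0 <= F t) ->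
  \int[iid_mx P m n]_x F x =
  \int[iid_tuple (iid_tuple P n) m]_t F (mx_of_tuples t).
Proof. by move=> mF F0; rewrite /iid_mx /distribution ge0_integral_pushforward. Qed.

(** Invariance of [P] is stated on nonnegative integrals, so that it composes and can be inverted
    without forming image measures. *)
Definition preserves (f : T -> T) := measurable_fun setT f /\
  forall F : T -> \bar R, measurable_fun setT F -> (forall x, 0 <= F x) ->
    \int[P]_x F (f x) = \int[P]_x F x.

End iid_integrals.

Section preserving.
Context d (T : measurableType d) (R : realType) (P : probability T R).
Local Open Scope ereal_scope.

Lemma preserves_comp (f g : T -> T) :
  preserves P f -> preserves P g -> preserves P (f \o g).
Proof.
move=> [mf pf] [mg pg]; split; first exact: measurableT_comp.
move=> F mF F0.
have mFf : measurable_fun setT (F \o f) by exact: measurableT_comp.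
by rewrite -(pf _ mF F0) -(pg _ mFf (fun x => F0 (f x))).
Qed.

Lemma measurable_map_tuple n (f : T -> T) : measurable_fun setT f ->
  measurable_fun setT (fun t : n.-tuple T => [tuple of map f t]).
Proof.
move=> mf; apply/measurable_fun_tnthP => i.
rewrite (_ : _ \o _ = f \o (fun t : n.-tuple T => tnth t i)); last first.
  by apply/funext => t /=; rewrite tnth_map.
by apply: measurableT_comp => //; exact: measurable_tnth.
Qed.

Lemma preserves_map_tuple n (f : T -> T) : preserves P f ->
  preserves (iid_tuple P n) (fun t => [tuple of map f t]).
Proof.
move=> [mf pf]; split; first exact: measurable_map_tuple.
elim: n => [|n IH] F mF F0.
  by apply: eq_integral => t _; congr F; apply/val_inj; rewrite /= tuple0.
pose G (p : T * n.-tuple T) := F (tcons p).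
have mG : measurable_fun setT G.
  by apply: measurableT_comp => //; exact: measurable_tcons.
rewrite !ge0_integral_iid_tupleS//; last first.
  by apply: (measurableT_comp mF); exact: measurable_map_tuple.
transitivity (\int[P]_x \int[iid_tuple P n]_t G (f x, t)).
  apply: eq_integral => x _.
  rewrite -(IH (fun t => G (f x, t)) (measurable_fun_pair2 (f x) mG) (fun t => F0 _)).
  by apply: eq_integral => t _; congr F; apply/val_inj.
have G0 p : 0 <= G p by exact: F0.
apply: (pf (fun x => \int[iid_tuple P n]_t G (x, t))) => //.
- by apply: (measurable_fun_fubini_tonelli_F (m2 := iid_tuple P n) G).
- by move=> x; exact: integral_ge0.
Qed.

End preserving.

(** * Orthogonal matrices acting on Gaussian vectors *)

Section orthogonal.
Context (R : realType).
Local Notation gamma := (std_gaussian R).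
Local Open Scope ereal_scope.

Definition tuple_mulmx m n (U : 'M[R]_(m, n)) (t : n.-tuple R) : m.-tuple R :=
  [tuple \sum_j U i j * tnth t j | i < m]%R.

Lemma measurable_tuple_mulmx m n (U : 'M[R]_(m, n)) :
  measurable_fun setT (tuple_mulmx U).
Proof.
apply/measurable_fun_tnthP => i.
rewrite (_ : _ \o _ = (fun t : n.-tuple R => \sum_j U i j * tnth t j)%R); last first.
  by apply/funext => t /=; rewrite tnth_mktuple.
apply: measurable_sum => j; apply: measurable_funM => //.
exact: measurable_tnth.
Qed.

Lemma tuple_mulmxM m n p (U : 'M[R]_(m, n)) (V : 'M[R]_(n, p)) t :
  tuple_mulmx (U *m V) t = tuple_mulmx U (tuple_mulmx V t).
Proof.
apply: eq_from_tnth => i; rewrite !tnth_mktuple.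
under eq_bigr do rewrite mxE mulr_suml; rewrite exchange_big /=.
apply: eq_bigr => j _; rewrite tnth_mktuple mulr_sumr.
by apply: eq_bigr => k _; rewrite mulrA.
Qed.

Definition preserves_iid n (U : 'M[R]_n) :=
  preserves (iid_tuple gamma n) (tuple_mulmx U).

Lemma preserves_iidM n (U V : 'M[R]_n) :
  preserves_iid U -> preserves_iid V -> preserves_iid (U *m V).
Proof.
move=> pU pV; rewrite /preserves_iid (_ : tuple_mulmx _ = tuple_mulmx U \o tuple_mulmx V).
  exact: preserves_comp.
by apply/funext => t; rewrite tuple_mulmxM.
Qed.

Lemma preserves_iid1 n : preserves_iid (1%:M : 'M[R]_n).
Proof.
have e t : tuple_mulmx (1%:M : 'M[R]_n) t = t.
  apply: eq_from_tnth => i; rewrite tnth_mktuple (bigD1 i)//= big1.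
    by rewrite mxE eqxx mul1r addr0.
  by move=> j /negPf ji; rewrite mxE eq_sym ji mul0r.
split; first exact: measurable_tuple_mulmx.
by move=> F mF F0; apply: eq_integral => t _; rewrite e.
Qed.

Lemma tnth_tcons0 d (T : measurableType d) n (p : T * n.-tuple T) :
  tnth (tcons p) ord0 = p.1.
Proof. by []. Qed.

Lemma tnth_tconsS d (T : measurableType d) n (p : T * n.-tuple T) i :
  tnth (tcons p) (lift ord0 i) = tnth p.2 i.
Proof. exact: tnthS. Qed.

Lemma tuple_mulmx_block n (U : 'M[R]_n) (x : R) t :
  tuple_mulmx (block_mx 1%:M 0 0 U : 'M[R]_(1 + n)) (tcons (x, t)) =
  tcons (x, tuple_mulmx U t).
Proof.
apply: eq_from_tnth => i; rewrite tnth_mktuple (@big_split_ord _ _ _ 1%N n) big_ord1 /=.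
have l0 : lshift n (ord0 : 'I_1) = ord0 by apply/val_inj.
have rS j : rshift 1 j = lift ord0 j :> 'I_n.+1 by apply/val_inj.
have [j ->|->] := unliftP ord0 i.
  rewrite [RHS]tnth_tconsS tnth_mktuple -rS block_mxEdl mxE mul0r add0r.
  by apply: eq_bigr => k _; rewrite block_mxEdr rS tnth_tconsS.
rewrite [RHS]tnth_tcons0 -{1}l0 block_mxEul mxE mul1r l0 tnth_tcons0.
by rewrite big1 ?addr0// => k _; rewrite -l0 block_mxEur mxE mul0r.
Qed.

Lemma preserves_iid_block n (U : 'M[R]_n) : preserves_iid U ->
  preserves_iid (block_mx 1%:M 0 0 U : 'M[R]_(1 + n)).
Proof.
move=> [mU pU]; split; first exact: measurable_tuple_mulmx.
move=> F mF F0.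
rewrite !ge0_integral_iid_tupleS//; last first.
  by apply: (measurableT_comp mF); exact: measurable_tuple_mulmx.
apply: eq_integral => x _.
have mFx : measurable_fun setT (fun t => F (tcons (x, t))).
  by apply: (measurableT_comp mF); apply: measurable_fun_tcons.
rewrite -[RHS](pU _ mFx (fun t => F0 _)).
by apply: eq_integral => t _; rewrite tuple_mulmx_block.
Qed.

Definition reflection2 (c s : R) : 'M[R]_2 :=
  \matrix_(i, j) (if i == 0 then (if j == 0 then c else s)
                  else (if j == 0 then s else - c))%R.

(** Coefficients are listed at ordinals of [n.+2], the form met in sums over a tuple built with
    [tcons], whereas [block_mx] is indexed by [2 + n]. *)
Lemma reflection_blockE n (c s : R)
    (M := block_mx (reflection2 c s) 0 0 1%:M : 'M[R]_(2 + n))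
    (o1 := lift ord0 ord0 : 'I_n.+2) :
  [/\ [/\ M ord0 ord0 = c, M ord0 o1 = s, M o1 ord0 = s & M o1 o1 = (- c)%R],
   forall k, M ord0 (rshift 2 k) = 0%R /\ M o1 (rshift 2 k) = 0%R,
   forall k, M (rshift 2 k) ord0 = 0%R /\ M (rshift 2 k) o1 = 0%R &
   forall k l, M (rshift 2 k) (rshift 2 l) = (k == l)%:R%R].
Proof.
have l0 : lshift n (ord0 : 'I_2) = ord0 by apply/val_inj.
have l1 : lshift n (lift ord0 ord0 : 'I_2) = o1 by apply/val_inj.
have h i j : M (lshift n i) (lshift n j) =
    (if i == 0 then (if j == 0 then c else s) else (if j == 0 then s else - c))%R.
  by rewrite [LHS]block_mxEul mxE.
have hu i k : M (lshift n i) (rshift 2 k) = 0%R.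
  by rewrite [LHS]block_mxEur mxE.
have hd i k : M (rshift 2 k) (lshift n i) = 0%R.
  by rewrite [LHS]block_mxEdl mxE.
split.
- by split; [have := h ord0 ord0|have := h ord0 (lift ord0 ord0)|
    have := h (lift ord0 ord0) ord0|have := h (lift ord0 ord0) (lift ord0 ord0)];
    rewrite ?l0 ?l1.
- by move=> k; have := hu ord0 k; have := hu (lift ord0 ord0) k; rewrite l0 l1.
- by move=> k; have := hd ord0 k; have := hd (lift ord0 ord0) k; rewrite l0 l1.
- by move=> k l; rewrite [LHS]block_mxEdr mxE.
Qed.

Lemma tuple_mulmx_reflection n (c s x y : R) t :
  tuple_mulmx (block_mx (reflection2 c s) 0 0 1%:M : 'M[R]_(2 + n))
    (tcons (x, tcons (y, t))) =
  tcons (c * x + s * y, tcons (s * x - c * y, t))%R.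
Proof.
have [[e00 e01 e10 e11] e0 eS eSS] := reflection_blockE n c s.
apply: eq_from_tnth => i; rewrite tnth_mktuple (@big_split_ord _ _ _ 2%N n).
rewrite big_ord_recl big_ord1 /=.
have l0 : lshift n (ord0 : 'I_2) = ord0 by apply/val_inj.
have l1 : lshift n (lift ord0 ord0 : 'I_2) = lift ord0 ord0 by apply/val_inj.
have rS j : rshift 2 j = lift ord0 (lift ord0 j) :> 'I_n.+2 by apply/val_inj.
rewrite [in LHS]l0 [in LHS]l1 !tnth_tconsS !tnth_tcons0.
have [j ->|->] := unliftP ord0 i; last first.
  rewrite [RHS]tnth_tcons0 e00 e01 big1 ?addr0// => k _.
  by rewrite (e0 k).1 mul0r.
rewrite [RHS]tnth_tconsS.
have [k ->|->] := unliftP ord0 j; last first.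
  rewrite [RHS]tnth_tcons0 e10 e11 mulNr big1 ?addr0// => k _.
  by rewrite (e0 k).2 mul0r.
rewrite [RHS]tnth_tconsS -rS (eS k).1 (eS k).2 !mul0r !add0r.
rewrite (bigD1 k)//= big1 ?addr0; last first.
  by move=> i' /negPf ik; rewrite eSS eq_sym ik mul0r.
by rewrite eSS eqxx mul1r rS !tnth_tconsS.
Qed.

(** Integrating out the other coordinates leaves a function [G] of two Gaussians, to which
    [std_gaussian_reflection] applies. *)
Lemma preserves_iid_reflection n (c s : R) :
  (0 < s)%R -> (c ^+ 2 + s ^+ 2 = 1)%R ->
  preserves_iid (block_mx (reflection2 c s) 0 0 1%:M : 'M[R]_(2 + n)).
Proof.
move=> s0 cs; split; first exact: measurable_tuple_mulmx.
move=> F mF F0.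
pose G (p : R * R) := \int[iid_tuple gamma n]_t F (tcons (p.1, tcons (p.2, t))).
have split2 (H : n.+2.-tuple R -> \bar R) : measurable_fun setT H ->
    (forall t, 0 <= H t) -> \int[iid_tuple gamma n.+2]_t H t =
    \int[gamma]_x \int[gamma]_y \int[iid_tuple gamma n]_t H (tcons (x, tcons (y, t))).
  move=> mH H0; rewrite ge0_integral_iid_tupleS//; apply: eq_integral => x _.
  have mHx : measurable_fun setT (fun t => H (tcons (x, t))).
    by apply: (measurableT_comp mH); apply: measurable_fun_tcons.
  exact: (ge0_integral_iid_tupleS gamma mHx (fun t => H0 _)).
have mFA := measurableT_comp mF
  (measurable_tuple_mulmx (block_mx (reflection2 c s) 0 0 1%:M : 'M[R]_(2 + n))).
rewrite [RHS]split2// [LHS](split2 _ mFA (fun t => F0 _)).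
rewrite -[RHS]/(\int[gamma]_x \int[gamma]_y G (x, y)).
have mG : measurable_fun setT G.
  pose K (q : (R * R) * n.-tuple R) := F (tcons (q.1.1, tcons (q.1.2, q.2))).
  have K0 q : 0 <= K q by exact: F0.
  apply: (measurable_fun_fubini_tonelli_F (m2 := iid_tuple gamma n) K) => //.
  apply: (measurableT_comp mF); apply: measurable_fun_tcons.
    by apply: measurableT_comp.
  by apply: measurable_fun_tcons => //; apply: measurableT_comp.
have G0 p : 0 <= G p by exact: integral_ge0.
rewrite -(std_gaussian_reflection s0 cs mG G0).
apply: eq_integral => x _; apply: eq_integral => y _; apply: eq_integral => t _.
exact: (congr1 F (tuple_mulmx_reflection c s x y t)).
Qed.

(* A Helmert matrix, built one plane reflection at a time. *)
Lemma helmert_exists n : exists U : 'M[R]_n.+1,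
  [/\ U *m U^T = 1%:M, forall j, U ord0 j = (Num.sqrt n.+1%:R)^-1%R &
      preserves_iid U].
Proof.
elim: n => [|n [U [UU U0 pU]]].
  exists 1%:M; split; [by rewrite trmx1 mulmx1| |exact: preserves_iid1].
  by move=> j; rewrite (ord1 j) mxE eqxx sqrtr1 invr1.
pose N : R := n.+2%:R.
have N0 : (0 < N)%R by rewrite ltr0n.
have sN0 : (0 < Num.sqrt N)%R by rewrite sqrtr_gt0.
(* The first row of the product is c followed by s times the old first row; these values of c and s
   make all its entries equal to 1 / sqrt N. *)
pose c : R := ((Num.sqrt N)^-1)%R.
pose s : R := (Num.sqrt n.+1%:R / Num.sqrt N)%R.
have s0 : (0 < s)%R by rewrite divr_gt0// sqrtr_gt0 ltr0n.
have cs : (c ^+ 2 + s ^+ 2 = 1)%R.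
  have -> : (c ^+ 2 + s ^+ 2 = (1 + Num.sqrt n.+1%:R ^+ 2) / Num.sqrt N ^+ 2)%R.
    by rewrite /c /s; field; rewrite gt_eqF.
  rewrite !sqr_sqrtr ?ler0n ?(ltW N0)//.
  have -> : (1 + n.+1%:R = N)%R by rewrite /N -[in RHS]natr1 addrC.
  by rewrite mulfV// gt_eqF.
pose A : 'M[R]_(2 + n) := block_mx (reflection2 c s) 0 0 1%:M.
pose B : 'M[R]_(1 + n.+1) := block_mx 1%:M 0 0 U.
have rr : reflection2 c s *m (reflection2 c s)^T = 1%:M.
  apply/matrixP => i j; rewrite !mxE big_ord_recl big_ord1 !mxE /=.
  case: i => [[|[|i]]] Hi //; case: j => [[|[|j]]] Hj //=; rewrite ?mulr1n ?mulr0n.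
  - by ring.
  - by ring.
  - by rewrite -cs; ring.
have BB : B *m B^T = 1%:M.
  rewrite /B tr_block_mx mulmx_block !trmx0 trmx1 !mulmx0 !mul0mx !mulmx1.
  by rewrite !(addr0, add0r) UU -scalar_mx_block.
have AA : A *m A^T = 1%:M.
  rewrite /A tr_block_mx mulmx_block !trmx0 trmx1 !mulmx0 !mul0mx !mulmx1.
  by rewrite !(addr0, add0r) rr -scalar_mx_block.
exists ((A : 'M[R]_n.+2) *m B); split.
- by rewrite trmx_mul mulmxA -(mulmxA A) BB mulmx1; exact: AA.
- have [[e00 e01 _ _] e0 _ _] := reflection_blockE n c s.
  move=> j; rewrite mxE (@big_split_ord _ _ _ 2%N n) big_ord_recl big_ord1 /=.
  have l0 : lshift n (ord0 : 'I_2) = ord0 by apply/val_inj.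
  have l1 : lshift n (lift ord0 ord0 : 'I_2) = lift ord0 ord0 by apply/val_inj.
  rewrite [X in (_ + X)%R]big1 ?addr0; last first.
    by move=> k _; rewrite /A (e0 k).1 mul0r.
  rewrite l0 l1 {1 2}/A e00 e01.
  have l0' : lshift n.+1 (ord0 : 'I_1) = ord0 by apply/val_inj.
  have rS i : rshift 1 i = lift ord0 i :> 'I_n.+2 by apply/val_inj.
  have b00 : B ord0 ord0 = 1%R.
    by have : B (lshift n.+1 ord0) (lshift n.+1 ord0) = 1%R;
      [rewrite /B block_mxEul mxE|rewrite l0'].
  have b0S i : B ord0 (lift ord0 i) = 0%R.
    by have : B (lshift n.+1 ord0) (rshift 1 i) = 0%R;
      [rewrite /B block_mxEur mxE|rewrite l0' rS].
  have bS0 i : B (lift ord0 i) ord0 = 0%R.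
    by have : B (rshift 1 i) (lshift n.+1 ord0) = 0%R;
      [rewrite /B block_mxEdl mxE|rewrite l0' rS].
  have bSS i k : B (lift ord0 i) (lift ord0 k) = U i k.
    by have : B (rshift 1 i) (rshift 1 k) = U i k;
      [rewrite /B block_mxEdr|rewrite !rS].
  have [k ->|->] := unliftP ord0 j.
    rewrite b0S bSS U0 mulr0 add0r.
    by rewrite /s mulrAC mulfV ?mul1r// gt_eqF// sqrtr_gt0 ltr0n.
  by rewrite b00 bS0 mulr0 addr0 mulr1.
- by apply: preserves_iidM; [exact: preserves_iid_reflection|exact: preserves_iid_block].
Qed.

End orthogonal.

Section matrix_laws.
Context d (T : measurableType d) (R : realType) (P : probability T R).
Local Open Scope ereal_scope.

Definition mx_boxes m n : set (set 'M[T]_(m, n)) :=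
  [set C | exists2 B : 'I_m -> 'I_n -> set T,
    (forall i j, measurable (B i j)) & C = [set A : 'M[T]_(m, n) | forall i j, B i j (A i j)]].

Lemma mx_boxes_measurable m n : @mx_boxes m n `<=` measurable.
Proof.
move=> _ [B mB ->].
rewrite (_ : [set _ | _] = \bigcap_(i in [set: 'I_m]) \bigcap_(j in [set: 'I_n])
    ((fun A : 'M[T]_(m, n) => A i j) @^-1` B i j)); last first.
  by apply/seteqP; split => A /= h; [move=> i _ j _; exact: h|move=> i j; exact: h].
apply: fin_bigcap_measurable => // i _; apply: fin_bigcap_measurable => // j _.
by rewrite -[X in measurable X]setTI; exact: measurable_mx_coef.
Qed.

(** Boxes form a pi-system that contains the generating cylinders. As [iid_mx_box] computes their
    probabilities, the equalities of laws below reduce to identities between finite products. *)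
Lemma mx_measure_unique m n (P1 P2 : probability 'M[T]_(m, n) R) :
  (forall B : 'I_m -> 'I_n -> set T, (forall i j, measurable (B i j)) ->
    P1 [set A : 'M[T]_(m, n) | forall i j, B i j (A i j)] = P2 [set A : 'M[T]_(m, n) | forall i j, B i j (A i j)]) ->
  forall C, measurable C -> P1 C = P2 C.
Proof.
move=> h C mC; apply: (g_sigma_algebra_measure_unique _ (@mx_boxes_measurable m n) (fun=> setT)).
- by move=> _; exists (fun _ _ => setT) => //; apply/seteqP; split.
- by rewrite bigcup_const.
- move=> _ _ [B mB ->] [B' mB' ->]; exists (fun i j => B i j `&` B' i j).
    by move=> i j; exact: measurableI.
  by apply/seteqP; split => A /=; [move=> [? ?] i j|move=> H; split => i j; case: (H i j)].
- by move=> _ [B mB ->]; exact: h.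
- by move=> _; apply: (le_lt_trans (probability_le1 _ _)) => //; rewrite ltry.
- move: C mC; apply: smallest_sub; first exact: smallest_sigma_algebra.
  move=> _ [i [j [D mD ->]]]; apply: sub_sigma_algebra.
  exists (fun k l => if (k == i) && (l == j) then D else setT).
    by move=> k l; case: ifP.
  apply/seteqP; split => A /= => [Dij k l|/(_ i j)]; last by rewrite !eqxx.
  by case: ifP => // /andP[/eqP -> /eqP ->].
Qed.

Lemma eq_integral_measure d' (S : measurableType d') (P1 P2 : probability S R)
    (F : S -> \bar R) :
  (forall C, measurable C -> P1 C = P2 C) ->
  \int[P1]_x F x = \int[P2]_x F x.
Proof. by move=> h; apply: eq_measure_integral => C mC _; exact: h. Qed.

Lemma ge0_integral_iid_trmx m n (F : 'M[T]_(n, m) -> \bar R) :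
  measurable_fun setT F -> (forall x, 0 <= F x) ->
  \int[iid_mx P m n]_x F x^T = \int[iid_mx P n m]_x F x.
Proof.
move=> mF F0.
have mtr : measurable_fun setT (@trmx T m n).
  apply: measurable_fun_mxP => i j.
  rewrite (_ : (fun _ => _) = (fun x : 'M[T]_(m, n) => x j i)).
    exact: measurable_mx_coef.
  by apply/funext => x; rewrite mxE.
pose tr : {mfun _ >-> _} := HB.pack (@trmx T m n) (isMeasurableFun.Build _ _ _ _ _ mtr).
transitivity (\int[distribution (iid_mx P m n) tr]_x F x).
  by rewrite /distribution [RHS]ge0_integral_pushforward.
apply: eq_integral_measure.
apply: mx_measure_unique => B mB.
rewrite iid_mx_box// exchange_big /= -(@iid_mx_box _ _ _ P m n (fun i j => B j i))//.
rewrite /distribution /pushforward; congr (iid_mx P m n _).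
by apply/seteqP; split => A /= h i j; have := h j i; rewrite mxE.
Qed.

Definition mix_mx m n (E : 'I_m -> 'I_n -> bool) (p : 'M[T]_(m, n) * 'M[T]_(m, n)) :
  'M[T]_(m, n) := \matrix_(i, j) (if E i j then p.1 i j else p.2 i j).

Lemma measurable_mix_mx m n (E : 'I_m -> 'I_n -> bool) :
  measurable_fun setT (mix_mx E).
Proof.
apply: measurable_fun_mxP => i j.
rewrite (_ : (fun _ => _) = (fun A : 'M[T]_(m, n) => A i j) \o
    (if E i j then fst else snd)); last first.
  by apply/funext => p; rewrite mxE /=; case: ifP.
apply: measurableT_comp; first exact: measurable_mx_coef.
by case: ifP => _; [exact: measurable_fst|exact: measurable_snd].
Qed.

(* Mixing the entries of two independent copies expresses independence of disjoint
   blocks of entries without splitting the matrix space into a product. *)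
Lemma ge0_integral_mix_mx m n (E : 'I_m -> 'I_n -> bool) (F : 'M[T]_(m, n) -> \bar R) :
  measurable_fun setT F -> (forall x, 0 <= F x) ->
  \int[iid_mx P m n]_x F x =
  \int[iid_mx P m n]_x \int[iid_mx P m n]_y F (mix_mx E (x, y)).
Proof.
move=> mF F0.
pose mu := iid_mx P m n.
pose K : {mfun _ >-> _} := HB.pack (@mix_mx m n E)
  (isMeasurableFun.Build _ _ _ _ _ (measurable_mix_mx E)).
transitivity (\int[distribution (mu \x mu) K]_x F x); last first.
  rewrite /distribution [LHS]ge0_integral_pushforward// preimage_setT.
  rewrite (fubini_tonelli1 (m1 := mu) (m2 := mu))//.
    by apply: measurableT_comp => //; exact: measurable_mix_mx.
  by move=> x; exact: F0.
apply: eq_integral_measure.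
apply: mx_measure_unique => B mB; apply/esym.
(* [B1] keeps the conditions on entries taken from the first copy and [B2] the others, so the
   preimage of the box under mixing is a product. *)
pose B1 i j := if E i j then B i j else setT.
pose B2 i j := if E i j then setT else B i j.
have mB1 i j : measurable (B1 i j) by rewrite /B1; case: ifP.
have mB2 i j : measurable (B2 i j) by rewrite /B2; case: ifP.
transitivity ((mu \x mu) ([set A : 'M[T]_(m, n) | forall i j, B1 i j (A i j)] `*`
    [set A : 'M[T]_(m, n) | forall i j, B2 i j (A i j)])).
  rewrite /distribution /pushforward; congr ((mu \x mu) _).
  apply/seteqP; split => [[A A'] /= h|[A A'] [/= h1 h2] i j].
    split => i j; rewrite /= /B1 /B2; case: ifP => // e.
      by have := h i j; rewrite mxE /= e.
    by have := h i j; rewrite mxE /= e.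
  by have := h1 i j; have := h2 i j; rewrite mxE /= /B1 /B2; case: ifP.
rewrite product_measure1E; last 2 first.
  by apply: mx_boxes_measurable; exists B1.
  by apply: mx_boxes_measurable; exists B2.
apply: (etrans (congr2 mule (iid_mx_box P mB1) (iid_mx_box P mB2))).
apply: (etrans _ (esym (iid_mx_box P mB))).
transitivity (\prod_(i < m) (\prod_(j < n) P (B1 i j) * \prod_(j < n) P (B2 i j))).
  by rewrite big_split.
apply: eq_bigr => i _.
transitivity (\prod_(j < n) (P (B1 i j) * P (B2 i j))); first by rewrite big_split.
apply: eq_bigr => j _; rewrite /B1 /B2.
by case: ifP => _; rewrite probability_setT ?mule1 ?mul1e.
Qed.

Lemma ge0_integral_iid_col m n (j : 'I_n) (F : 'M[T]_(m, 1) -> \bar R) :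
  measurable_fun setT F -> (forall x, 0 <= F x) ->
  \int[iid_mx P m n]_x F (col j x) = \int[iid_mx P m 1]_x F x.
Proof.
move=> mF F0.
have mcol : measurable_fun setT (@col T m n j).
  apply: measurable_fun_mxP => i k.
  rewrite (_ : (fun _ => _) = (fun x : 'M[T]_(m, n) => x i j)).
    exact: measurable_mx_coef.
  by apply/funext => x; rewrite mxE.
pose K : {mfun _ >-> _} := HB.pack (@col T m n j) (isMeasurableFun.Build _ _ _ _ _ mcol).
transitivity (\int[distribution (iid_mx P m n) K]_x F x).
  by rewrite /distribution [RHS]ge0_integral_pushforward.
apply: eq_integral_measure.
apply: mx_measure_unique => B mB.
pose B1 i k := if k == j then B i ord0 else setT.
have mB1 i k : measurable (B1 i k) by rewrite /B1; case: ifP.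
transitivity (iid_mx P m n [set A : 'M[T]_(m, n) | forall i k, B1 i k (A i k)]).
  rewrite /distribution /pushforward; congr (iid_mx P m n _).
  apply/seteqP; split => A /= h i k.
    by rewrite /B1; case: ifP => // /eqP ->; have := h i ord0; rewrite mxE.
  by have := h i j; rewrite mxE /B1 eqxx (ord1 k).
apply: (etrans (iid_mx_box P mB1)); apply: (etrans _ (esym (iid_mx_box P mB))).
apply: eq_bigr => i _.
rewrite big_ord1 (bigD1 j)//= big1 ?mule1; first by rewrite /B1 eqxx.
by move=> k /negPf kj; rewrite /B1 kj probability_setT.
Qed.

End matrix_laws.

Section measurable_matrix_ops.
Context d (S : measurableType d) (R : realType).

Lemma measurable_fun_mulmx m n p (f : S -> 'M[R]_(m, n)) (g : S -> 'M[R]_(n, p)) :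
  measurable_fun setT f -> measurable_fun setT g ->
  measurable_fun setT (fun x => f x *m g x).
Proof.
move=> mf mg; apply: measurable_fun_mxP => i j.
rewrite (_ : (fun _ => _) = (fun x => \sum_k f x i k * g x k j)); last first.
  by apply/funext => x; rewrite mxE.
apply: measurable_sum => k; apply: measurable_funM.
  exact: (measurableT_comp (measurable_mx_coef i k) mf).
exact: (measurableT_comp (measurable_mx_coef k j) mg).
Qed.

Lemma measurable_fun_trmx m n (f : S -> 'M[R]_(m, n)) :
  measurable_fun setT f -> measurable_fun setT (fun x => (f x)^T).
Proof.
move=> mf; apply: measurable_fun_mxP => i j.
rewrite (_ : (fun _ => _) = (fun x => f x j i)); last first.
  by apply/funext => x; rewrite mxE.
exact: (measurableT_comp (measurable_mx_coef j i) mf).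
Qed.

End measurable_matrix_ops.

(** * Independence of the centered matrix and the margin *)

Section gaussian_matrix.
Context (R : realType).
Local Notation gamma := (std_gaussian R).

Lemma preserves_mulmxr m n (V : 'M[R]_n) : preserves_iid V ->
  preserves (iid_mx gamma m n) (fun x => x *m V^T).
Proof.
move=> pV; have [mV _] := pV.
have mX : measurable_fun setT (fun x : 'M[R]_(m, n) => x *m V^T).
  by apply: measurable_fun_mulmx; [exact: measurable_id|exact: measurable_cst].
split=> // F mF F0.
have mFX := measurableT_comp mF mX.
rewrite (ge0_integral_iid_mx gamma mFX (fun x => F0 _)) (ge0_integral_iid_mx gamma mF F0).
have [_ p] := preserves_map_tuple m pV.
have mFt := measurableT_comp mF (@measurable_mx_of_tuples _ R m n).
rewrite -[RHS](p _ mFt (fun x => F0 _)).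
apply: eq_integral => t _; congr F; apply/matrixP => i j; rewrite !mxE.
rewrite tnth_map tnth_mktuple; apply: eq_bigr => k _.
by rewrite !mxE mulrC.
Qed.

Lemma preserves_mulmxl m n (U : 'M[R]_m) : preserves_iid U ->
  preserves (iid_mx gamma m n) (fun x => U *m x).
Proof.
move=> pU; have [mr pr] := preserves_mulmxr n pU.
split.
  by apply: measurable_fun_mulmx; [exact: measurable_cst|exact: measurable_id].
move=> F mF F0.
have mtr k l : measurable_fun setT (fun x : 'M[R]_(k, l) => x^T).
  by apply: measurable_fun_trmx; exact: measurable_id.
have mG := measurableT_comp mF (mtr n m).
have mGr := measurableT_comp mG mr.
rewrite -(ge0_integral_iid_trmx gamma mF F0).
rewrite -[RHS](pr _ mG (fun x => F0 _)).
rewrite -[RHS](ge0_integral_iid_trmx gamma mGr (fun x => F0 _)).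
by apply: eq_integral => x _; rewrite /= !trmx_mul !trmxK.
Qed.

(** Needed because invariance is constructed for the Helmert matrices, while the change of basis
    below uses their transposes. *)
Lemma preserves_inverse d (T : measurableType d) (P : probability T R) (f g : T -> T) :
  preserves P f -> measurable_fun setT g -> cancel f g -> preserves P g.
Proof.
move=> [mf pf] mg fg; split => // F mF F0.
have mFg := measurableT_comp mF mg.
rewrite -(pf _ mFg (fun x => F0 _)).
by apply: eq_integral => x _; rewrite /= fg.
Qed.

(** The first row of U is the normalized constant vector, so in the basis formed by the rows the
    centering projection just erases coordinate 0. *)
Lemma center_mx_helmert n (U : 'M[R]_n.+1) :
  U *m U^T = 1%:M -> (forall j, U ord0 j = (Num.sqrt n.+1%:R)^-1%R) ->
  center_mx R n.+1 = U^T *m (1%:M - delta_mx ord0 ord0) *m U.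
Proof.
move=> UU U0; have UU' : U^T *m U = 1%:M by exact: mulmx1C.
rewrite mulmxBr mulmx1 mulmxBl UU' /center_mx; congr (_ - _)%R.
apply/matrixP => i j; rewrite !mxE (bigD1 ord0)//= big1 ?addr0; last first.
  move=> k /negPf k0; rewrite !mxE big1 ?mul0r// => l _.
  by rewrite !mxE k0 andbF mulr0.
rewrite !mxE (bigD1 ord0)//= big1 ?addr0; last first.
  by move=> k /negPf k0; rewrite !mxE k0 mulr0.
by rewrite !mxE !eqxx !U0 !mulr1 -invfM -expr2 sqr_sqrtr ?ler0n.
Qed.

Lemma mulmx_helmert n (U : 'M[R]_n.+1) :
  U *m U^T = 1%:M -> (forall j, U ord0 j = (Num.sqrt n.+1%:R)^-1%R) ->
  U *m const_mx 1 = Num.sqrt n.+1%:R *: delta_mx ord0 ord0 :> 'cV_n.+1.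
Proof.
move=> UU U0.
have n0 : Num.sqrt n.+1%:R != 0%R :> R by rewrite gt_eqF// sqrtr_gt0 ltr0n.
have -> : const_mx 1 = Num.sqrt n.+1%:R *: (U^T *m delta_mx ord0 ord0) :> 'cV_n.+1.
  apply/matrixP => i j; rewrite !mxE (bigD1 ord0)//= big1 ?addr0; last first.
    by move=> k /negPf k0; rewrite !mxE k0 mulr0.
  by rewrite !mxE eqxx (ord1 j) eqxx mulr1 U0 mulfV.
by rewrite -scalemxAr mulmxA UU mul1mx.
Qed.

Lemma margin_ofE m n (x : 'M[R]_(m, n)) :
  margin_of x = (x *m const_mx 1, const_mx 1 *m x).
Proof.
rewrite /margin_of; congr (_, _).
  by apply/matrixP => i j; rewrite !mxE; apply: eq_bigr => k _; rewrite mxE mulr1.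
by apply/matrixP => i j; rewrite !mxE; apply: eq_bigr => k _; rewrite mxE mul1r.
Qed.

Definition centered m n (x : 'M[R]_(m, n)) := center_mx R m *m x *m center_mx R n.

Lemma measurable_centered m n : measurable_fun setT (@centered m n).
Proof.
apply: measurable_fun_mulmx; last exact: measurable_cst.
by apply: measurable_fun_mulmx; [exact: measurable_cst|exact: measurable_id].
Qed.

Local Open Scope ereal_scope.

Lemma gaussian_independence m n (H : 'M[R]_(m.+1, n.+1) -> \bar R)
    (F : margin R m.+1 n.+1 -> \bar R) :
  measurable_fun setT H -> (forall x, 0 <= H x) ->
  measurable_fun setT F -> (forall x, 0 <= F x) ->
  \int[iid_mx gamma m.+1 n.+1]_x (H (centered x) * F (margin_of x)) =
  (\int[iid_mx gamma m.+1 n.+1]_x H (centered x)) *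
  (\int[iid_mx gamma m.+1 n.+1]_x F (margin_of x)).
Proof.
move=> mH H0 mF F0; set mu := iid_mx _ _ _.
have [U [UU U0 pU]] := helmert_exists R m.
have [V [VV V0 pV]] := helmert_exists R n.
have UU' : U^T *m U = 1%:M by exact: mulmx1C.
have VV' : V^T *m V = 1%:M by exact: mulmx1C.
pose Phi (x : 'M[R]_(m.+1, n.+1)) := U^T *m x *m V.
have mPhi : measurable_fun setT Phi.
  apply: measurable_fun_mulmx; last exact: measurable_cst.
  by apply: measurable_fun_mulmx; [exact: measurable_cst|exact: measurable_id].
have pPhi : preserves mu Phi.
  apply: (preserves_inverse (f := (fun x => U *m x) \o (fun x => x *m V^T))) => //.
    by apply: preserves_comp; [exact: preserves_mulmxl|exact: preserves_mulmxr].
  by move=> x /=; rewrite /Phi !mulmxA UU' mul1mx -mulmxA VV' mulmx1.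
have [_ {}pPhi] := pPhi.
(* In the new basis the margin depends only on the first row and column, the centered matrix only on
   the other entries. *)
pose E (i : 'I_m.+1) (j : 'I_n.+1) := (i == ord0) || (j == ord0).
pose D k : 'M[R]_k.+1 := (1%:M - delta_mx ord0 ord0)%R.
have DE k (i j : 'I_k.+1) : D k i j = ((i == j) && (i != ord0))%:R%R.
  rewrite !mxE; case: (eqVneq i j) => [<-|ij] /=; last first.
    case: (eqVneq i ord0) ij => [->|_ _] /=; last by rewrite subr0.
    by rewrite eq_sym => /negPf ->; rewrite subr0.
  by case: eqP => _; rewrite /= ?subrr ?subr0.
have DxD (x : 'M[R]_(m.+1, n.+1)) i j :
    (D m *m x *m D n) i j = if E i j then 0%R else x i j.
  rewrite mxE (bigD1 j)//= big1 ?addr0; last first.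
    by move=> k kj; rewrite DE (negPf kj) mulr0.
  rewrite mxE (bigD1 i)//= big1 ?addr0; last first.
    by move=> k ki; rewrite DE eq_sym (negPf ki) mul0r.
  rewrite !DE !eqxx /E /=; case: (i == _); case: (j == _); rewrite ?mul0r ?mulr0//.
  by rewrite mul1r mulr1.
have CPhi x : centered (Phi x) = U^T *m (D m *m x *m D n) *m V.
  rewrite /centered (center_mx_helmert UU U0) (center_mx_helmert VV V0) /Phi -/(D m) -/(D n).
  by rewrite !mulmxA -(mulmxA _ U U^T) UU mulmx1 -(mulmxA _ V V^T) VV mulmx1.
have CK x y : centered (Phi (mix_mx E (x, y))) = centered (Phi y).
  rewrite !CPhi; congr (_ *m _ *m _); apply/matrixP => i j; rewrite !DxD.
  by case: ifP => // e; rewrite mxE e.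
have MK x y : margin_of (Phi (mix_mx E (x, y))) = margin_of (Phi x).
  rewrite !margin_ofE; congr (_, _).
    rewrite /Phi -!mulmxA (mulmx_helmert VV V0); congr (_ *m _).
    rewrite -!scalemxAr; congr (_ *: _); apply/matrixP => i j; rewrite !mxE.
    apply: eq_bigr => k _; rewrite !mxE (ord1 j) eqxx andbT.
    by case: (eqVneq k ord0) => [->|_]; rewrite /= ?mulr0// /E eqxx orbT.
  have h : (const_mx 1%R : 'rV_m.+1) *m U^T = Num.sqrt m.+1%:R *: delta_mx ord0 ord0.
    rewrite -[LHS]trmxK trmx_mul trmxK trmx_const (mulmx_helmert UU U0).
    by rewrite linearZ /= trmx_delta.
  rewrite /Phi !mulmxA h; congr (_ *m _).
  rewrite -!scalemxAl; congr (_ *: _); apply/matrixP => i j; rewrite !mxE.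
  apply: eq_bigr => k _; rewrite !mxE (ord1 i) eqxx /=.
  by case: (eqVneq k ord0) => [->|_]; rewrite /= ?mul0r// /E eqxx.
have mHc := measurableT_comp mH (@measurable_centered m.+1 n.+1).
have mFm := measurableT_comp mF (@measurable_margin_of R m.+1 n.+1).
have mHF := emeasurable_funM mHc mFm.
have HF0 x : 0 <= H (centered x) * F (margin_of x) by rewrite mule_ge0.
rewrite -(pPhi _ mHc (fun x => H0 _)) -(pPhi _ mFm (fun x => F0 _)).
rewrite -(pPhi _ mHF HF0) (ge0_integral_mix_mx gamma E (measurableT_comp mHF mPhi) (fun x => HF0 _)).
have mHP := measurableT_comp mHc mPhi; have mFP := measurableT_comp mFm mPhi.
transitivity (\int[mu]_x ((\int[mu]_y H (centered (Phi y))) * F (margin_of (Phi x)))).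
  apply: eq_integral => x _; rewrite -ge0_integralZr//.
  by apply: eq_integral => y _ /=; rewrite CK MK.
rewrite ge0_integralZl//.
by apply: integral_ge0 => x _; exact: H0.
Qed.

End gaussian_matrix.

(** * The resolvent of a Gaussian Gram matrix *)

Section quadratic_forms.
Context d (T : measurableType d) (R : realType) (P : probability T R) (xi : T -> R).
Hypothesis mxi : measurable_fun setT xi.
Hypothesis quad_xi : forall a b c : R,
  (\int[P]_x ((a * (xi x ^+ 2 - 1) + b * xi x + c) ^+ 2)%:E =
   (2 * a ^+ 2 + b ^+ 2 + c ^+ 2)%:E)%E.

(** The first coordinate is integrated innermost, with the others frozen, so that [quad_xi] applies
    with coefficients that depend on them. *)
Lemma ge0_integral_iid_tupleS' n (F : n.+1.-tuple T -> \bar R) :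
  measurable_fun setT F -> (forall t, 0 <= F t)%E ->
  (\int[iid_tuple P n.+1]_t F t =
  \int[iid_tuple P n]_t \int[P]_x F (tcons (x, t)))%E.
Proof.
move=> mF F0; rewrite ge0_integral_iid_tupleS//.
pose G p := F (@tcons _ T n p).
have mG : measurable_fun setT G by apply: measurableT_comp => //; exact: measurable_tcons.
exact: (fubini_tonelli (m1 := P) (m2 := iid_tuple P n) G mG (fun p => F0 _)).
Qed.

Definition linform n (v : 'I_n -> R) (t : n.-tuple T) : R :=
  \sum_i v i * xi (tnth t i).

(** Subtracting the identity centers the form: for standardized independent coordinates the mean of
    the uncentered form is the trace of [M]. *)
Definition quadform n (M : 'I_n -> 'I_n -> R) (t : n.-tuple T) : R :=
  \sum_i \sum_j M i j * (xi (tnth t i) * xi (tnth t j) - (i == j)%:R).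

Lemma measurable_linform n (v : 'I_n -> R) : measurable_fun setT (linform v).
Proof.
apply: measurable_sum => i; apply: measurable_funM => //.
exact: (measurableT_comp mxi (measurable_tnth i)).
Qed.

Lemma measurable_quadform n (M : 'I_n -> 'I_n -> R) : measurable_fun setT (quadform M).
Proof.
apply: measurable_sum => i; apply: measurable_sum => j; apply: measurable_funM => //.
apply: measurable_funB => //; apply: measurable_funM.
  exact: (measurableT_comp mxi (measurable_tnth i)).
exact: (measurableT_comp mxi (measurable_tnth j)).
Qed.

Lemma linform_tcons n (v : 'I_n.+1 -> R) x t :
  linform v (tcons (x, t)) = v ord0 * xi x + linform (fun i => v (lift ord0 i)) t.
Proof.
by rewrite /linform big_ord_recl; congr (_ + _); apply: eq_bigr => i _; rewrite tnthS.
Qed.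

(** In the first coordinate the form combines xi^2 - 1, xi and 1, exactly the shape of [quad_xi];
    the factor 2 collects the first row and the first column. *)
Lemma quadform_tcons n (M : 'I_n.+1 -> 'I_n.+1 -> R) x t :
  (forall i j, M i j = M j i) ->
  quadform M (tcons (x, t)) = M ord0 ord0 * (xi x ^+ 2 - 1) +
    2 * linform (fun i => M ord0 (lift ord0 i)) t * xi x +
    quadform (fun i j => M (lift ord0 i) (lift ord0 j)) t.
Proof.
move=> sM; rewrite /quadform big_ord_recl [in LHS]big_ord_recl /=.
rewrite -[tnth _ 0]/x -expr2 -2!addrA; congr (_ + _).
under [X in _ + X]eq_bigr do rewrite big_ord_recl /=.
rewrite big_split /= addrA; congr (_ + _); last first.
  by apply: eq_bigr => i _; apply: eq_bigr => j _; rewrite !tnthS (inj_eq (@lift_inj _ _)).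
rewrite mulr_natl mulrnAl mulr2n /linform mulr_suml; congr (_ + _).
  by apply: eq_bigr => i _; rewrite tnthS subr0 mulrAC mulrA.
by apply: eq_bigr => i _; rewrite tnthS subr0 sM mulrA.
Qed.

Lemma integral_linform_sqr n (v : 'I_n -> R) :
  (\int[iid_tuple P n]_t (linform v t ^+ 2)%:E = (\sum_i v i ^+ 2)%:E)%E.
Proof.
elim: n v => [|n IH] v.
  under eq_integral do rewrite /linform big_ord0 expr0n.
  by rewrite big_ord0 integral0.
have msq k (w : 'I_k -> R) : measurable_fun setT (fun t => (linform w t ^+ 2)%:E).
  by apply/measurable_EFinP; apply: measurable_funX; exact: measurable_linform.
have F0 t : (0 <= (linform v t ^+ 2)%:E)%E by rewrite lee_fin sqr_ge0.
rewrite (ge0_integral_iid_tupleS' (msq _ v) F0).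
under eq_integral => t _.
  under eq_integral => x _.
    (* A null multiple of xi^2 - 1 is inserted to match [quad_xi]. *)
    rewrite linform_tcons -[v ord0 * _]add0r -(mul0r (xi x ^+ 2 - 1)); over.
  rewrite /= quad_xi expr0n mulr0 add0r EFinD; over.
rewrite /= ge0_integralD//; last 3 first.
  by move=> x _; rewrite lee_fin sqr_ge0.
  by move=> x _; rewrite lee_fin sqr_ge0.
  exact: msq.
have integral_const (r : R) k : (\int[iid_tuple P k]_t r%:E = r%:E)%E.
  by rewrite integral_cst// [X in (_ * X)%E](probability_setT (iid_tuple P k)) mule1.
by rewrite integral_const IH -EFinD big_ord_recl.
Qed.

(** Integrating the first coordinate leaves 2 M_00^2 + 4 L^2 + Q^2, with L linear and Q the form in
    the remaining variables. The mean of L^2 gives the first row, counted also for the column by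
    symmetry; Q falls to the induction hypothesis. *)
Lemma integral_quadform_sqr n (M : 'I_n -> 'I_n -> R) :
  (forall i j, M i j = M j i) ->
  (\int[iid_tuple P n]_t (quadform M t ^+ 2)%:E =
   (2 * \sum_i \sum_j M i j ^+ 2)%:E)%E.
Proof.
elim: n M => [|n IH] M sM.
  under eq_integral do rewrite /quadform big_ord0 expr0n.
  by rewrite big_ord0 mulr0 integral0.
have msq k (N : 'I_k -> 'I_k -> R) : measurable_fun setT (fun t => (quadform N t ^+ 2)%:E).
  by apply/measurable_EFinP; apply: measurable_funX; exact: measurable_quadform.
have msl k (w : 'I_k -> R) : measurable_fun setT (fun t => (linform w t ^+ 2)%:E).
  by apply/measurable_EFinP; apply: measurable_funX; exact: measurable_linform.
have F0 t : (0 <= (quadform M t ^+ 2)%:E)%E by rewrite lee_fin sqr_ge0.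
rewrite (ge0_integral_iid_tupleS' (msq _ M) F0).
under eq_integral => t _.
  under eq_integral => x _ do rewrite quadform_tcons//.
  rewrite /= quad_xi exprMn -addrA EFinD [X in (_ + X)%E]EFinD [X in (_ + (X + _))%E]EFinM; over.
rewrite /= ge0_integralD//; last 3 first.
- by move=> t _; rewrite lee_fin mulr_ge0// sqr_ge0.
- by move=> t _; apply: adde_ge0; [apply: mule_ge0|]; rewrite lee_fin; exact: sqr_ge0.
- by apply: emeasurable_funD; [apply: measurable_funeM; exact: msl|exact: msq].
set L := linform _; set Q := quadform _.
have L0 t : setT t -> (0 <= (L t ^+ 2)%:E)%E by rewrite lee_fin sqr_ge0.
have Q0 t : setT t -> (0 <= (Q t ^+ 2)%:E)%E by rewrite lee_fin sqr_ge0.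
have mL : measurable_fun setT (fun t => (L t ^+ 2)%:E) by exact: msl.
have mQ : measurable_fun setT (fun t => (Q t ^+ 2)%:E) by exact: msq.
have m4L : measurable_fun setT (fun t => (2 ^+ 2)%:E * (L t ^+ 2)%:E)%E.
  exact: measurable_funeM.
have four0 : (0 <= (2 ^+ 2 : R)%:E)%E by rewrite lee_fin sqr_ge0.
have L40 t : setT t -> (0 <= (2 ^+ 2)%:E * (L t ^+ 2)%:E)%E.
  by move=> tT; rewrite mule_ge0// L0.
rewrite (ge0_integralD _ measurableT L40 m4L Q0 mQ).
rewrite (ge0_integralZl _ measurableT mL L0 four0).
have integral_const (r : R) k : (\int[iid_tuple P k]_t r%:E = r%:E)%E.
  by rewrite integral_cst// [X in (_ * X)%E](probability_setT (iid_tuple P k)) mule1.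
rewrite integral_const integral_linform_sqr IH//.
rewrite -EFinM -!EFinD; congr (_%:E).
rewrite [in RHS]big_ord_recl [in RHS]big_ord_recl /=.
under [X in _ = 2 * (_ + X)]eq_bigr do rewrite big_ord_recl /= sM.
by rewrite big_split /=; ring.
Qed.

End quadratic_forms.

(** * Measurability of resolvents and traces *)

Section measurable_inverse.
Context d (S : measurableType d) (R : realType).

Lemma measurable_inv : measurable_fun setT (fun x : R => x^-1).
Proof.
rewrite (_ : [set: R] = [set 0] `|` ~` [set 0]); last by rewrite setUv.
apply/measurable_funU => //; first exact: measurableC.
split; first exact: measurable_fun_set1.
apply: open_continuous_measurable_fun; first exact: closed_openC.
move=> x /set_mem /= /eqP x0.
exact: inv_continuous.
Qed.

Lemma measurable_det n (f : S -> 'M[R]_n) : measurable_fun setT f ->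
  measurable_fun setT (fun x => \det (f x)).
Proof.
move=> mf; apply: measurable_sum => s; apply: measurable_funM => //.
apply: measurable_prod => i _.
exact: (measurableT_comp (measurable_mx_coef _ _) mf).
Qed.

(** Cramer's rule: each coefficient is a cofactor over the determinant, both polynomial in the
    entries. *)
Lemma measurable_invmx n (f : S -> 'M[R]_n) : measurable_fun setT f ->
  (forall x, f x \in unitmx) ->
  measurable_fun setT (fun x => invmx (f x)).
Proof.
move=> mf uf; apply: measurable_fun_mxP => i j.
rewrite (_ : (fun _ => _) = (fun x => (\det (f x))^-1 * cofactor (f x) j i)); last first.
  by apply/funext => x; rewrite /invmx uf !mxE.
apply: measurable_funM.
  by apply: (measurableT_comp measurable_inv); exact: measurable_det.
apply: measurable_funM => //; apply: measurable_det.
apply: measurable_fun_mxP => k l.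
rewrite (_ : (fun _ => _) = (fun x => f x (lift j k) (lift i l))).
  exact: (measurableT_comp (measurable_mx_coef _ _) mf).
by apply/funext => x; rewrite !mxE.
Qed.

Lemma measurable_resolvent n (f : S -> 'M[R]_n) z : measurable_fun setT f ->
  (forall x, psdmx (f x)) -> 0 < z ->
  measurable_fun setT (fun x => resolvent (f x) z).
Proof.
move=> mf pf z0; apply: measurable_invmx; last first.
  by move=> x; exact: resolvent_unit.
apply: measurable_fun_mxP => i j.
rewrite (_ : (fun _ => _) = (fun x => f x i j + z%:M i j)).
  apply: measurable_funD => //.
  exact: (measurableT_comp (measurable_mx_coef _ _) mf).
by apply/funext => x; rewrite !mxE.
Qed.

Lemma measurable_mxtrace n (f : S -> 'M[R]_n) : measurable_fun setT f ->
  measurable_fun setT (fun x => \tr (f x)).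
Proof.
move=> mf; apply: measurable_sum => i.
exact: (measurableT_comp (measurable_mx_coef _ _) mf).
Qed.

Lemma measurable_fun_scalemx m n (c : R) (f : S -> 'M[R]_(m, n)) :
  measurable_fun setT f -> measurable_fun setT (fun x => c *: f x).
Proof.
move=> mf; apply: measurable_fun_mxP => i j.
rewrite (_ : (fun _ => _) = (fun x => c * f x i j)).
  by apply: measurable_funM => //; exact: (measurableT_comp (measurable_mx_coef _ _) mf).
by apply/funext => x; rewrite !mxE.
Qed.

End measurable_inverse.

Section stieltjes.
Context (R : realType).
Local Notation gamma := (std_gaussian R).

Lemma gaussian_col_variance m (M : 'M[R]_m) : M^T = M ->
  (\int[iid_mx gamma m 1]_g ((qform M g - \tr M) ^+ 2)%:E =
   (2 * \sum_i \sum_j M i j ^+ 2)%:E)%E.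
Proof.
move=> sM.
have mq : measurable_fun setT (fun g : 'M[R]_(m, 1) => (qform M g - \tr M) ^+ 2).
  apply: measurable_funX; apply: measurable_funB => //.
  apply: (measurableT_comp (measurable_mx_coef 0 0)).
  apply: measurable_fun_mulmx; last exact: measurable_id.
  apply: measurable_fun_mulmx; last exact: measurable_cst.
  by apply: measurable_fun_trmx; exact: measurable_id.
rewrite ge0_integral_iid_mx; last 2 first.
- exact/measurable_EFinP.
- by move=> g; rewrite lee_fin sqr_ge0.
(* The rows of a one-column matrix are tuples of length one, whence this projection. *)
pose xi (u : 1.-tuple R) := tnth u ord0.
have mxi : measurable_fun setT xi by exact: measurable_tnth.
have quad a b c : (\int[iid_tuple gamma 1]_u
    ((a * (xi u ^+ 2 - 1) + b * xi u + c) ^+ 2)%:E =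
    (2 * a ^+ 2 + b ^+ 2 + c ^+ 2)%:E)%E.
  rewrite ge0_integral_iid_tupleS; last 2 first.
  - apply/measurable_EFinP; apply: measurable_funX; apply: measurable_funD => //.
    apply: measurable_funD; apply: measurable_funM => //.
    by apply: measurable_funB => //; exact: measurable_funX.
  - by move=> u; rewrite lee_fin sqr_ge0.
  rewrite -(std_gaussian_quadratic a b c); apply: eq_integral => x _.
  rewrite (eq_integral (cst ((a * (x ^+ 2 - 1) + b * x + c) ^+ 2)%:E)); last by [].
  rewrite integral_cst//.
  by rewrite [X in (_ * X)%E](probability_setT (iid_tuple gamma 0)) mule1.
rewrite -(integral_quadform_sqr mxi quad (M := fun i j => M i j)); last first.
  by move=> i j; rewrite -[in LHS]sM mxE.
apply: eq_integral => t _; congr ((_ ^+ 2)%:E).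
rewrite /qform /quadform /mxtrace !mxE -sumrB.
under eq_bigr do rewrite mxE mulr_suml.
rewrite [in LHS]sumrB exchange_big -sumrB /=; apply: eq_bigr => i _.
rewrite [in RHS](eq_bigr (fun j => M i j * (xi (tnth t i) * xi (tnth t j)) - M i j * (i == j)%:R));
  last by move=> j _; rewrite mulrBr.
rewrite sumrB; congr (_ - _).
  by apply: eq_bigr => j _; rewrite !mxE /xi; ring.
rewrite (bigD1 i)//= eqxx mulr1 big1 ?addr0// => j /negPf ji.
by rewrite eq_sym ji mulr0.
Qed.

Definition stieltjes m n z (x : 'M[R]_(m, n)) : R :=
  m%:R^-1 * \tr (resolvent (n%:R^-1 *: (x *m x^T)) z).

Section fixed_size.
Variables (m n : nat) (z : R).
Hypotheses (m0 : (0 < m)%N) (n0 : (0 < n)%N) (z0 : 0 < z).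
Let mu := iid_mx gamma m n.
Let c : R := n%:R^-1.
Let c0 : 0 <= c. Proof. by rewrite invr_ge0. Qed.
Let mR0 : 0 < m%:R :> R. Proof. by rewrite ltr0n. Qed.
Let nR0 : 0 < n%:R :> R. Proof. by rewrite ltr0n. Qed.

Lemma measurable_gram d (S : measurableType d) (f : S -> 'M[R]_(m, n)) :
  measurable_fun setT f -> measurable_fun setT (fun x => c *: (f x *m (f x)^T)).
Proof.
move=> mf; apply: measurable_fun_scalemx; apply: measurable_fun_mulmx => //.
exact: measurable_fun_trmx.
Qed.

Lemma measurable_stieltjes : measurable_fun setT (@stieltjes m n z).
Proof.
apply: measurable_funM => //; apply: measurable_mxtrace.
apply: measurable_resolvent => //; first exact: measurable_gram.
by move=> x; exact: psdmx_gram.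
Qed.

Lemma stieltjes_ge0 (x : 'M[R]_(m, n)) : 0 <= stieltjes z x.
Proof.
by rewrite mulr_ge0 ?invr_ge0// mxtrace_resolvent_ge0//; exact: psdmx_gram.
Qed.

Lemma stieltjes_le (x : 'M[R]_(m, n)) : stieltjes z x <= z^-1.
Proof.
rewrite /stieltjes mulrC ler_pdivrMr// mulrC.
by apply: mxtrace_resolvent_le => //; exact: psdmx_gram.
Qed.

Lemma stieltjes_centered (x : 'M[R]_(m, n)) :
  `|stieltjes z (centered x) - stieltjes z x| <= 2 / z / m%:R.
Proof.
rewrite /stieltjes -mulrBr normrM ger0_norm ?invr_ge0// mulrC ler_wpM2r ?invr_ge0//.
exact: mxtrace_resolvent_center.
Qed.

Section loo_deviation.
Variable j : 'I_n.
Let Q (x : 'M[R]_(m, n)) := resolvent (loo_gram c x j) z.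
(** Two arguments separate the matrix in the resolvent from the one that supplies the column: mixing
    independent copies along column [j] turns [D x x] into [D x y]. *)
Let D (x y : 'M[R]_(m, n)) := c * (qform (Q x) (col j y) - \tr (Q x)).

Let measurable_Q : measurable_fun setT Q.
Proof.
apply: measurable_resolvent => //; last by move=> x; exact: psdmx_loo.
apply: measurable_fun_mxP => i k.
rewrite (_ : (fun _ => _) = (fun x : 'M[R]_(m, n) =>
   \sum_(l | l != j) c * (x i l * x k l))); last first.
  apply/funext => x; rewrite summxE; apply: eq_bigr => l _.
  by rewrite !mxE big_ord1 !mxE.
under eq_fun do rewrite big_mkcond.
apply: measurable_sum => l; case: (l != j) => //; apply: measurable_funM => //.
by apply: measurable_funM; exact: measurable_mx_coef.
Qed.

Lemma measurable_loo_deviation : measurable_fun setT (fun x => D x x).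
Proof.
apply: measurable_funM => //; apply: measurable_funB; last exact: measurable_mxtrace.
apply: (measurableT_comp (measurable_mx_coef 0 0)).
have mcol : measurable_fun setT (@col R m n j).
  apply: measurable_fun_mxP => i k.
  rewrite (_ : (fun _ => _) = (fun x : 'M[R]_(m, n) => x i j)).
    exact: measurable_mx_coef.
  by apply/funext => x; rewrite mxE.
apply: measurable_fun_mulmx => //; apply: measurable_fun_mulmx => //.
exact: measurable_fun_trmx.
Qed.

Let D_mix (x y : 'M[R]_(m, n)) (K := mix_mx (fun _ k => k != j) (x, y)) :
  D K K = D x y.
Proof.
have QK : Q K = Q x.
  rewrite /Q /loo_gram; congr (resolvent _ z); apply: eq_bigr => k kj.
  suff -> : col k K = col k x by [].
  by apply/matrixP => i l; rewrite !mxE kj.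
rewrite /D QK; suff -> : col j K = col j y by [].
by apply/matrixP => i l; rewrite !mxE eqxx.
Qed.

(** Column [j] is independent of the resolvent that omits it. Mixing freezes the resolvent, and the
    inner integral is the variance of a Gaussian quadratic form, bounded uniformly by
    [resolvent_frobenius_le]. *)
Lemma loo_variance :
  (\int[mu]_x (D x x ^+ 2)%:E <= (c ^+ 2 * (2 * (m%:R / z ^+ 2)))%:E)%E.
Proof.
have mD2 : measurable_fun setT (fun x => (D x x ^+ 2)%:E).
  by apply/measurable_EFinP; apply: measurable_funX; exact: measurable_loo_deviation.
have D20 x : (0 <= (D x x ^+ 2)%:E)%E by rewrite lee_fin sqr_ge0.
rewrite (ge0_integral_mix_mx gamma (fun _ k => k != j) mD2 D20).
apply: (@le_trans _ _ (\int[mu]_x (c ^+ 2 * (2 * (m%:R / z ^+ 2)))%:E)%E); last first.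
  by rewrite integral_cst// [X in (_ * X)%E](probability_setT mu) mule1.
apply: ge0_le_integral => //.
- by move=> x _; exact: integral_ge0.
- pose G (p : 'M[R]_(m, n) * 'M[R]_(m, n)) :=
    (D (mix_mx (fun _ k => k != j) p) (mix_mx (fun _ k => k != j) p) ^+ 2)%:E.
  apply: (measurable_fun_fubini_tonelli_F (m2 := mu) G) => //.
    exact: (measurableT_comp mD2 (measurable_mix_mx _)).
  by move=> p; exact: D20.
- move=> x _.
  under eq_integral do rewrite D_mix /D exprMn EFinM.
  have sQ : (Q x)^T = Q x by apply: resolvent_sym => //; exact: psdmx_loo.
  pose F (g : 'M[R]_(m, 1)) := ((qform (Q x) g - \tr (Q x)) ^+ 2)%:E.
  have mF : measurable_fun setT F.
    apply/measurable_EFinP; apply: measurable_funX; apply: measurable_funB => //.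
    apply: (measurableT_comp (measurable_mx_coef 0 0)).
    apply: measurable_fun_mulmx; last exact: measurable_id.
    apply: measurable_fun_mulmx; last exact: measurable_cst.
    by apply: measurable_fun_trmx; exact: measurable_id.
  have F0 g : (0 <= F g)%E by rewrite lee_fin sqr_ge0.
  have mcol : measurable_fun setT (@col R m n j).
    apply: measurable_fun_mxP => i k.
    rewrite (_ : (fun _ => _) = (fun x : 'M[R]_(m, n) => x i j)).
      exact: measurable_mx_coef.
    by apply/funext => y; rewrite mxE.
  rewrite (@ge0_integralZl _ _ _ mu _ measurableT _ (measurableT_comp mF mcol))//; last 2 first.
    by move=> y _; exact: F0.
    by rewrite lee_fin sqr_ge0.
  rewrite (ge0_integral_iid_col gamma j mF F0) gaussian_col_variance//.
  rewrite -EFinM lee_fin ler_wpM2l ?sqr_ge0// ler_wpM2l//.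
  by apply: resolvent_frobenius_le => //; exact: psdmx_loo.
Qed.

(** From |D| <= e/2 + D^2 / (2 e), with e free; this stands in for Cauchy-Schwarz, and e becomes a
    function of n in [stieltjes_bound_cvg0]. *)
Lemma loo_deviation (e : R) : 0 < e ->
  (\int[mu]_x `|D x x|%:E <= (e / 2 + m%:R / (e * n%:R ^+ 2 * z ^+ 2))%:E)%E.
Proof.
move=> e0.
have mD2 : measurable_fun setT (fun x => (D x x ^+ 2)%:E).
  by apply/measurable_EFinP; apply: measurable_funX; exact: measurable_loo_deviation.
have D20 x : setT x -> (0 <= (D x x ^+ 2)%:E)%E by rewrite lee_fin sqr_ge0.
have e20 : 0 <= (2 * e)^-1 by rewrite invr_ge0 mulr_ge0// ltW.
have me : measurable_fun setT (fun x => ((2 * e)^-1)%:E * (D x x ^+ 2)%:E)%E.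
  exact: measurable_funeM.
apply: (@le_trans _ _ (\int[mu]_x ((e / 2)%:E + ((2 * e)^-1)%:E * (D x x ^+ 2)%:E))%E).
  apply: ge0_le_integral => //.
  - by apply/measurable_EFinP; apply: measurableT_comp => //; exact: measurable_loo_deviation.
  - exact: emeasurable_funD.
  - move=> x _; rewrite -EFinM -EFinD lee_fin -(real_normK (num_real (D x x))).
    rewrite -subr_ge0.
    have -> : e / 2 + (2 * e)^-1 * `|D x x| ^+ 2 - `|D x x| =
        (2 * e)^-1 * (e - `|D x x|) ^+ 2.
      by field; rewrite gt_eqF.
    by rewrite mulr_ge0// sqr_ge0.
rewrite ge0_integralD//; last 2 first.
- by move=> x _; rewrite lee_fin divr_ge0// ltW.
- by move=> x _; rewrite mule_ge0 ?lee_fin ?sqr_ge0.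
rewrite integral_cst// [X in (_ * X + _)%E](probability_setT mu) mule1.
rewrite ge0_integralZl//.
apply: (@le_trans _ _ ((e / 2)%:E + ((2 * e)^-1)%:E * (c ^+ 2 * (2 * (m%:R / z ^+ 2)))%:E)%E).
  by rewrite leeD2l// lee_wpmul2l ?lee_fin//; exact: loo_variance.
rewrite -EFinM -EFinD lee_fin lerD2l le_eqVlt; apply/orP; left; apply/eqP.
by rewrite /c; field; rewrite !gt_eqF.
Qed.

End loo_deviation.
Let devsum (x : 'M[R]_(m, n)) : R := \sum_(j < n)
  `|c * (qform (resolvent (loo_gram c x j) z) (col j x) -
         \tr (resolvent (loo_gram c x j) z))|.

(** The difference of the two residuals factors as (t - s) (z + 1 / ((1 + kappa s) (1 + kappa t))),
    and the second factor is at least z. *)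
Lemma fixed_point_stable (kappa s t : R) : 0 <= kappa -> 0 <= s -> 0 <= t ->
  1 - z * t = t / (1 + kappa * t) ->
  `|s - t| <= z^-1 * `|(1 - z * s) - s / (1 + kappa * s)|.
Proof.
move=> k0 s0 t0 ht.
have ks : 0 < 1 + kappa * s by rewrite ltr_wpDr// mulr_ge0.
have kt : 0 < 1 + kappa * t by rewrite ltr_wpDr// mulr_ge0.
have -> : (1 - z * s) - s / (1 + kappa * s) =
    - ((s - t) * (z + ((1 + kappa * s) * (1 + kappa * t))^-1)).
  transitivity ((1 - z * s) - s / (1 + kappa * s) - ((1 - z * t) - t / (1 + kappa * t))).
    by rewrite ht subrr subr0.
  by field; rewrite !gt_eqF.
rewrite normrN normrM mulrCA ler_peMr// mulrC ler_pdivlMr// mul1r.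
rewrite ger0_norm ?addr_ge0 ?ltW ?invr_gt0 ?mulr_gt0//.
by rewrite ltrDl invr_gt0 mulr_gt0.
Qed.

(** The leave-one-out equation holds with m/n in place of its limit; this is the price of the
    replacement. *)
Lemma kappa_stable (kappa kappa' s : R) : 0 <= kappa -> 0 <= kappa' ->
  0 <= s -> s <= z^-1 ->
  `|s / (1 + kappa * s) - s / (1 + kappa' * s)| <= `|kappa - kappa'| / z ^+ 2.
Proof.
move=> k0 k'0 s0 sz.
have ks : 1 <= 1 + kappa * s by rewrite lerDl mulr_ge0.
have ks' : 1 <= 1 + kappa' * s by rewrite lerDl mulr_ge0.
have p : 0 < (1 + kappa * s) * (1 + kappa' * s).
  by rewrite mulr_gt0// (lt_le_trans ltr01).
have -> : s / (1 + kappa * s) - s / (1 + kappa' * s) =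
    (kappa' - kappa) * (s ^+ 2 / ((1 + kappa * s) * (1 + kappa' * s))).
  by field; rewrite !gt_eqF// (lt_le_trans ltr01).
rewrite normrM distrC ler_wpM2l// ger0_norm; last by rewrite divr_ge0 ?sqr_ge0 ?ltW.
rewrite -exprVn (@le_trans _ _ (s ^+ 2))//.
  by rewrite ler_pdivrMr// ler_peMr ?sqr_ge0// mulr_ege1.
by rewrite ler_pXn2r// nnegrE// invr_ge0 ltW.
Qed.

Lemma stieltjes_centered_bound (kappa t : R) (x : 'M[R]_(m, n)) :
  0 <= kappa -> 0 <= t -> 1 - z * t = t / (1 + kappa * t) ->
  `|stieltjes z (centered x) - t| <=
  z^-1 * (m%:R^-1 * (devsum x + z^-1) + `|kappa - m%:R / n%:R| / z ^+ 2) +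
  2 / z / m%:R.
Proof.
move=> k0 t0 ht; rewrite (le_trans (ler_distD (stieltjes z x) _ _))//.
rewrite [leRHS]addrC; apply: lerD; first exact: stieltjes_centered.
have s0 := stieltjes_ge0 x; have sz := stieltjes_le x.
rewrite (le_trans (fixed_point_stable k0 s0 t0 ht))//.
apply: ler_wpM2l; first by rewrite invr_ge0 ltW.
have kn0 : 0 <= m%:R / n%:R :> R by rewrite divr_ge0.
rewrite (le_trans (ler_distD (stieltjes z x / (1 + m%:R / n%:R * stieltjes z x)) _ _))//.
apply: lerD; last by rewrite distrC; exact: kappa_stable.
have := loo_bound x m0 n0 z0.
by under eq_bigr do rewrite -mulrBr.
Qed.

Lemma stieltjes_mean_bound (kappa t e : R) :
  0 <= kappa -> 0 <= t -> 1 - z * t = t / (1 + kappa * t) -> 0 < e ->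
  (\int[mu]_x `|stieltjes z (centered x) - t|%:E <=
   (z^-1 * (m%:R^-1 * (n%:R * (e / 2 + m%:R / (e * n%:R ^+ 2 * z ^+ 2)) + z^-1)
      + `|kappa - m%:R / n%:R| / z ^+ 2) + 2 / z / m%:R)%:E)%E.
Proof.
move=> k0 t0 ht e0.
(* The pointwise bound is affine in [devsum]: [A] is its slope and [B] the deterministic
   remainder. *)
pose A := z^-1 * m%:R^-1.
pose B := z^-1 * (m%:R^-1 * z^-1 + `|kappa - m%:R / n%:R| / z ^+ 2) + 2 / z / m%:R.
have A0 : 0 <= A by rewrite mulr_ge0 ?invr_ge0 ?ltW.
have B0 : 0 <= B.
  by rewrite addr_ge0 ?mulr_ge0 ?addr_ge0 ?mulr_ge0 ?invr_ge0 ?exprn_ge0 ?mulr_ge0 ?(ltW z0).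
have mD j : measurable_fun setT (fun x : 'M[R]_(m, n) =>
    `|c * (qform (resolvent (loo_gram c x j) z) (col j x) -
         \tr (resolvent (loo_gram c x j) z))|%:E).
  by apply/measurable_EFinP; apply: measurableT_comp => //; exact: measurable_loo_deviation.
have mdev : measurable_fun setT (fun x => (devsum x)%:E).
  by apply/measurable_EFinP; apply: measurable_sum => j; apply/measurable_EFinP; exact: mD.
have dev0 x : (0 <= (devsum x)%:E)%E by rewrite lee_fin; exact: sumr_ge0.
apply: (@le_trans _ _ (\int[mu]_x (A%:E * (devsum x)%:E + B%:E))%E).
  apply: ge0_le_integral => //.
  - apply/measurable_EFinP; apply: measurableT_comp => //; apply: measurable_funB => //.
    exact: (measurableT_comp measurable_stieltjes (@measurable_centered R m n)).
  - by apply: emeasurable_funD => //; exact: measurable_funeM.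
  - move=> x _; rewrite -EFinM -EFinD lee_fin.
    rewrite (le_trans (stieltjes_centered_bound x k0 t0 ht))// le_eqVlt.
    by apply/orP; left; apply/eqP; rewrite /A /B; ring.
rewrite ge0_integralD//; last 2 first.
- by move=> x _; rewrite mule_ge0// lee_fin.
- exact: measurable_funeM.
rewrite integral_cst// [X in (_ + _ * X)%E](probability_setT mu) mule1.
rewrite ge0_integralZl//.
have -> : (\int[mu]_x (devsum x)%:E = \sum_(j < n) \int[mu]_x
    `|c * (qform (resolvent (loo_gram c x j) z) (col j x) -
         \tr (resolvent (loo_gram c x j) z))|%:E)%E.
  rewrite -ge0_integral_sum//.
  by apply: eq_integral => x _; rewrite /devsum sumEFin.
apply: (@le_trans _ _ (A%:E * \sum_(j < n) (e / 2 + m%:R / (e * n%:R ^+ 2 * z ^+ 2))%:E + B%:E)%E).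
  rewrite leeD2r// lee_wpmul2l ?lee_fin//; apply: lee_sum => j _.
  exact: loo_deviation.
rewrite sumEFin sumr_const card_ord -EFinM -EFinD lee_fin le_eqVlt.
by apply/orP; left; apply/eqP; rewrite /A /B -mulr_natl; ring.
Qed.

End fixed_size.

End stieltjes.

(** * The conditional law given the margin *)

Section disintegration.
Context (R : realType).
Local Notation gamma := (std_gaussian R).

Lemma measurable_mx_set1 m n (M : 'M[R]_(m, n)) : measurable [set M].
Proof.
apply: mx_boxes_measurable; exists (fun i j => [set M i j]).
  by move=> i j; exact: measurable_set1.
by apply/seteqP; split => [A -> //|A /= h]; apply/matrixP => i j; exact: h.
Qed.

Lemma measurable_margin_set1 m n (t : margin R m n) : measurable [set t].
Proof.
rewrite (_ : [set t] = [set t.1] `*` [set t.2]).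
  by apply: measurableX; exact: measurable_mx_set1.
by case: t => a b; apply/seteqP; split => [x ->//|[x y] [/= -> ->]].
Qed.

(** Expanding the two projections subtracts row and column means and adds back the grand mean. *)
Lemma centered_margin_mean m n (x : 'M[R]_(m.+1, n.+1)) :
  centered x = x - margin_mean (margin_of x).1 (margin_of x).2.
Proof.
have JE k (M : 'M[R]_(k, n.+1)) i j :
    (M *m center_mx R n.+1) i j = M i j - n.+1%:R^-1 * \sum_l M i l.
  rewrite /center_mx mulmxBr mulmx1 -scalemxAr !mxE; congr (_ - _ * _).
  by apply: eq_bigr => l _; rewrite mxE mulr1.
apply/matrixP => i j; rewrite /centered JE.
have EJ l : (center_mx R m.+1 *m x) i l = x i l - m.+1%:R^-1 * \sum_k x k l.
  rewrite /center_mx mulmxBl mul1mx -scalemxAl !mxE; congr (_ - _ * _).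
  by apply: eq_bigr => k _; rewrite mxE mul1r.
rewrite EJ (eq_bigr _ (fun l _ => EJ l)).
rewrite sumrB -mulr_sumr exchange_big /= !mxE.
have -> : \sum_k (margin_of x).1 k 0 = \sum_k \sum_l x k l.
  by apply: eq_bigr => k _; rewrite mxE.
rewrite natrM; field.
by rewrite ?nat1r ?natr1 !pnatr_eq0.
Qed.

Variable lam : forall m n : nat, R.-ker (margin R m n) ~> 'M[R]_(m, n).
Hypothesis lam_disint : forall m n,
  is_disintegration (iid_mx gamma m n) (lam m n) (@margin_of R m n).

Lemma measurable_lam_integral m n (F : 'M[R]_(m, n) -> \bar R) :
  measurable_fun setT F -> (forall x, 0 <= F x)%E ->
  measurable_fun setT (fun t => \int[lam m n t]_x F x)%E.
Proof.
move=> mF F0; apply: measurable_fun_integral_kernel => //.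
by move=> U mU; exact: measurable_kernel.
Qed.

Lemma eq_integral_on_fiber m n (t : margin R m n) (F G : 'M[R]_(m, n) -> \bar R) :
  lam m n t (~` (@margin_of R m n @^-1` [set t])) = 0%E ->
  measurable_fun setT F -> (forall x, 0 <= F x)%E ->
  measurable_fun setT G -> (forall x, 0 <= G x)%E ->
  (forall x, margin_of x = t -> F x = G x) ->
  (\int[lam m n t]_x F x = \int[lam m n t]_x G x)%E.
Proof.
move=> lam0 mF F0 mG G0 FG; apply: ge0_ae_eq_integral => //.
exists (~` (@margin_of R m n @^-1` [set t])); split => //.
  apply: measurableC; rewrite -[X in measurable X]setTI.
  by apply: measurable_margin_of => //; exact: measurable_margin_set1.
by move=> x /= h1 h2; apply: h1 => _; exact: FG.
Qed.

(** Over any measurable set B of margins, disintegration and independence make the integral of the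
    conditional mean of H (centered x) a constant times the mass of B, so this conditional mean is
    almost everywhere constant. On the fiber over t, [centered x] is x minus the mean matrix of t.
    The bound C gives integrability. *)
Lemma lam_integral_ae m n (H : 'M[R]_(m.+1, n.+1) -> R) (C : R) :
  measurable_fun setT H -> (forall x, 0 <= H x <= C) ->
  {ae margin_law gamma m.+1 n.+1, forall t,
    (\int[lam m.+1 n.+1 t]_x (H (x - margin_mean t.1 t.2)%R)%:E =
     \int[iid_mx gamma m.+1 n.+1]_x (H (centered x))%:E)%E}.
Proof.
move=> mH H0C; set mu := iid_mx _ _ _; set nu := margin_law _ _ _.
have [conc disint] := lam_disint m.+1 n.+1.
pose Hc (x : 'M[R]_(m.+1, n.+1)) := (H (centered x))%:E.
have mHc : measurable_fun setT Hc.
  by apply/measurable_EFinP; exact: (measurableT_comp mH (@measurable_centered R _ _)).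
have Hc0 x : (0 <= Hc x)%E by rewrite lee_fin; case/andP: (H0C (centered x)).
have HcC x : (Hc x <= C%:E)%E by rewrite lee_fin; case/andP: (H0C (centered x)).
pose K t := (\int[lam m.+1 n.+1 t]_x Hc x)%E.
have mK : measurable_fun setT K by exact: measurable_lam_integral.
have K0 t : (0 <= K t)%E by exact: integral_ge0.
have IC : (\int[mu]_x Hc x <= C%:E)%E.
  apply: (@le_trans _ _ (\int[mu]_x C%:E)%E); first exact: ge0_le_integral.
  by rewrite integral_cst// [X in (_ * X)%E](probability_setT mu) mule1.
have I0 : (0 <= \int[mu]_x Hc x)%E by exact: integral_ge0.
have Ifin : (\int[mu]_x Hc x)%E \is a fin_num.
  by rewrite ge0_fin_numE// (le_lt_trans IC)// ltry.
set c := fine (\int[mu]_x Hc x)%E.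
have cE : (\int[mu]_x Hc x)%E = c%:E by rewrite fineK.
have key B : measurable B -> (\int[nu]_(t in B) K t = \int[nu]_(t in B) c%:E)%E.
  move=> mB.
  pose iB (t : margin R m.+1 n.+1) : \bar R := (\1_B t)%:E.
  have miB : measurable_fun setT iB by apply/measurable_EFinP; exact: measurable_indic.
  have iB0 t : (0 <= iB t)%E by rewrite lee_fin.
  have mpi := @measurable_margin_of R m.+1 n.+1.
  have mh : measurable_fun setT (fun x => Hc x * iB (margin_of x))%E.
    by apply: emeasurable_funM => //; exact: measurableT_comp.
  have h0 x : (0 <= Hc x * iB (margin_of x))%E by rewrite mule_ge0.
  have e1 := disint _ mh h0.
  have e2 := gaussian_independence (H := fun x => (H x)%:E) (F := iB) _ _ miB iB0.
  transitivity (\int[nu]_t (K t * iB t))%E.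
    rewrite integral_mkcond; apply: eq_integral => t _; rewrite patchE /iB indicE.
    by case: ifPn => _; rewrite ?mule1 ?mule0.
  transitivity (\int[nu]_t \int[lam m.+1 n.+1 t]_x (Hc x * iB (margin_of x)))%E.
    apply: ge0_ae_eq_integral => //.
    - exact: emeasurable_funM.
    - exact: measurable_lam_integral.
    - by move=> t _; rewrite mule_ge0.
    - by move=> t _; exact: integral_ge0.
    - apply: filterS conc => t [_ lam0] _.
      rewrite -ge0_integralZr//; apply: eq_integral_on_fiber => //.
      + exact: emeasurable_funM.
      + by move=> x; rewrite mule_ge0.
      + by move=> x ->.
  rewrite -e1 e2//; last 2 first.
  - exact/measurable_EFinP.
  - by move=> x; rewrite lee_fin; case/andP: (H0C x).
  rewrite -/(Hc _) cE [RHS]integral_cst//; congr (_ * _)%E.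
  transitivity (\int[nu]_t iB t)%E; last by rewrite integral_indic// setIT.
  by rewrite /nu /margin_law /distribution [RHS]ge0_integral_pushforward.
have iK : nu.-integrable setT K.
  apply/integrableP; split => //.
  under eq_integral do rewrite gee0_abs//.
  by rewrite key// integral_cst// [X in (_ * X)%E](probability_setT nu) mule1 ltry.
have ae_c : ae_eq nu setT K (cst c%:E).
  by apply: integral_ae_eq => // B _ mB; exact: key.
apply: filterS2 conc ae_c => t [_ lam0] /(_ I) Kc.
rewrite -/(Hc _) cE -[RHS]Kc /K; apply: eq_integral_on_fiber => //.
- apply/measurable_EFinP; apply: (measurableT_comp mH).
  apply: measurable_fun_mxP => i j.
  rewrite (_ : (fun _ => _) = (fun x : 'M[R]_(m.+1, n.+1) => x i j - margin_mean t.1 t.2 i j)).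
    by apply: measurable_funB => //; exact: measurable_mx_coef.
  by apply/funext => x; rewrite !mxE.
- by move=> x; rewrite lee_fin; case/andP: (H0C (x - margin_mean t.1 t.2)).
- by move=> x xt; rewrite /Hc centered_margin_mean xt.
Qed.

End disintegration.

(** * The null set of exceptional margins *)

Section exceptional_set.
Context (R : realType).
Local Notation gamma := (std_gaussian R).
Variable lam : forall m n : nat, R.-ker (margin R m n) ~> 'M[R]_(m, n).
Hypothesis lam_disint : forall m n,
  is_disintegration (iid_mx gamma m n) (lam m n) (@margin_of R m n).

(* Only countably many conditions, so that failing margins form a null set. *)
Definition good_margin m n (t : margin R m n) : Prop :=
  lam m n t [set: 'M[R]_(m, n)] = 1%E /\
  forall a b : rat, 0 < a ->
    (\int[lam m n t]_x `|stieltjes (ratr a : R) (x - margin_mean t.1 t.2) - ratr b|%:E =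
     \int[iid_mx gamma m n]_x `|stieltjes (ratr a : R) (centered x) - ratr b|%:E)%E.

(** Empty matrices are left out; along sizes that tend to infinity both dimensions are eventually
    positive. *)
Definition exceptional m n : set (margin R m n) :=
  [set t | [/\ (0 < m)%N, (0 < n)%N & ~ good_margin t]].

Lemma exceptional_negligible m n :
  (margin_law gamma m n).-negligible (@exceptional m n).
Proof.
case: m => [|m]; first by apply: negligibleS (negligible_set0 _) => t [].
case: n => [|n]; first by apply: negligibleS (negligible_set0 _) => t [].
suff : {ae margin_law gamma m.+1 n.+1, forall t, @good_margin m.+1 n.+1 t}.
  by apply: negligibleS => t [].
have [conc _] := lam_disint m.+1 n.+1.
pose Q (a b : rat) (t : margin R m.+1 n.+1) : Prop := 0 < a ->
    (\int[lam m.+1 n.+1 t]_x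
        `|stieltjes (ratr a : R) (x - margin_mean t.1 t.2) - ratr b|%:E =
     \int[iid_mx gamma m.+1 n.+1]_x
        `|stieltjes (ratr a : R) (centered x) - ratr b|%:E)%E.
(* Pairs of rationals are enumerated by [unpickle], so that one countable intersection covers all
   conditions. *)
pose P (k : nat) (t : margin R m.+1 n.+1) : Prop :=
  forall ab : rat * rat, unpickle k = Some ab -> Q ab.1 ab.2 t.
have aeP k : {ae margin_law gamma m.+1 n.+1, forall t, P k t}.
  rewrite /P; case: unpickle => [[a b]|]; last by apply: aeW.
  suff aeQ : {ae margin_law gamma m.+1 n.+1, forall t, Q a b t}.
    by apply: filterS aeQ => t Qt _ [<-].
  have [a0|a0] := ltP 0 a; last by apply: aeW => t; rewrite /Q ltNge a0.
  have z0 : 0 < ratr a :> R by rewrite ltr0q.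
  pose H (x : 'M[R]_(m.+1, n.+1)) := `|stieltjes (ratr a : R) x - ratr b|.
  have mH : measurable_fun setT H.
    by apply: measurableT_comp => //; apply: measurable_funB => //; exact: measurable_stieltjes.
  have HC x : 0 <= H x <= (ratr a)^-1 + `|ratr b|.
    rewrite normr_ge0 /= (le_trans (ler_normB _ _))// lerD2r.
    by rewrite ger0_norm ?stieltjes_ge0 ?stieltjes_le.
  by apply: filterS (lam_integral_ae lam_disint mH HC) => t Ht _.
apply: filterS2 conc (ae_foralln aeP) => t [t1 _] Pt; split => // a b a0.
exact: (Pt (pickle (a, b)) (a, b) (pickleK _)).
Qed.

(** Moving the center from s to a rational changes each side by at most their distance, so rational
    centers suffice. The center will be a value of the limiting Stieltjes transform, which need not
    be rational. *)
Lemma good_marginP m n (t : margin R m n) (a : rat) (s : R) :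
  (0 < m)%N -> (0 < n)%N -> 0 < a -> good_margin t ->
  (\int[lam m n t]_x `|stieltjes (ratr a : R) (x - margin_mean t.1 t.2) - s|%:E <=
   \int[iid_mx gamma m n]_x `|stieltjes (ratr a : R) (centered x) - s|%:E)%E.
Proof.
move=> m0 n0 a0 [t1 gt]; have z0 : 0 < ratr a :> R by rewrite ltr0q.
set mu := iid_mx gamma m n.
pose S (x : 'M[R]_(m, n)) := stieltjes (ratr a : R) x.
have mS : measurable_fun setT S by exact: measurable_stieltjes.
have mSc : measurable_fun setT (fun x : 'M[R]_(m, n) => S (centered x)).
  exact: (measurableT_comp mS (@measurable_centered R m n)).
have mSt : measurable_fun setT (fun x : 'M[R]_(m, n) => S (x - margin_mean t.1 t.2)).
  apply: (measurableT_comp mS); apply: measurable_fun_mxP => i j.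
  rewrite (_ : (fun _ => _) = (fun x : 'M[R]_(m, n) => x i j - margin_mean t.1 t.2 i j)).
    by apply: measurable_funB => //; exact: measurable_mx_coef.
  by apply/funext => x; rewrite !mxE.
have mabs (f : 'M[R]_(m, n) -> R) (r : R) : measurable_fun setT f ->
    measurable_fun setT (fun x => `|f x - r|%:E).
  by move=> mf; apply/measurable_EFinP; apply: measurableT_comp => //; exact: measurable_funB.
have shift (P : {measure set 'M[R]_(m, n) -> \bar R}) (f : 'M[R]_(m, n) -> R) (r r' : R) :
    P setT = 1%E -> measurable_fun setT f ->
    (\int[P]_x `|f x - r|%:E <= \int[P]_x `|f x - r'|%:E + `|r' - r|%:E)%E.
  move=> P1 mf; apply: (@le_trans _ _ (\int[P]_x (`|f x - r'|%:E + `|r' - r|%:E))%E).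
    apply: ge0_le_integral => //; first exact: mabs.
      by apply: emeasurable_funD => //; exact: mabs.
    by move=> x _; rewrite -EFinD lee_fin ler_distD.
  rewrite ge0_integralD//; last exact: mabs.
  by rewrite integral_cst// P1 mule1.
apply/lee_addgt0Pr => e e0.
have [q /[!in_itv]/= /andP[sq qs]] : exists q : rat, ratr q \in `]s, (s + e / 2)[.
  by apply: rat_in_itvoo; rewrite ltrDl divr_gt0.
have d1 : `|ratr q - s| <= e / 2 by rewrite ger0_norm; lra.
apply: (le_trans (shift _ _ s (ratr q) t1 mSt)).
rewrite gt//.
apply: (@le_trans _ _ ((\int[mu]_x `|S (centered x) - s|%:E + `|s - ratr q|%:E) +
    `|ratr q - s|%:E)%E).
  by rewrite leeD2r//; apply: shift => //; exact: probability_setT.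
rewrite -addeA leeD2l// -EFinD lee_fin distrC; lra.
Qed.

End exceptional_set.

(** * Empirical eigenvalue distributions *)

Section esd_theory.
Context (R : realType).

Lemma esd_Rintegral m (A : 'M[R]_m) (f : R -> R) : measurable_fun setT f ->
  \int[esd A]_y f y = m%:R^-1 * \sum_(i < m) f (eigenvalues A)`_i.
Proof.
move=> mf.
(* The sum of Dirac masses is integrated termwise for nonnegative functions, hence the detour
   through positive and negative parts. *)
have ge0 (F : R -> \bar R) : measurable_fun setT F -> (forall x, 0 <= F x)%E ->
    (\int[esd A]_y F y = (m%:R^-1)%:E * \sum_(i < m) F (eigenvalues A)`_i)%E.
  move=> mF F0; rewrite /esd ge0_integral_mscale//; congr (_ * _)%E.
  rewrite ge0_integral_measure_sum//; apply: eq_bigr => i _.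
  by rewrite integral_dirac// diracT mul1e.
have mf' : measurable_fun setT (EFin \o f) by exact/measurable_EFinP.
rewrite /Rintegral integralE !ge0//; last 2 first.
- exact: measurable_funeneg.
- exact: measurable_funepos.
have e (g : R -> R) (h : R -> \bar R) : (forall y, h y = (g y)%:E) ->
    ((m%:R^-1)%:E * \sum_(i < m) h (eigenvalues A)`_i =
     (m%:R^-1 * \sum_(i < m) g (eigenvalues A)`_i)%:E)%E.
  by move=> hg; under eq_bigr do rewrite hg; rewrite sumEFin.
rewrite (e (f^\+)%R); last by move=> y; rewrite funeposE -EFin_max.
rewrite (e (f^\-)%R); last by move=> y; rewrite funenegE -EFin_max.
rewrite -EFinB /= -mulrBr -sumrB; congr (_ * _); apply: eq_bigr => i _.
rewrite /funrpos /funrneg; case: (lerP 0 (f (eigenvalues A)`_i)) => h.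
  by rewrite (max_idPr _) ?oppr_le0// subr0.
by rewrite (max_idPl _) ?oppr_ge0 ?ltW// opprK add0r.
Qed.

Lemma size_eigenvalues m (A : 'M[R]_m) : A^T = A -> size (eigenvalues A) = m.
Proof.
move=> sA; have := congr1 (fun p : {poly R} => size p) (char_poly_eigenvalues sA).
by rewrite size_char_poly size_prod_XsubC => -[].
Qed.

Lemma eigenvalues_ge0 m (A : 'M[R]_m) (a : R) : psdmx A ->
  a \in eigenvalues A -> 0 <= a.
Proof.
move=> [sA pA] aA; have : root (char_poly A) a.
  by rewrite (char_poly_eigenvalues sA) root_prod_XsubC.
rewrite -eigenvalue_root_char => /eigenvalueP[v vA v0].
have h := pA v^T; rewrite /qform trmxK vA -scalemxAl mxE in h.
have vv : 0 < qform 1%:M v^T.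
  rewrite lt_neqAle qform1_ge0 andbT eq_sym.
  by apply: contra v0 => /eqP /qform1_eq0 vt0; rewrite -[v]trmxK vt0 trmx0.
by move: h; rewrite -[v *m v^T](mulmx1 _) -?mulmxA; move: vv; rewrite /qform trmxK mulmx1 mulmx1 => vv; rewrite pmulr_lge0.
Qed.

Lemma char_poly_similar (F : fieldType) m (P D : 'M[F]_m) : P \in unitmx ->
  char_poly (invmx P *m D *m P) = char_poly D.
Proof.
move=> uP; rewrite /char_poly.
have -> : char_poly_mx (invmx P *m D *m P) =
    map_mx polyC (invmx P) *m char_poly_mx D *m map_mx polyC P.
  rewrite /char_poly_mx mulmxBr mulmxBl -!map_mxM; congr (_ - _).
  rewrite scalar_mxC -mulmxA -map_mxM mulVmx// map_mx1 mulmx1//.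
rewrite !det_mulmx mulrAC -det_mulmx -map_mxM mulVmx// map_mx1 det1 mul1r//.
Qed.

(** The list [s] is known only through the characteristic polynomial; unique factorization makes it
    a permutation of the diagonal that the spectral theorem provides. *)
Lemma mxtrace_inv_shift (C : numClosedFieldType) m (B : 'M[C]_m) (s : seq C) (z : C) :
  B \is normalmx -> char_poly B = \prod_(a <- s) ('X - a%:P) ->
  B + z%:M \in unitmx -> \tr (invmx (B + z%:M)) = \sum_(a <- s) (a + z)^-1.
Proof.
move=> /orthomx_spectralP BE cs uBz.
have uP := spectral_unit B; set P := spectralmx B in BE uP; set D := spectral_diag B in BE.
have cB : \prod_(a <- s) ('X - a%:P) = \prod_(a <- [seq D 0 i | i <- enum 'I_m]) ('X - a%:P).
  rewrite -cs BE char_poly_similar// char_poly_trig; last exact: diag_mx_is_trig.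
  by rewrite big_map big_enum; apply: eq_bigr => i _; rewrite mxE eqxx mulr1n.
have /prod_XsubC_eq perm := cB.
have BzE : B + z%:M = invmx P *m (diag_mx D + z%:M) *m P.
  rewrite [in LHS]BE mulmxDr mulmxDl; congr (_ + _).
  by rewrite scalar_mxC -mulmxA mulVmx// mulmx1.
have uDz : diag_mx D + z%:M \in unitmx.
  by move: uBz; rewrite BzE !unitmx_mul unitmx_inv uP /= andbT.
have iD : invmx (diag_mx D + z%:M) = diag_mx (\row_i (D 0 i + z)^-1).
  have nz i : D 0 i + z != 0.
    move: uDz; rewrite unitmxE -diag_const_mx -linearD /= det_diag unitfE => /prodf_neq0 /(_ i isT).
    by rewrite !mxE.
  apply: (can_inj (mulKmx uDz)); rewrite mulmxV// -[z%:M]diag_const_mx -linearD /= mulmx_diag.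
  apply/matrixP => i j; rewrite !mxE; case: eqP => [->|_]; last by rewrite !mulr0n.
  by rewrite !mulr1n mulfV.
have -> : invmx (B + z%:M) = invmx P *m invmx (diag_mx D + z%:M) *m P.
  apply: (can_inj (mulKmx uBz)); rewrite mulmxV// {1}BzE.
  by rewrite !mulmxA mulmxK// mulmxK// mulVmx.
rewrite mxtrace_mulC mulmxA mulmxV// mul1mx iD mxtrace_diag (perm_big _ perm).
by rewrite big_map big_enum; apply: eq_bigr => i _; rewrite mxE.
Qed.

(** The spectral theorem is applied over the complex numbers, and injectivity of the embedding
    brings the identity back. *)
Lemma mxtrace_resolvent_eigenvalues m (A : 'M[R]_m) (z : R) : psdmx A -> 0 < z ->
  \tr (resolvent A z) = \sum_(i < m) ((eigenvalues A)`_i + z)^-1.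
Proof.
move=> pA z0; have sA := pA.1.
pose toC : {rmorphism R -> complex R} := real_complex R.
pose B := map_mx toC A.
have realB : B \is a mxOver Num.real.
  by apply/mxOverP => i j; rewrite mxE complex_real.
have hermB : B \is hermsymmx.
  apply: realsym_hermsym => //; apply/is_hermitianmxP.
  by rewrite expr0 scale1r; apply/matrixP => i j; rewrite !mxE /= -[in LHS]sA mxE.
have cB : char_poly B = \prod_(a <- map toC (eigenvalues A)) ('X - a%:P).
  by rewrite -map_char_poly (char_poly_eigenvalues sA) map_prod_XsubC big_map.
have uBz : B + (toC z)%:M \in unitmx.
  have : map_mx toC (A + z%:M) \in unitmx by rewrite map_unitmx resolvent_unit.
  by rewrite map_mxD map_scalar_mx.
apply: (@fmorph_inj _ _ toC).
transitivity (\tr (invmx (B + (toC z)%:M))).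
  by rewrite /resolvent /B -map_scalar_mx -map_mxD -map_invmx trace_map_mx.
rewrite (mxtrace_inv_shift (hermitian_normalmx hermB) cB uBz).
rewrite big_map (big_nth 0) size_eigenvalues// big_mkord rmorph_sum /=.
by apply: eq_bigr => i _; rewrite fmorphV rmorphD.
Qed.

End esd_theory.

(** * Moments of the Marchenko-Pastur law *)

Section mp_integral.
Context (R : realType).

(** The derivative of asin is unbounded at 1, so the limit comes from monotonicity: u > cos d forces
    asin u > pi/2 - d because sin (pi/2 - d) = cos d. Capping [d] at pi/2 keeps pi/2 - d in the
    range of asin. *)
Lemma cvg_asin1 (F : set_system R) {FF : Filter F} (u : R -> R) :
  u x @[x --> F] --> (1 : R) -> (\forall x \near F, -1 <= u x <= 1) ->
  asin (u x) @[x --> F] --> (pi / 2 : R).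
Proof.
move=> u1 uI; apply/cvgrPdist_lt => e e0.
have p2 : 0 < pi / 2 :> R by rewrite divr_gt0 ?pi_gt0.
pose d := Num.min e (pi / 2).
have d0 : 0 < d by rewrite lt_min e0.
have d2 : d <= pi / 2 by rewrite ge_min lexx orbT.
have cd : cos d < 1.
  by rewrite -cos0 ltr_cos ?in_itv /= ?lexx ?pi_ge0 ?(ltW d0)//; lra.
have hu : \forall x \near F, cos d < u x.
  by apply: (cvgr_gt 1 u1).
near=> x.
have ux : -1 <= u x <= 1 by near: x.
have cu : cos d < u x by near: x.
have aI : asin (u x) \in `[(- (pi / 2)), (pi / 2)].
  by rewrite in_itv /= asin_geNpi2//= asin_lepi2.
have al := asin_lepi2 ux.
rewrite ger0_norm ?subr_ge0// ltrBlDl -ltrBlDr.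
apply: (@le_lt_trans _ _ (pi / 2 - d)); first by rewrite lerD2l lerN2 ge_min lexx.
rewrite -ltr_sin//; last by rewrite in_itv /=; apply/andP; split; lra.
by rewrite asinK ?in_itv// sinB sin_pihalf cos_pihalf mul1r mul0r subr0.
Unshelve. all: by end_near. Qed.

Lemma cvg_asinN1 (F : set_system R) {FF : Filter F} (u : R -> R) :
  u x @[x --> F] --> (- 1 : R) -> (\forall x \near F, -1 <= u x <= 1) ->
  asin (u x) @[x --> F] --> (- (pi / 2) : R).
Proof.
move=> u1 uI; apply/cvgrPdist_lt => e e0.
have p2 : 0 < pi / 2 :> R by rewrite divr_gt0 ?pi_gt0.
pose d := Num.min e (pi / 2).
have d0 : 0 < d by rewrite lt_min e0.
have d2 : d <= pi / 2 by rewrite ge_min lexx orbT.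
have cd : cos d < 1.
  by rewrite -cos0 ltr_cos ?in_itv /= ?lexx ?pi_ge0 ?(ltW d0)//; lra.
have hu : \forall x \near F, u x < - cos d.
  by apply: (cvgr_lt (- 1) u1); rewrite ltrN2.
near=> x.
have ux : -1 <= u x <= 1 by near: x.
have cu : u x < - cos d by near: x.
have aI : asin (u x) \in `[(- (pi / 2)), (pi / 2)].
  by rewrite in_itv /= asin_geNpi2//= asin_lepi2.
have al := asin_geNpi2 ux.
rewrite distrC opprK ger0_norm; last by rewrite -lerBlDr sub0r.
rewrite -ltrBrDr; apply: (@lt_le_trans _ _ (d - pi / 2)); last first.
  by rewrite lerD2r ge_min lexx.
rewrite -ltr_sin//; last by rewrite in_itv /=; apply/andP; split; lra.
by rewrite asinK ?in_itv// sinB sin_pihalf cos_pihalf mulr1 mulr0 sub0r.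
Unshelve. all: by end_near. Qed.

Section primitive.
Variables a b z : R.
Hypotheses (ab : a < b) (az : 0 < a + z).

Let u (x : R) : R := 2 / (b - a) * x + (- (a + b) / (b - a)).
Let c : R := 2 * ((a + z) * (b + z)) / (b - a).
Let v (x : R) : R := (a + b + 2 * z) / (b - a) + (- c) * (x + z)^-1.
Let Q (x : R) : R := (b - x) * (x - a).

(** The arguments of the arcsines are [u], affine, and [v], homographic, both sending a, b to -1, 1.
    As 1 - u^2 and 1 - v^2 are (b - x)(x - a) times the square of a rational function, up to
    constants, both arcsines have derivatives of the form rational over sqrt((b - x)(x - a)). *)
Definition mp_primitive (x : R) : R :=
  Num.sqrt ((b - x) * (x - a)) +
  (a + b + 2 * z) / 2 * asin (2 / (b - a) * x + (- (a + b) / (b - a))) +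
  (- Num.sqrt ((a + z) * (b + z))) *
    asin ((a + b + 2 * z) / (b - a) + (- (2 * ((a + z) * (b + z)) / (b - a))) * (x + z)^-1).

Let ba0 : 0 < b - a. Proof. by rewrite subr_gt0. Qed.
Let bz : 0 < b + z. Proof. by apply: lt_trans az _; rewrite ltrD2r. Qed.
Let ba_neq0 : b - a != 0. Proof. exact: lt0r_neq0. Qed.

Let xz0 x : a <= x -> 0 < x + z.
Proof. by move=> ax; apply: lt_le_trans az _; rewrite lerD2r. Qed.

Let uE x : 1 - u x ^+ 2 = 4 * Q x / (b - a) ^+ 2.
Proof. by rewrite /u /Q; field. Qed.

Let vE x : a <= x -> 1 - v x ^+ 2 =
  4 * ((a + z) * (b + z)) * Q x / ((x + z) * (b - a)) ^+ 2.
Proof.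
move=> ax; have xz := lt0r_neq0 (xz0 ax).
by rewrite /v /c /Q; field; rewrite ba_neq0 xz.
Qed.

Let Q_ge0 x : a <= x <= b -> 0 <= Q x.
Proof. by move=> /andP[ax xb]; rewrite /Q mulr_ge0 ?subr_ge0. Qed.

Let Q_gt0 x : a < x < b -> 0 < Q x.
Proof. by move=> /andP[ax xb]; rewrite /Q mulr_gt0 ?subr_gt0. Qed.

Let sqr_le1 (w : R) : 0 <= 1 - w ^+ 2 -> -1 <= w <= 1.
Proof. by rewrite subr_ge0 -ler_norml -real_normK ?num_real// expr_le1. Qed.

Let sqr_lt1 (w : R) : 0 < 1 - w ^+ 2 -> -1 < w < 1.
Proof. by rewrite subr_gt0 -ltr_norml -real_normK ?num_real// expr_lt1. Qed.

Let uI x : a <= x <= b -> -1 <= u x <= 1.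
Proof.
move=> axb; apply: sqr_le1; rewrite uE.
by rewrite mulr_ge0 ?invr_ge0 ?sqr_ge0// mulr_ge0// Q_ge0.
Qed.

Let vI x : a <= x <= b -> -1 <= v x <= 1.
Proof.
move=> /[dup] axb /andP[ax _]; apply: sqr_le1; rewrite vE//.
by rewrite mulr_ge0 ?invr_ge0 ?sqr_ge0// mulr_ge0 ?Q_ge0// mulr_ge0// mulr_ge0 ?ltW.
Qed.

Let is_derive_u (x : R) : is_derive x 1 u (2 / (b - a)).
Proof.
have := derive1_add (derive1_cstl (2 / (b - a)) (is_derive_id (x : R) (1 : R)))
  (is_derive_cst (- (a + b) / (b - a)) (x : R) (1 : R)).
by move/is_derive_eq; apply; rewrite addr0 mulr1.
Qed.

Let is_derive_v x : a <= x -> is_derive x 1 v (c / (x + z) ^+ 2).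
Proof.
move=> ax; have xz := lt0r_neq0 (xz0 ax).
have := derive1_add (is_derive_cst ((a + b + 2 * z) / (b - a)) (x : R) (1 : R))
  (derive1_cstl (- c) (derive1_inv (f := fun y => y + z) xz
    (derive1_add (is_derive_id (x : R) (1 : R)) (is_derive_cst z (x : R) (1 : R))))).
by move/is_derive_eq; apply; rewrite addr0 add0r !mulNr mulrN opprK div1r.
Qed.

Let is_derive_Q (x : R) : is_derive x 1 Q (a + b - 2 * x).
Proof.
have := derive1_mul
  (derive1_add (is_derive_cst b (x : R) (1 : R)) (derive1_opp (is_derive_id (x : R) (1 : R))))
  (derive1_add (is_derive_id (x : R) (1 : R)) (is_derive_cst (- a) (x : R) (1 : R))).
by move/is_derive_eq; apply; rewrite /cst /=; ring.
Qed.

Lemma is_derive_mp_primitive x : a < x < b ->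
  is_derive x 1 mp_primitive (Num.sqrt ((b - x) * (x - a)) / (x + z)).
Proof.
move=> axb; have /andP[ax xb] := axb.
have xz := xz0 (ltW ax); have Q0 := Q_gt0 axb.
pose q := Num.sqrt (Q x); pose S := Num.sqrt ((a + z) * (b + z)).
have q0 : 0 < q by rewrite sqrtr_gt0.
have S0 : 0 < S by rewrite sqrtr_gt0 mulr_gt0.
have q2 : q ^+ 2 = Q x by rewrite sqr_sqrtr// ltW.
have S2 : S ^+ 2 = (a + z) * (b + z) by rewrite sqr_sqrtr// mulr_ge0 ?ltW.
have su : Num.sqrt (1 - u x ^+ 2) = 2 * q / (b - a).
  rewrite uE -q2 (_ : _ / _ = (2 * q / (b - a)) ^+ 2); last by field.
  by rewrite sqrtr_sqr ger0_norm// divr_ge0 ?ltW// mulr_gt0.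
have sv : Num.sqrt (1 - v x ^+ 2) = 2 * S * q / ((x + z) * (b - a)).
  rewrite (vE (ltW ax)) -q2 -S2.
  rewrite (_ : _ / _ = (2 * S * q / ((x + z) * (b - a))) ^+ 2); last first.
    by field; rewrite ba_neq0 lt0r_neq0.
  by rewrite sqrtr_sqr ger0_norm// divr_ge0 ?ltW// !mulr_gt0.
have u1 : -1 < u x < 1.
  by apply: sqr_lt1; rewrite uE divr_gt0 ?exprn_gt0// mulr_gt0.
have v1 : -1 < v x < 1.
  apply: sqr_lt1; rewrite (vE (ltW ax)); apply: divr_gt0; last first.
    by rewrite exprn_gt0// mulr_gt0.
  by apply: mulr_gt0 => //; apply: mulr_gt0 => //; apply: mulr_gt0.
have := derive1_add (derive1_add
    (derive1_chain (is_derive_Q x) (is_derive1_sqrt Q0))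
    (derive1_cstl ((a + b + 2 * z) / 2)
      (derive1_chain (is_derive_u x) (is_derive1_asin u1))))
  (derive1_cstl (- S) (derive1_chain (is_derive_v (ltW ax)) (is_derive1_asin v1))).
move/is_derive_eq; apply; rewrite su sv -/q /c -S2.
have e : q ^+ 2 = (b - x) * (x - a) by rewrite q2.
have f : S ^+ 2 = (a + z) * (b + z) by [].
have qn := lt0r_neq0 q0; have Sn := lt0r_neq0 S0; have xn := lt0r_neq0 xz.
rewrite -/(Q x) -/q.
(* Multiplying by q (x + z) leaves the polynomial identity (a + b + z - x)(x + z) - (a + z)(b + z) =
   (b - x)(x - a). *)
apply: (mulIf (mulf_neq0 qn xn)).
transitivity (q ^+ 2); last by field.
transitivity ((a + b + z - x) * (x + z) - S ^+ 2).
  by field; rewrite qn Sn xn ba_neq0.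
by rewrite e f; ring.
Qed.

Let continuous_u x : {for x, continuous u}.
Proof.
have [du _] := is_derive_u x.
exact/differentiable_continuous/derivable1_diffP.
Qed.

Let continuous_v x : a <= x -> {for x, continuous v}.
Proof.
move=> ax; have [dv _] := is_derive_v ax.
exact/differentiable_continuous/derivable1_diffP.
Qed.

Let continuous_Q x : {for x, continuous (fun y => Num.sqrt (Q y))}.
Proof.
have [dQ _] := is_derive_Q x.
apply: (@continuous_comp _ _ _ Q (@Num.sqrt R)).
  exact/differentiable_continuous/derivable1_diffP.
exact: sqrt_continuous.
Qed.

Let ub : u b = 1. Proof. by rewrite /u; field. Qed.
Let ua : u a = -1. Proof. by rewrite /u; field. Qed.
Let vb : v b = 1.
Proof. by rewrite /v /c; field; rewrite ba_neq0 lt0r_neq0. Qed.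
Let va : v a = -1.
Proof. by rewrite /v /c; field; rewrite ba_neq0 lt0r_neq0. Qed.

Let asin_1 : asin (1 : R) = pi / 2.
Proof.
rewrite -[in LHS](sin_pihalf R) sinK// in_itv /= lexx andbT.
by rewrite (@le_trans _ _ 0) ?oppr_le0 ?divr_ge0 ?pi_ge0.
Qed.

Let asin_N1 : asin (- 1 : R) = - (pi / 2).
Proof.
rewrite -[in LHS](sin_pihalf R) -sinN sinK// in_itv /= lexx /=.
by rewrite (@le_trans _ _ 0) ?oppr_le0 ?divr_ge0 ?pi_ge0.
Qed.

(** The square root vanishes at both end points and each arcsine rises from - pi/2 to pi/2.
    Differentiability is only known inside, hence the one-sided limits. *)
Lemma integral_mp_primitive :
  (\int[lebesgue_measure]_(x in `[a, b])
     (Num.sqrt ((b - x) * (x - a)) / (x + z))%:E =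
   (pi * ((a + b + 2 * z) / 2 - Num.sqrt ((a + z) * (b + z))))%:E)%E.
Proof.
have FE x : mp_primitive x = Num.sqrt (Q x) + (a + b + 2 * z) / 2 * asin (u x) +
   (- Num.sqrt ((a + z) * (b + z))) * asin (v x) by [].
rewrite (@continuous_FTC2 _ _ mp_primitive)//.
- rewrite !FE ub ua vb va asin_1 asin_N1 -EFinB; congr EFin.
  by rewrite /Q !subrr mul0r mulr0 sqrtr0; field.
- apply: continuous_in_subspaceT => x /set_mem /=; rewrite in_itv /= => /andP[ax xb].
  apply: cvgM; first exact: continuous_Q.
  apply: cvgV; first by rewrite lt0r_neq0 ?xz0.
  by apply: cvgD; [exact: cvg_id|exact: cvg_cst].
- split.
  + by move=> x; rewrite in_itv /= => /is_derive_mp_primitive[].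
  + rewrite FE ua va asin_N1; apply: cvgD; first apply: cvgD.
    + exact/cvg_at_right_filter/continuous_Q.
    + apply: cvgM; first exact: cvg_cst.
      apply: cvg_asinN1; first by rewrite -ua; exact/cvg_at_right_filter/continuous_u.
      near=> x; apply: uI; apply/andP; split; near: x.
        exact: nbhs_right_ge.
      exact: nbhs_right_le.
    + apply: cvgM; first exact: cvg_cst.
      apply: cvg_asinN1; first by rewrite -va; exact/cvg_at_right_filter/(continuous_v (lexx a)).
      near=> x; apply: vI; apply/andP; split; near: x.
        exact: nbhs_right_ge.
      exact: nbhs_right_le.
  + rewrite FE ub vb asin_1; apply: cvgD; first apply: cvgD.
    + exact/cvg_at_left_filter/continuous_Q.
    + apply: cvgM; first exact: cvg_cst.
      apply: cvg_asin1; first by have := cvg_at_left_filter (@continuous_u b); rewrite ub.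
      near=> x; apply: uI; apply/andP; split; near: x.
        exact: nbhs_left_ge.
      exact: nbhs_left_le.
    + apply: cvgM; first exact: cvg_cst.
      apply: cvg_asin1; first by have := cvg_at_left_filter (continuous_v (ltW ab)); rewrite vb.
      near=> x; apply: vI; apply/andP; split; near: x.
        exact: nbhs_left_ge.
      exact: nbhs_left_le.
- by move=> x; rewrite in_itv /= => /is_derive_mp_primitive h; rewrite derive1E derive_val.
Unshelve. all: by end_near. Qed.

End primitive.

End mp_integral.

(** * Mass, support and Stieltjes transform of the limit law *)

Section mp_moments.
Context (R : realType) (kappa : R).
Hypothesis k0 : 0 < kappa.
Local Notation mu := (@lebesgue_measure R).
Local Notation a := (mp_lower kappa).
Local Notation b := (mp_upper kappa).

Let q (x : R) : R := Num.sqrt ((b - x) * (x - a)).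

Let s0 : 0 < Num.sqrt kappa. Proof. by rewrite sqrtr_gt0. Qed.
Let s2 : Num.sqrt kappa ^+ 2 = kappa. Proof. by rewrite sqr_sqrtr ?ltW. Qed.

Lemma mp_lower_ge0 : 0 <= a. Proof. exact: sqr_ge0. Qed.

Lemma mp_lower_lt_upper : a < b.
Proof. by rewrite -subr_gt0 /mp_upper /mp_lower; move: s0 => h; nra. Qed.

Let abD : a + b = 2 * (1 + kappa).
Proof. by rewrite /mp_upper /mp_lower -[in RHS]s2; ring. Qed.

Let abM : a * b = (1 - kappa) ^+ 2.
Proof. by rewrite /mp_upper /mp_lower -[in RHS]s2; ring. Qed.

(** Square root of the discriminant of kappa z t^2 + (1 - kappa + z) t - 1, whose roots solve 1 - z
    t = t / (1 + kappa t); the radicand is also (a + z)(b + z). *)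
Definition mp_disc (z : R) : R := Num.sqrt ((1 - kappa) ^+ 2 + 2 * (1 + kappa) * z + z ^+ 2).

Let mq (z : R) : measurable_fun setT (fun x => q x / (x + z)).
Proof.
apply: measurable_funM.
  apply: (@measurableT_comp _ _ _ _ _ _ (@Num.sqrt R)).
    by apply: continuous_measurable_fun; exact: sqrt_continuous.
  by apply: measurable_funM; apply: measurable_funB.
apply: (@measurableT_comp _ _ _ _ _ _ (@GRing.inv R)); first exact: measurable_inv.
exact: measurable_funD.
Qed.

Lemma integral_mp_shift z : 0 < z ->
  (\int[mu]_(x in `[a, b]) (q x / (x + z))%:E =
   (pi * (1 + kappa + z - mp_disc z))%:E)%E.
Proof.
move=> z0; have az : 0 < a + z by rewrite ltr_wpDl ?mp_lower_ge0.
rewrite (integral_mp_primitive mp_lower_lt_upper az); congr EFin; congr (_ * _).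
rewrite abD; congr (_ - _); first by field.
congr Num.sqrt; rewrite -abM -abD; ring.
Qed.

(** The primitive needs a + z > 0, which fails at z = 0 when kappa = 1; the value is reached by
    monotone convergence along z = 1/(n + 1). *)
Lemma integral_mp_noshift :
  (\int[mu]_(x in `[a, b]) (q x / x)%:E =
   (pi * (1 + kappa - `|1 - kappa|))%:E)%E.
Proof.
pose g (n : nat) (x : R) : \bar R := (q x / (x + n.+1%:R^-1))%:E.
have q0 x : 0 <= q x by exact: sqrtr_ge0.
have xI x : `[a, b]%classic x -> 0 <= x.
  by rewrite /= in_itv /= => /andP[ax _]; apply: le_trans mp_lower_ge0 ax.
have gle n x : `[a, b]%classic x -> 0 <= x + n.+1%:R^-1.
  by move=> /xI x0; rewrite addr_ge0 ?invr_ge0.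
have gdec (x : R) (m n : nat) : 0 <= x -> (m <= n)%N -> x + n.+1%:R^-1 <= x + m.+1%:R^-1.
  by move=> x0 mn; rewrite lerD2l lef_pV2 ?posrE ?ltr0n// ler_nat.
have glim x : `[a, b]%classic x -> g n x @[n --> \oo] --> (q x / x)%:E.
  move=> xab; have x0 := xI _ xab; apply: cvg_EFin; first exact: nearW.
  rewrite [X in X @ _ --> _](_ : _ = fun n => q x / (x + n.+1%:R^-1))//.
  (* The point 0 lies in the interval only if a = 0; then q vanishes there and so does every
     term. *)
  move: x0; rewrite le_eqVlt => /predU1P[x0|x0].
    have a0 : a = 0.
      apply/eqP; rewrite eq_le mp_lower_ge0 andbT x0.
      by move: xab; rewrite /= in_itv /= => /andP[].
    by rewrite -x0 /q a0 subrr mulr0 sqrtr0 mul0r; under eq_fun do rewrite mul0r; exact: cvg_cst.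
  apply: cvgM; first exact: cvg_cst.
  apply: cvgV; first exact: lt0r_neq0.
  rewrite -[X in _ --> X]addr0; apply: cvgD; first exact: cvg_cst.
  exact: cvg_harmonic.
have gcvg := @cvg_monotone_convergence _ _ _ mu `[a, b]%classic (measurable_itv _) g.
have {}gcvg : (\int[mu]_(x in `[a, b]) g n x)%E @[n --> \oo] -->
    (\int[mu]_(x in `[a, b]) (q x / x)%:E)%E.
  rewrite [X in _ --> X](_ : _ = \int[mu]_(x in `[a, b]) limn (g ^~ x))%E; last first.
    by apply: eq_integral => x /set_mem xab; apply/esym/cvg_lim => //; exact: glim.
  apply: gcvg.
  - by move=> n; apply: measurable_funTS; apply/measurable_EFinP; exact: mq.
  - by move=> n x xab; rewrite lee_fin divr_ge0 ?gle.
  - move=> x xab m n mn; rewrite lee_fin ler_wpM2l// lef_pV2 ?posrE.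
    + exact: gdec (xI _ xab) mn.
    + by rewrite ltr_wpDl ?invr_gt0// (xI _ xab).
    + by rewrite ltr_wpDl ?invr_gt0// (xI _ xab).
have gE n : (\int[mu]_(x in `[a, b]) g n x = (pi * (1 + kappa + n.+1%:R^-1 - mp_disc n.+1%:R^-1))%:E)%E.
  by rewrite integral_mp_shift ?invr_gt0.
suff : (\int[mu]_(x in `[a, b]) g n x)%E @[n --> \oo] -->
  (pi * (1 + kappa - `|1 - kappa|))%:E by exact: cvg_unique.
rewrite (funext gE); apply: cvg_EFin; first exact: nearW.
have h0 : (fun n => n.+1%:R^-1 : R) @ \oo --> (0 : R) by exact: cvg_harmonic.
apply: cvgM; first exact: cvg_cst.
rewrite -[X in _ --> X - _](addr0 (1 + kappa)).
apply: cvgB; first by apply: cvgD; [exact: cvg_cst|].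
rewrite -sqrtr_sqr /mp_disc.
suff sq : (fun n : nat => (1 - kappa) ^+ 2 + 2 * (1 + kappa) * n.+1%:R^-1 + n.+1%:R^-1 ^+ 2) @ \oo
    --> (1 - kappa) ^+ 2 by exact: (cvg_comp _ _ sq (@sqrt_continuous R _)).
rewrite -[X in _ --> X]addr0 -[X in _ --> X + _]addr0.
apply: cvgD; first apply: cvgD; first exact: cvg_cst.
  by rewrite -[X in _ --> X](mulr0 (2 * (1 + kappa))); apply: cvgM; [exact: cvg_cst|].
by rewrite -[X in _ --> X](mulr0 0); under eq_fun do rewrite expr2; apply: cvgM.
Qed.

Let C : R := (2 * pi * kappa)^-1.

Let C0 : 0 < C. Proof. by rewrite invr_gt0 !mulr_gt0 ?pi_gt0. Qed.

Let q_ge0 x : 0 <= q x. Proof. exact: sqrtr_ge0. Qed.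

Lemma ge0_integral_mp_ac (F : R -> \bar R) : measurable_fun setT F ->
  (forall x, 0 <= F x)%E ->
  (\int[mp_ac kappa]_x F x =
   \int[mu]_(x in `[a, b]) (F x * ((2 * pi * kappa)^-1 * (q x / x))%:E))%E.
Proof.
move=> mF F0.
(* Lebesgue measure carried to the canonical measurable type on [R], where [mp_ac] lives. *)
pose mu' : {measure set R -> \bar R} :=
  measure_function_pushforward__canonical__measure_function_Measure
    mu (@measurable_of_measurableTypeR R).
have mu'E (G : R -> \bar R) A : measurable A -> measurable_fun A G -> (forall x, A x -> 0 <= G x)%E ->
    (\int[mu']_(x in A) G x = \int[mu]_(x in A) G x)%E.
  move=> mA mG G0; rewrite ge0_integral_pushforward// => y /set_mem; exact: G0.
rewrite (@ge0_integral_density _ _ _ mu' (mp_ac kappa) (mp_pdf kappa)) ?mu'E//.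
- rewrite [RHS]integral_mkcond; apply: eq_integral => x _.
  rewrite patchE /mp_pdf mem_setE in_itv /=; case: ifPn => _; last by rewrite mule0.
  congr (_ * _)%E; congr EFin; rewrite /q.
  by rewrite invfM; ring.
- by apply: emeasurable_funM => //; apply/measurable_EFinP; exact: measurable_mp_pdf.
- by move=> x _; rewrite mule_ge0 ?lee_fin ?mp_pdf_ge0.
- exact: measurable_mp_pdf.
- exact: mp_pdf_ge0.
- move=> A mA; rewrite mu'E//.
  + by apply: measurable_funTS; apply/measurable_EFinP; exact: measurable_mp_pdf.
  + by move=> x _; rewrite lee_fin mp_pdf_ge0.
Qed.

(** This mass is min (1, 1/kappa); the atom supplies the rest. *)
Lemma integral_mp_ac1 : (\int[mp_ac kappa]_x 1 =
  ((1 + kappa - `|1 - kappa|) / (2 * kappa))%:E)%E.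
Proof.
rewrite ge0_integral_mp_ac//.
under eq_integral do rewrite mul1e EFinM.
rewrite ge0_integralZl//; last 3 first.
- apply: measurable_funTS; apply/measurable_EFinP; under eq_fun do rewrite -[X in _ / X]addr0.
  exact: mq.
- move=> x; rewrite /= in_itv /= => /andP[ax _].
  by rewrite lee_fin divr_ge0// (le_trans mp_lower_ge0).
- by rewrite lee_fin ltW.
rewrite integral_mp_noshift -EFinM; congr EFin.
have := pi_gt0 R; move: (pi : R) => p p0.
by field; rewrite !lt0r_neq0.
Qed.

Lemma ge0_integral_mp_law (F : R -> \bar R) : measurable_fun setT F ->
  (forall x, 0 <= F x)%E ->
  (\int[mp_law kappa]_x F x =
   (mp_atom kappa)%:E * F 0%R + \int[mp_ac kappa]_x F x)%E.
Proof.
move=> mF F0; rewrite /mp_law ge0_integral_measure_add//; congr (_ + _)%E.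
by rewrite ge0_integral_mscale//= integral_dirac// diracT mul1e.
Qed.

Lemma mp_law_setT : mp_law kappa setT = 1%E.
Proof.
rewrite -[LHS]mul1e -(integral_cst (mp_law kappa))// ge0_integral_mp_law// mule1.
rewrite integral_mp_ac1 -EFinD; congr EFin.
rewrite /mp_atom; case: ifPn => [k1|]; last rewrite -leNgt => k1.
  by rewrite ler0_norm ?subr_le0 ?ltW//; field; rewrite lt0r_neq0.
by rewrite ger0_norm ?subr_ge0//; field; rewrite lt0r_neq0.
Qed.

Lemma mp_law_support (F : R -> \bar R) : measurable_fun setT F ->
  (forall x, 0 <= F x)%E -> (forall x, 0 <= x <= b -> F x = 0%E) ->
  (\int[mp_law kappa]_x F x = 0)%E.
Proof.
move=> mF F0 Fs; have b0 : 0 <= b by exact: sqr_ge0.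
rewrite ge0_integral_mp_law// ge0_integral_mp_ac// Fs ?lexx// mule0 add0e.
apply: integral0_eq => x; rewrite /= in_itv /= => /andP[ax xb].
by rewrite Fs ?mul0e// xb (le_trans mp_lower_ge0).
Qed.

Definition mp_stieltjes (z : R) : R := (kappa - 1 - z + mp_disc z) / (2 * kappa * z).

Let disc2 z : 0 < z -> mp_disc z ^+ 2 = (1 - kappa) ^+ 2 + 2 * (1 + kappa) * z + z ^+ 2.
Proof.
move=> z0; rewrite /mp_disc sqr_sqrtr// addr_ge0 ?sqr_ge0//.
by rewrite addr_ge0 ?sqr_ge0// mulr_ge0 ?mulr_ge0 ?(ltW z0)// addr_ge0 ?ltW.
Qed.

Lemma mp_stieltjes_ge0 z : 0 < z -> 0 <= mp_stieltjes z.
Proof.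
move=> z0; rewrite divr_ge0//; last by rewrite mulr_ge0 ?mulr_ge0 ?ltW.
have D0 : 0 <= mp_disc z by exact: sqrtr_ge0.
have D2 := disc2 z0.
have kz : 0 < kappa * z by rewrite mulr_gt0.
have [h|h] := leP (z + 1 - kappa) 0; first by lra.
suff : z + 1 - kappa <= mp_disc z by lra.
rewrite -ler_sqr ?nnegrE ?(ltW h)// D2; nra.
Qed.

Lemma mp_stieltjes_eq z : 0 < z ->
  1 - z * mp_stieltjes z = mp_stieltjes z / (1 + kappa * mp_stieltjes z).
Proof.
move=> z0; have t0 := mp_stieltjes_ge0 z0.
have d0 : 1 + kappa * mp_stieltjes z != 0.
  by rewrite lt0r_neq0// ltr_wpDr// mulr_ge0// ltW.
apply: (mulIf d0); rewrite divfK// /mp_stieltjes.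
apply/eqP; rewrite -subr_eq0; apply/eqP.
transitivity (((1 - kappa) ^+ 2 + 2 * (1 + kappa) * z + z ^+ 2 - mp_disc z ^+ 2) / (4 * kappa * z)).
  by field; rewrite !lt0r_neq0.
by rewrite disc2// subrr mul0r.
Qed.

(** The maximum with 0 changes nothing on the support and makes the integrand bounded and continuous
    on the line. Partial fractions, z / (x (x + z)) + 1 / (x + z) = 1 / x, reduce the integral to
    the two computed above. *)
Lemma integral_mp_stieltjes z : 0 < z ->
  (\int[mp_law kappa]_x ((Num.max x 0 + z)^-1)%:E = (mp_stieltjes z)%:E)%E.
Proof.
move=> z0; pose g (x : R) : R := (Num.max x 0 + z)^-1.
have g0 x : 0 <= g x.
  by rewrite invr_ge0 addr_ge0 ?(ltW z0)// le_max lexx orbT.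
have mg : measurable_fun setT g.
  apply: (@measurableT_comp _ _ _ _ _ _ (@GRing.inv R)); first exact: measurable_inv.
  by apply: measurable_funD => //; exact: measurable_maxr.
have mgE : measurable_fun setT (EFin \o g) by exact/measurable_EFinP.
have ab0 x : `[a, b]%classic x -> 0 <= x.
  by rewrite /= in_itv /= => /andP[ax _]; rewrite (le_trans mp_lower_ge0).
rewrite ge0_integral_mp_law// ge0_integral_mp_ac//.
set A := (\int[mu]_(x in _) _)%E.
have AE : (z%:E * A + (C * (pi * (1 + kappa + z - mp_disc z)))%:E =
    (C * (pi * (1 + kappa - `|1 - kappa|)))%:E)%E.
  rewrite !(EFinM C) -integral_mp_noshift -integral_mp_shift//.
  have mq0 : measurable_fun setT (fun x => (q x / x)%:E).
    by apply/measurable_EFinP; under eq_fun do rewrite -[X in _ / X]addr0; exact: mq.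
  have mqz : measurable_fun setT (fun x => (q x / (x + z))%:E).
    by apply/measurable_EFinP; exact: mq.
  have F1 x : `[a, b]%classic x -> (0 <= (q x / x)%:E)%E.
    by move=> /ab0 x0; rewrite lee_fin divr_ge0.
  have F2 x : `[a, b]%classic x -> (0 <= (q x / (x + z))%:E)%E.
    by move=> /ab0 x0; rewrite lee_fin divr_ge0// addr_ge0// ltW.
  have mG : measurable_fun setT
      (fun x => ((g x)%:E * ((2 * pi * kappa)^-1 * (q x / x))%:E)%E).
    by apply: emeasurable_funM => //; under eq_fun do rewrite EFinM; apply: emeasurable_funM.
  have G0 x : `[a, b]%classic x ->
      (0 <= (g x)%:E * ((2 * pi * kappa)^-1 * (q x / x))%:E)%E.
    by move=> /ab0 x0; rewrite -EFinM lee_fin mulr_ge0// mulr_ge0 ?(ltW C0)// divr_ge0.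
  have mS (c : \bar R) (G : R -> \bar R) : measurable_fun setT G ->
      measurable_fun `[a, b] (fun x => (c * G x)%E).
    by move=> mG'; apply: measurable_funTS; exact: emeasurable_funM.
  rewrite -!ge0_integralZl//; try by [exact: measurable_funTS | rewrite lee_fin ltW].
  rewrite -ge0_integralD//.
  - apply: eq_integral => x /set_mem xab; rewrite -!EFinM -EFinD; congr EFin.
    have x0 := ab0 _ xab; rewrite /Num.max ltNge x0 /=.
    move: x0; rewrite le_eqVlt => /predU1P[x0|x0].
      have a0 : a = 0.
        apply/eqP; rewrite eq_le mp_lower_ge0 andbT x0.
        by move: xab; rewrite /= in_itv /= => /andP[].
      by rewrite -x0 /q a0 subrr mulr0 sqrtr0 !(mul0r, mulr0) addr0.
    by rewrite -/C; field; rewrite !lt0r_neq0// addr_gt0.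
  - by move=> x xab; rewrite mule_ge0 ?G0// lee_fin ltW.
  - exact: (mS _ _ mG).
  - by move=> x xab; rewrite mule_ge0 ?F2// lee_fin ltW.
  - exact: (mS _ _ mqz).
have A0 : (0 <= A)%E.
  apply: integral_ge0 => x /ab0 x0.
  by rewrite -EFinM lee_fin (mulr_ge0 (g0 x))// mulr_ge0 ?(ltW C0)// divr_ge0.
(* z A plus a finite number is finite, so A is finite and the equation can be solved among the
   reals. *)
have Afin : A \is a fin_num.
  move: AE A0; case: A => [r| |]//=.
  by rewrite gt0_muley ?lte_fin.
move: AE; rewrite -(fineK Afin) -!EFinM -!EFinD => -[] AE.
have {}AE : fine A = C * pi * (mp_disc z - z - `|1 - kappa|) / z.
  by apply: (mulfI (lt0r_neq0 z0)); rewrite [RHS]mulrC divfK ?lt0r_neq0//; lra.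
rewrite AE maxxx add0r; congr EFin; rewrite /C /mp_stieltjes /mp_atom.
have := pi_gt0 R; move: (pi : R) => p p0.
case: ifPn => [k1|]; last rewrite -leNgt => k1.
  by rewrite ler0_norm ?subr_le0 ?ltW//; field; rewrite !lt0r_neq0.
by rewrite ger0_norm ?subr_ge0//; field; rewrite !lt0r_neq0.
Qed.

End mp_moments.

(** * From resolvents to continuous test functions *)

Section bernstein.
Context (R : realType).

(* The expectation of [f] at a binomial random variable with [n] trials, as a
   polynomial in the success probability: the recursion conditions on the first trial. *)
Fixpoint bernstein (n : nat) (f : nat -> R) : {poly R} :=
  if n is k.+1 then 'X * bernstein k (f \o succn) + (1 - 'X) * bernstein k f
  else (f 0)%:P.

Lemma bernsteinS n f w : (bernstein n.+1 f).[w] =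
  w * (bernstein n (f \o succn)).[w] + (1 - w) * (bernstein n f).[w].
Proof. by rewrite /= !hornerE. Qed.

Lemma bernstein_linear n (f g : nat -> R) a b w :
  (bernstein n (fun j => a * f j + b * g j)).[w] =
  a * (bernstein n f).[w] + b * (bernstein n g).[w].
Proof.
elim: n f g => [|n IH] f g; first by rewrite /= !hornerE.
by rewrite !bernsteinS !IH; ring.
Qed.

Lemma bernstein_cst n c w : (bernstein n (fun=> c)).[w] = c.
Proof.
elim: n => [|n IH]; first by rewrite /= hornerE.
by rewrite bernsteinS IH; ring.
Qed.

Lemma bernstein_le n (f g : nat -> R) w : 0 <= w <= 1 ->
  (forall j, (j <= n)%N -> f j <= g j) -> (bernstein n f).[w] <= (bernstein n g).[w].
Proof.
move=> /andP[w0 w1]; elim: n f g => [|n IH] f g fg; first by rewrite /= !hornerE fg.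
rewrite !bernsteinS lerD// ler_wpM2l ?subr_ge0//; apply: IH => j jn.
  exact: fg.
by apply: fg; rewrite (leq_trans jn).
Qed.

(** Variance plus squared bias of a binomial variable. The center is arbitrary because conditioning
    on the first trial shifts it by one. *)
Lemma bernstein_variance n c w :
  (bernstein n (fun j => (j%:R - c) ^+ 2)).[w] = n%:R * w * (1 - w) + (n%:R * w - c) ^+ 2.
Proof.
elim: n c => [|n IH] c; first by rewrite /= hornerE; ring.
rewrite bernsteinS IH.
have -> : (fun j => (j%:R - c) ^+ 2) \o succn = fun j => (j%:R - (c - 1)) ^+ 2.
  by apply/funext => j /=; rewrite -natr1; ring.
by rewrite IH -natr1; ring.
Qed.

Lemma bounded_on_segment (F : R -> R) : continuous F ->
  exists C : R, forall v : R, 0 <= v <= 1 -> `|F v| <= C.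
Proof.
move=> cF; have /compact_near_coveringP cpt := @segment_compact R 0 1.
suff : \forall C \near +oo, `[(0 : R), 1] `<=` [set v | `|F v| <= C].
  by move=> [C [_ /(_ (C + 1))]]; rewrite ltrDl => /(_ ltr01) h; exists (C + 1).
apply: cpt => x _; near=> v C => /=.
apply: (@le_trans _ _ (`|F x| + 1)); last by near: C; exact: nbhs_pinfty_ge.
have : `|F x - F v| < 1.
  by near: v; move/cvgrPdist_lt : (cF x); apply.
by move=> h; rewrite -[F v](subKr (F x)) (le_trans (ler_normB _ _))// lerD2l ltW.
Unshelve. all: by end_near. Qed.

(** A quadratic modulus is preferred to uniform continuity because (v - w)^2 averages to a variance
    under the binomial weights. Near the diagonal e suffices; away from it |F| <= C and a large K
    wins. *)
Lemma unif_modulus (F : R -> R) (e : R) : continuous F -> 0 < e ->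
  exists2 K : R, 0 <= K & forall v w : R, 0 <= v <= 1 -> 0 <= w <= 1 ->
    `|F v - F w| <= e + K * (v - w) ^+ 2.
Proof.
move=> cF e0; have [C FC] := bounded_on_segment cF.
have /compact_near_coveringP cpt := @segment_compact R 0 1.
suff : \forall K \near +oo, `[(0 : R), 1] `<=` [set v | 0 <= v <= 1 -> forall w, 0 <= w <= 1 ->
    `|F v - F w| <= e + K * (v - w) ^+ 2].
  move=> [K0 [_ hK]]; pose K : R := Num.max K0 0 + 1; exists K.
    by rewrite addr_ge0// le_max lexx orbT.
  move=> v w v01 w01; apply: (hK K); rewrite //= /K.
  by rewrite ltr_pwDr// le_max lexx.
apply: cpt => x _.
have e20 : 0 < e / 2 by rewrite divr_gt0.
have /cvgrPdist_lt/(_ _ e20)/nbhs_ballP[d /= d0 xd] := cF x.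
have dist (y : R) : `|x - y| < d -> `|F x - F y| < e / 2 by move=> h; exact: xd.
near=> v K => /=.
move=> v01 w w01; have xv : `|x - v| < d / 2.
  by near: v; apply: cvgr_dist_lt; [exact: cvg_id | rewrite divr_gt0].
have K0 : 0 <= K by near: K; exact: nbhs_pinfty_ge.
have [vw|vw] := ltP `|v - w| (d / 2).
  have h1 : `|F x - F v| < e / 2 by apply: dist; lra.
  have h2 : `|F x - F w| < e / 2.
    apply: dist; rewrite -(subrKA v) (le_lt_trans (ler_normD _ _))//; lra.
  rewrite -(subrKA (F x)) (le_trans (ler_normD _ _))// distrC.
  by have := mulr_ge0 K0 (sqr_ge0 (v - w)); lra.
have Kd : 2 * C <= K * (d / 2) ^+ 2.
  rewrite -ler_pdivrMr ?exprn_gt0 ?divr_gt0//.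
have Kd' : K * (d / 2) ^+ 2 <= K * (v - w) ^+ 2.
  rewrite ler_wpM2l// -[leRHS]real_normK ?num_real//.
  by rewrite ler_sqr ?nnegrE// divr_ge0 ?ltW.
rewrite (le_trans (ler_normB _ _))//.
by have := FC _ v01; have := FC _ w01; lra.
Unshelve. all: by end_near. Qed.

Lemma weierstrass_approx (F : R -> R) (e : R) : continuous F -> 0 < e ->
  exists p : {poly R}, forall w : R, 0 <= w <= 1 -> `|F w - p.[w]| <= e.
Proof.
move=> cF e0; have e20 : 0 < e / 2 by rewrite divr_gt0.
have [K K0 FK] := unif_modulus cF e20.
pose n := (Num.bound (K / (e / 2))).+1.
exists (bernstein n (fun j => F (j%:R / n%:R))) => w w01.
have n0 : 0 < n%:R :> R by rewrite ltr0n.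
have nK : K / n%:R <= e / 2.
  rewrite ler_pdivrMr// mulrC -ler_pdivrMr//.
  have /ltW := archi_boundP (divr_ge0 K0 (ltW e20)) => /le_trans; apply.
  by rewrite ler_nat leqnSn.
(* One sign at a time, since [bernstein_le] is one-sided; the error is at most e/2 plus w (1 - w) K
   / n. *)
have bound (s : R) : `|s| = 1 -> s * ((bernstein n (fun j => F (j%:R / n%:R))).[w] - F w) <= e.
  move=> s1; have -> : s * ((bernstein n (fun j => F (j%:R / n%:R))).[w] - F w) =
      (bernstein n (fun j => s * F (j%:R / n%:R) + (- s) * F w)).[w].
    rewrite (bernstein_linear n (fun j => F (j%:R / n%:R)) (fun=> F w)) bernstein_cst; ring.
  apply: (@le_trans _ _ (bernstein n (fun j =>
      K / n%:R ^+ 2 * (j%:R - n%:R * w) ^+ 2 + 1 * (e / 2))).[w]).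
    apply: bernstein_le => // j jn.
    have jn01 : 0 <= (j%:R / n%:R : R) <= 1.
      by rewrite divr_ge0//= ler_pdivrMr// mul1r ler_nat.
    rewrite mulNr -mulrBr (le_trans (ler_norm _))// normrM s1 !mul1r.
    apply: (le_trans (FK _ _ jn01 w01)); rewrite addrC lerD2r le_eqVlt; apply/orP; left.
    by apply/eqP; field; rewrite lt0r_neq0.
  rewrite (bernstein_linear n (fun j => (j%:R - n%:R * w) ^+ 2) (fun=> e / 2)).
  rewrite bernstein_cst bernstein_variance subrr expr0n addr0 mul1r.
  have -> : K / n%:R ^+ 2 * (n%:R * w * (1 - w)) = (w * (1 - w)) * (K / n%:R).
    by field; rewrite lt0r_neq0.
  have ww : w * (1 - w) <= 1 by have /andP[? ?] := w01; nra.
  have := ler_wpM2r (divr_ge0 K0 (ltW n0)) ww; lra.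
rewrite distrC ler_norml; apply/andP; split.
  by have := bound (-1); rewrite normrN1 => /(_ erefl); lra.
by have := bound 1; rewrite normr1 mul1r => /(_ erefl).
Qed.

End bernstein.

Section bounded_measurable.
Context (R : realType) (L : {measure set R -> \bar R}) (b : R).
Hypothesis L1 : L setT = 1%E.
Hypothesis Lb : forall F : R -> \bar R, measurable_fun setT F ->
  (forall x, 0 <= F x)%E -> (forall x, 0 <= x <= b -> F x = 0%E) ->
  (\int[L]_x F x = 0)%E.

Definition bounded_measurable (f : R -> R) : Prop :=
  measurable_fun setT f /\ exists C : R, forall x, `|f x| <= C.

Lemma bounded_measurable_cst c : bounded_measurable (fun=> c).
Proof. by split => //; exists `|c|. Qed.

Lemma bounded_measurableZD f g a c : bounded_measurable f -> bounded_measurable g ->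
  bounded_measurable (fun x => a * f x + c * g x).
Proof.
move=> [mf [C fC]] [mg [D gD]]; split.
  by apply: measurable_funD; apply: measurable_funM.
exists (`|a| * C + `|c| * D) => x.
by rewrite (le_trans (ler_normD _ _))// !normrM lerD// ler_wpM2l.
Qed.

Lemma bounded_measurableM f g : bounded_measurable f -> bounded_measurable g ->
  bounded_measurable (fun x => f x * g x).
Proof.
move=> [mf [C fC]] [mg [D gD]]; split; first exact: measurable_funM.
by exists (C * D) => x; rewrite normrM ler_pM.
Qed.

Lemma bounded_measurable_norm f : bounded_measurable f ->
  bounded_measurable (fun x => `|f x|).
Proof.
move=> [mf [C fC]]; split; first exact: measurableT_comp.
by exists C => x; rewrite normr_id.
Qed.

Lemma bounded_measurable_continuous (f : R -> R) C : continuous f ->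
  (forall x, `|f x| <= C) -> bounded_measurable f.
Proof. by move=> cf fC; split; [exact: continuous_measurable_fun|exists C]. Qed.

Lemma bounded_measurable_integrable f : bounded_measurable f ->
  L.-integrable setT (EFin \o f).
Proof.
move=> [mf [C fC]]; apply: measurable_bounded_integrable => //.
  by rewrite L1 ltry.
exists C; split; first exact: num_real.
by move=> M CM x _; rewrite /= (le_trans (fC x))// ltW.
Qed.

Lemma Rintegral_cst1 c : \int[L]_x c = c.
Proof. by rewrite Rintegral_cst// L1 mulr1. Qed.

Lemma RintegralZD f g a c : bounded_measurable f -> bounded_measurable g ->
  \int[L]_x (a * f x + c * g x) = a * \int[L]_x f x + c * \int[L]_x g x.
Proof.
move=> bf bg; have i h : bounded_measurable h -> L.-integrable setT (EFin \o h).
  exact: bounded_measurable_integrable.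
have s h (r : R) : bounded_measurable h -> L.-integrable setT (EFin \o (fun x => r * h x)).
  move=> bh; apply: i; have := bounded_measurableZD r 0 bh bh.
  by congr (bounded_measurable _); apply/funext => x; rewrite mul0r addr0.
by rewrite RintegralD//; [congr (_ + _); rewrite RintegralZl//; exact: i|exact: s|exact: s].
Qed.

(** The excess of |f - g| over e is nonnegative and vanishes on [0, b], so [Lb] makes its integral
    zero; total mass 1 turns e into the bound. *)
Lemma Rintegral_dist f g e : bounded_measurable f -> bounded_measurable g ->
  (forall x, 0 <= x <= b -> `|f x - g x| <= e) ->
  `|\int[L]_x f x - \int[L]_x g x| <= e.
Proof.
move=> bf bg fg.
pose h x := `|f x - g x|; pose r x := Num.max (h x - e) 0.
have bd : bounded_measurable (fun x => f x - g x).
  have := bounded_measurableZD 1 (-1) bf bg.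
  by congr (bounded_measurable _); apply/funext => x; rewrite mul1r mulN1r.
have bh : bounded_measurable h := bounded_measurable_norm bd.
have mr : measurable_fun setT r.
  by apply: measurable_maxr => //; apply: measurable_funB => //; case: bh.
have br : bounded_measurable r.
  split => //; have [_ [C hC]] := bh; exists (C + `|e|) => x.
  rewrite ger0_norm ?le_max ?lexx ?orbT// ge_max addr_ge0//; last first.
    by rewrite (le_trans _ (hC x)).
  rewrite andbT lerD//; first by rewrite (le_trans _ (hC x))// ler_norm.
  by rewrite -normrN ler_norm.
have r0 : \int[L]_x r x = 0.
  rewrite /Rintegral Lb//; first exact/measurable_EFinP.
    by move=> x; rewrite lee_fin /r le_max lexx orbT.
  by move=> x xb; congr EFin; rewrite /r; apply/max_idPr; rewrite subr_le0; exact: fg.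
rewrite -RintegralB//; try exact: bounded_measurable_integrable.
rewrite (le_trans (le_normr_Rintegral _ (bounded_measurable_integrable bd)))//.
have -> : e = \int[L]_x (e * 1 + 1 * r x).
  rewrite (RintegralZD _ _ (bounded_measurable_cst 1) br) Rintegral_cst1 r0.
  by rewrite mulr0 addr0 mulr1.
apply: le_Rintegral => //; first exact: (bounded_measurable_integrable bh).
  by apply: bounded_measurable_integrable; apply: bounded_measurableZD => //; exact: bounded_measurable_cst.
by move=> x _; rewrite mulr1 mul1r -lerBlDl /r le_max lexx.
Qed.

End bounded_measurable.

Section difference_quotient.
Context (R : realFieldType).

(** In the factorization of u^(n+1) - v^(n+1) each of the n + 1 products lies between v^n and
    u^n. *)
Lemma subrX_bounds (u v : R) n : 0 <= v -> v <= u ->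
  n.+1%:R * v ^+ n * (u - v) <= u ^+ n.+1 - v ^+ n.+1 <= n.+1%:R * u ^+ n * (u - v).
Proof.
move=> v0 vu; have u0 := le_trans v0 vu; rewrite subrXX /=.
have cst (c : R) : n.+1%:R * c = \sum_(i < n.+1) c by rewrite sumr_const card_ord mulr_natl.
rewrite [(u - v) * _]mulrC; apply/andP; split; rewrite ler_wpM2r ?subr_ge0// cst.
  apply: ler_sum => i _; have /subnK ni : (i <= n)%N by rewrite -ltnS.
  by rewrite -[in leLHS]ni exprD ler_wpM2r ?exprn_ge0// lerXn2r.
apply: ler_sum => i _; have /subnK ni : (i <= n)%N by rewrite -ltnS.
by rewrite -[in leRHS]ni exprD ler_wpM2l ?exprn_ge0// lerXn2r.
Qed.

(** Meant for u = 1/y and v = 1/(y + h), where u - v = h u v. The quotient lies between v^(n+2) and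
    u^(n+2), whose gap is of order h, uniformly for u <= M. *)
Lemma difference_quotient_bound (u v h M : R) n : 0 < h -> 0 <= v -> v <= u -> u <= M ->
  u - v = h * (u * v) ->
  `|u ^+ n.+2 - (h * n.+1%:R)^-1 * (u ^+ n.+1 - v ^+ n.+1)| <= h * (n.+2%:R * M ^+ n.+3).
Proof.
move=> h0 v0 vu uM uvE; have u0 := le_trans v0 vu; have M0 := le_trans u0 uM.
have n0 : 0 < n.+1%:R :> R by rewrite ltr0n.
have hn0 : 0 < h * n.+1%:R by rewrite mulr_gt0.
have uv : u * v <= u * u by rewrite ler_wpM2l.
have vuv : v * v <= u * v by rewrite ler_wpM2r.
have /andP[lo hi] := subrX_bounds n v0 vu.
set q := _^-1 * _.
have q1 : v ^+ n.+2 <= q.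
  rewrite /q mulrC ler_pdivlMr// (le_trans _ lo)// uvE.
  rewrite (_ : n.+1%:R * _ * _ = u * v * v ^+ n * (h * n.+1%:R)); last by ring.
  by rewrite ler_wpM2r ?(ltW hn0)// !exprS mulrA ler_wpM2r ?exprn_ge0.
have q2 : q <= u ^+ n.+2.
  rewrite /q mulrC ler_pdivrMr// (le_trans hi)// uvE.
  rewrite (_ : n.+1%:R * _ * _ = u * v * u ^+ n * (h * n.+1%:R)); last by ring.
  by rewrite ler_wpM2r ?(ltW hn0)// !exprS mulrA ler_wpM2r ?exprn_ge0.
rewrite ger0_norm ?subr_ge0// (le_trans (lerB (lexx _) q1))//.
have /andP[_ hi'] := subrX_bounds n.+1 v0 vu.
rewrite (le_trans hi')// uvE.
rewrite (_ : n.+2%:R * _ * _ = h * (n.+2%:R * (u ^+ n.+1 * (u * v)))); last by ring.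
rewrite ler_wpM2l ?(ltW h0)// ler_wpM2l ?ler0n//.
apply: (@le_trans _ _ (u ^+ n.+3)).
  by rewrite (exprSr u n.+2) (exprSr u n.+1) -[leRHS]mulrA ler_wpM2l ?exprn_ge0// ler_wpM2l.
by rewrite lerXn2r.
Qed.

End difference_quotient.

(** * Convergence in probability of spectral averages *)

Section weak_convergence.
Context (R : realType) (L : {measure set R -> \bar R}) (b : R).
Hypothesis b0 : 0 <= b.
Hypothesis L1 : L setT = 1%E.
Hypothesis Lb : forall F : R -> \bar R, measurable_fun setT F ->
  (forall x, 0 <= F x)%E -> (forall x, 0 <= x <= b -> F x = 0%E) ->
  (\int[L]_x F x = 0)%E.
Context (d : nat -> measure_display) (X : forall k, measurableType (d k))
  (P : forall k, {measure set (X k) -> \bar R})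
  (m : nat -> nat) (ev : forall k, X k -> nat -> R).
Hypothesis ev0 : forall k (x : X k) i, 0 <= ev x i.
Hypothesis m_gt0 : \forall k \near \oo, (0 < m k)%N.

Definition average k (f : R -> R) (x : X k) : R :=
  (m k)%:R^-1 * \sum_(i < m k) f (ev x i).
Arguments average : clear implicits.

(** Measurability belongs to the notion: the union bound needs it, and as nothing is assumed on the
    points [ev] themselves it must be inherited from the resolvent functions. *)
Definition cvg_average (f : R -> R) : Prop :=
  (forall k, measurable_fun setT (average k f)) /\
  forall e : R, 0 < e ->
    (fun k => P k [set x | e < `|average k f x - \int[L]_y f y|]) @ \oo --> 0%E.

Lemma averageZD k f g a c x :
  average k (fun y => a * f y + c * g y) x = a * average k f x + c * average k g x.
Proof. by rewrite /average big_split /= -!mulr_sumr; ring. Qed.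

Lemma average_norm k f (x : X k) : `|average k f x| <= average k (fun y => `|f y|) x.
Proof.
rewrite /average normrM ger0_norm ?invr_ge0// ler_wpM2l ?invr_ge0//.
exact: ler_norm_sum.
Qed.

Lemma average_le k f g x : (forall y, 0 <= y -> f y <= g y) ->
  average k f x <= average k g x.
Proof. by move=> fg; rewrite ler_wpM2l ?invr_ge0//; apply: ler_sum => i _; exact: fg. Qed.

Lemma average_cst k x (c : R) : 0 <= c -> average k (fun=> c) x <= c.
Proof.
move=> c0; rewrite /average sumr_const card_ord; have [->|k0] := posnP (m k).
  by rewrite mulr0n mulr0.
by rewrite -[c *+ _]mulr_natl mulKf// pnatr_eq0 -lt0n.
Qed.

Lemma average_dist k f g x e : 0 <= e -> (forall y, 0 <= y -> `|f y - g y| <= e) ->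
  `|average k f x - average k g x| <= e.
Proof.
move=> e0 fg; have -> : average k f x - average k g x = average k (fun y => f y - g y) x.
  have := averageZD f g 1 (-1) x; rewrite mul1r mulN1r => <-.
  by congr average; apply/funext => y; rewrite mul1r mulN1r.
rewrite (le_trans (average_norm _ _))// (le_trans _ (average_cst x e0))//.
exact: average_le.
Qed.

Let event k (e : R) f := [set x : X k | e < `|average k f x - \int[L]_y f y|].
Arguments event : clear implicits.

Let measurable_event k e f : measurable_fun setT (average k f) -> measurable (event k e f).
Proof.
move=> mf; pose F x := `|average k f x - \int[L]_y f y|.
have mF : measurable_fun setT F.
  by apply: measurableT_comp => //; exact: measurable_funB.
rewrite (_ : event k e f = F @^-1` `]e, +oo[%classic).
  by rewrite -[X in measurable X]setTI; exact: mF.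
by apply/seteqP; split => x; rewrite /event /= in_itv /= andbT.
Qed.

Let squeeze (A B C : forall k, set (X k)) :
  (forall k, measurable (A k)) -> (forall k, measurable (B k)) -> (forall k, measurable (C k)) ->
  (forall k, A k `<=` B k `|` C k) ->
  (fun k => P k (B k)) @ \oo --> 0%E -> (fun k => P k (C k)) @ \oo --> 0%E ->
  (fun k => P k (A k)) @ \oo --> 0%E.
Proof.
move=> mA mB mC ABC B0 C0.
apply: (@squeeze_cvge _ _ _ _ (fun=> 0%E) _ (fun k => P k (B k) + P k (C k))%E) => //.
- apply: nearW => k; rewrite measure_ge0 /=.
  rewrite (le_trans (le_measure _ _ _ (ABC k))) ?inE//; first exact: measurableU.
  exact: measureU2.
- exact: cvg_cst.
- by rewrite -[X in _ --> X](adde0 0%E); apply: cvgeD.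
Qed.

Lemma cvg_averageZD f g a c :
  bounded_measurable f -> bounded_measurable g ->
  cvg_average f -> cvg_average g -> cvg_average (fun x => a * f x + c * g x).
Proof.
move=> bf bg [mf cf] [mg cg].
have mfg k : measurable_fun setT (average k (fun x => a * f x + c * g x)).
  rewrite (_ : average k _ = fun x => a * average k f x + c * average k g x).
    by apply: measurable_funD; apply: measurable_funM.
  by apply/funext => x; rewrite averageZD.
split => // e e0.
(* The 1 added to |r| avoids division by zero and still keeps |r| times the threshold at most
   e/2. *)
have h (r : R) : 0 < e / 2 / (`|r| + 1) by rewrite !divr_gt0// ltr_wpDl.
apply: (@squeeze _ (fun k => event k (e / 2 / (`|a| + 1)) f)
  (fun k => event k (e / 2 / (`|c| + 1)) g)); try by move=> k; exact: measurable_event.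
- move=> k x; rewrite /event /= averageZD (RintegralZD L1)// => ex.
  have [h1|h1] := ltP (e / 2 / (`|a| + 1)) `|average k f x - \int[L]_y f y|; first by left.
  have [h2|h2] := ltP (e / 2 / (`|c| + 1)) `|average k g x - \int[L]_y g y|; first by right.
  have bnd (r u : R) : `|u| <= e / 2 / (`|r| + 1) -> `|r * u| <= e / 2.
    rewrite normrM ler_pdivlMr ?ltr_wpDl// => hu.
    by rewrite (le_trans _ hu)// mulrC ler_wpM2l// lerDl.
  move: ex; rewrite (_ : _ - _ =
    a * (average k f x - \int[L]_y f y) + c * (average k g x - \int[L]_y g y)); last by ring.
  have := ler_normD (a * (average k f x - \int[L]_y f y)) (c * (average k g x - \int[L]_y g y)).
  by have := bnd a _ h1; have := bnd c _ h2; lra.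
- exact: cf.
- exact: cg.
Qed.

(** The averaged points are nonnegative, so closeness on the half-line bounds the averages and,
    through the support, the integrals. Measurability survives as a pointwise limit. *)
Lemma cvg_average_unif f : bounded_measurable f ->
  (forall e : R, 0 < e -> exists g, [/\ bounded_measurable g, cvg_average g &
     forall x, 0 <= x -> `|f x - g x| <= e]) ->
  cvg_average f.
Proof.
move=> bf fg.
have n0 (n : nat) : 0 < n.+1%:R^-1 :> R by rewrite invr_gt0.
have [G hG] := choice (fun n => fg _ (n0 n)).
have mf k : measurable_fun setT (average k f).
  apply: (@measurable_fun_cvg _ _ _ _ (fun n => average k (G n))).
    by move=> n; have [_ [mg _] _] := hG n; exact: mg.
  move=> x _; apply/cvgrPdist_le => e e0.
  have h0 : (fun n => n.+1%:R^-1 : R) @ \oo --> (0 : R) by exact: cvg_harmonic.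
  near=> n; have ne : n.+1%:R^-1 < e by near: n; exact: (cvgr_lt 0 h0).
  have [_ _ hn] := hG n.
  by rewrite (le_trans _ (ltW ne))//; apply: average_dist => //; exact: ltW.
split => // e e0; have e40 : 0 < e / 4 by rewrite divr_gt0.
have [g [bg [mg cg] hg]] := fg _ e40.
apply: (@squeeze _ (event^~ (e / 2) ^~ g) (fun=> set0)) => //; first last.
- by under eq_fun do rewrite measure0; exact: cvg_cst.
- by apply: cg; rewrite divr_gt0.
- move=> k x; rewrite /event /= => ex; left.
  have h1 : `|average k f x - average k g x| <= e / 4 by apply: average_dist => //; exact: ltW.
  have h2 : `|\int[L]_y f y - \int[L]_y g y| <= e / 4.
    by apply: (Rintegral_dist L1 Lb) => // y /andP[y0 _]; exact: hg.
  have : `|average k f x - \int[L]_y f y| <= `|average k g x - \int[L]_y g y| + e / 2.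
    rewrite (_ : _ - _ = (average k f x - average k g x) +
      (average k g x - \int[L]_y g y) - (\int[L]_y f y - \int[L]_y g y)); last by ring.
    rewrite (le_trans (ler_normB _ _))// (le_trans (lerD (ler_normD _ _) (lexx _)))//.
    lra.
  by move=> h; lra.
- by move=> k; exact: measurable_event.
- by move=> k; exact: measurable_event.
Unshelve. all: by end_near. Qed.

Lemma cvg_average_cst c : cvg_average (fun=> c).
Proof.
split=> [k|e e0]; first exact: measurable_cst.
(* The average of a constant is this constant only for m k > 0, which holds eventually. *)
apply: cvg_near_cst; near=> k.
have mk : (0 < m k)%N by near: k.
rewrite [X in P k X](_ : _ = set0) ?measure0//.
apply/seteqP; split => // x /=; rewrite (Rintegral_cst1 L1).
rewrite /average sumr_const card_ord -[c *+ _]mulr_natl mulKf ?pnatr_eq0 -?lt0n//.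
by rewrite subrr normr0 ltNge (ltW e0).
Unshelve. all: by end_near. Qed.

Let shift (z x : R) : R := (Num.max x 0 + z)^-1.

Let shift_gt0 (z x : R) : 0 < z -> 0 < Num.max x 0 + z.
Proof. by move=> z0; rewrite ltr_wpDl// le_max lexx orbT. Qed.

Let shift_ge0 (z x : R) : 0 < z -> 0 <= shift z x.
Proof. by move=> z0; rewrite invr_ge0 ltW// shift_gt0. Qed.

Let shift_le (z x : R) : 0 < z -> shift z x <= z^-1.
Proof.
by move=> z0; rewrite lef_pV2 ?posrE ?shift_gt0// lerDr le_max lexx orbT.
Qed.

Let continuous_shift z : 0 < z -> continuous (shift z).
Proof.
move=> z0 x; apply: cvgV; first by rewrite lt0r_neq0// shift_gt0.
apply: cvgD; last exact: cvg_cst.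
exact: (@continuous_max _ _ idfun (fun=> 0) x (fun _ h => h) (@cst_continuous _ _ _ _)).
Qed.

Let bm_shift z n : 0 < z -> bounded_measurable (fun x => shift z x ^+ n).
Proof.
move=> z0; elim: n => [|n IH]; first exact: bounded_measurable_cst.
rewrite (_ : (fun _ => _) = fun x => shift z x * shift z x ^+ n); last first.
  by apply/funext => x; rewrite exprS.
apply: bounded_measurableM => //.
apply: (@bounded_measurable_continuous _ _ z^-1); first exact: continuous_shift.
by move=> x; rewrite ger0_norm ?shift_ge0 ?shift_le.
Qed.

Hypothesis resolvent_cvg : forall a : rat, 0 < a ->
  cvg_average (fun x => (Num.max x 0 + ratr a)^-1).

(** The next power is a uniform limit of difference quotients between [a] and [a + h], with [h]
    rational because convergence is assumed at rational points only. *)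
Lemma cvg_average_shiftX n (a : rat) : 0 < a ->
  cvg_average (fun x => shift (ratr a) x ^+ n).
Proof.
case: n => [_|n]; first exact: cvg_average_cst.
elim: n a => [|n IH] a a0; first exact: resolvent_cvg.
have z0 : 0 < ratr a :> R by rewrite ltr0q.
apply: cvg_average_unif; first exact: bm_shift.
(* [C] is the constant of [difference_quotient_bound] for the upper bound 1/a. *)
move=> e e0; pose C := n.+2%:R * (ratr a)^-1 ^+ n.+3 : R.
have C0 : 0 < C by rewrite mulr_gt0 ?ltr0n// exprn_gt0// invr_gt0.
have eC : 0 < e / C by rewrite divr_gt0.
have [h] := rat_in_itvoo eC; rewrite in_itv /= => /andP[h0 he].
have hq : 0 < h by rewrite -(ltr0q R).
have ah : 0 < a + h by rewrite addr_gt0.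
have ahz : 0 < ratr (a + h) :> R by rewrite ltr0q.
pose s : R := (ratr h * n.+1%:R)^-1.
exists (fun x => s * shift (ratr a) x ^+ n.+1 + (- s) * shift (ratr (a + h)) x ^+ n.+1).
split.
- by apply: bounded_measurableZD; exact: bm_shift.
- by apply: cvg_averageZD; [exact: bm_shift|exact: bm_shift|exact: IH|exact: IH].
move=> x x0; rewrite mulNr -mulrBr.
apply: (@le_trans _ _ (ratr h * C)); last by rewrite -ler_pdivlMr// ltW.
apply: difference_quotient_bound => //.
- exact: shift_ge0.
- rewrite lef_pV2 ?posrE ?shift_gt0// lerD2l ler_rat lerDl ltW//.
- exact: shift_le.
- rewrite /shift rmorphD; field.
  by have := shift_gt0 x ahz; rewrite rmorphD => /lt0r_neq0 ->; exact: lt0r_neq0 (shift_gt0 x z0).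
Qed.

Let w : R -> R := shift 1.

Lemma cvg_average_poly (p : {poly R}) : cvg_average (fun x => p.[w x]).
Proof.
have w1 : w = shift (ratr 1) by rewrite rmorph1.
rewrite (_ : (fun _ => _) = fun x => \sum_(i < size p) p`_i * w x ^+ i); last first.
  by apply/funext => x; rewrite horner_coef.
suff : forall n, bounded_measurable (fun x => \sum_(i < n) p`_i * w x ^+ i) /\
    cvg_average (fun x => \sum_(i < n) p`_i * w x ^+ i).
  by move=> /(_ (size p))[].
elim=> [|n [bn cn]].
  under eq_fun do rewrite big_ord0; split; first exact: bounded_measurable_cst.
  exact: cvg_average_cst.
rewrite (_ : (fun _ => _) = fun x => 1 * (\sum_(i < n) p`_i * w x ^+ i) + p`_n * w x ^+ n);
  last by apply/funext => x; rewrite big_ord_recr mul1r.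
split.
  by apply: bounded_measurableZD => //; exact: bm_shift.
apply: cvg_averageZD => //; first exact: bm_shift.
by rewrite w1; exact: cvg_average_shiftX.
Qed.

Let w_itv x : 0 <= w x <= 1.
Proof. by rewrite shift_ge0//= -[leRHS]invr1 shift_le. Qed.

Lemma cvg_average_comp (F : R -> R) : continuous F -> cvg_average (F \o w).
Proof.
move=> cF; apply: cvg_average_unif.
  have [C FC] := bounded_on_segment cF.
  apply: (@bounded_measurable_continuous _ _ C) => [x|x]; last exact: FC.
  by apply: continuous_comp; [exact: continuous_shift|exact: cF].
move=> e e0; have [p hp] := weierstrass_approx cF e0.
exists (fun x => p.[w x]); split; last by move=> x _; exact: hp.
- have [C pC] := bounded_on_segment (@continuous_horner _ p).
  apply: (@bounded_measurable_continuous _ _ C) => [x|x]; last exact: pC.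
  by apply: continuous_comp; [exact: continuous_shift|exact: continuous_horner].
- exact: cvg_average_poly.
Qed.

Let cutoff (M x : R) : R := Num.max 0 (Num.min 1 (M + 1 - x)).

Let cutoff_itv M x : 0 <= cutoff M x <= 1.
Proof. by rewrite /cutoff le_max lexx /= ge_max ler01 ge_min lexx. Qed.

Let cutoff1 M x : x <= M -> cutoff M x = 1.
Proof.
move=> xM; rewrite /cutoff (min_idPl _) ?(max_idPr _)//.
by rewrite -lerBlDl; lra.
Qed.

Let cutoff0 M x : M + 1 <= x -> cutoff M x = 0.
Proof.
by move=> xM; rewrite /cutoff; apply/max_idPl; rewrite ge_min subr_le0 xM orbT.
Qed.

Let continuous_cutoff M : continuous (cutoff M).
Proof.
move=> x; apply: (@continuous_max _ _ (fun=> 0) (fun y => Num.min 1 (M + 1 - y)) x).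
  exact: cst_continuous.
apply: (@continuous_min _ _ (fun=> 1) (fun y => M + 1 - y) x); first exact: cst_continuous.
by apply: cvgB; [exact: cvg_cst|exact: cvg_id].
Qed.

Let bm_cutoff (f : R -> R) (M : R) : continuous f -> (exists C : R, forall x : R, `|f x| <= C) ->
  bounded_measurable (fun x => f x * cutoff M x).
Proof.
move=> cf [C fC]; apply: bounded_measurableM.
  exact: (bounded_measurable_continuous cf fC).
apply: (@bounded_measurable_continuous _ _ 1); first exact: continuous_cutoff.
by move=> x; have /andP[h0 h1] := cutoff_itv M x; rewrite ger0_norm.
Qed.

Lemma cvg_average_cutoff (f : R -> R) (M : R) : continuous f -> (exists C : R, forall x : R, `|f x| <= C) ->
  0 <= M -> cvg_average (fun x => f x * cutoff M x).
Proof.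
(* The map w = 1/(1 + x) is inverted by 1/w - 1. Truncating w at [dl], its value at x = M + 1, makes
   the inverse continuous on the line and alters only points where the cutoff is zero. *)
move=> cf bf M0; pose dl := (M + 2)^-1.
have dl0 : 0 < dl by rewrite invr_gt0 ltr_wpDl.
pose g y : R := (Num.max y dl)^-1 - 1.
have cg : continuous g.
  move=> y; apply: cvgB; last exact: cvg_cst.
  apply: cvgV; first by rewrite lt0r_neq0// lt_max dl0 orbT.
  exact: (@continuous_max _ _ idfun (fun=> dl) y (fun _ h => h) (@cst_continuous _ _ _ _)).
pose F y := f (g y) * cutoff M (g y).
have cF : continuous F.
  move=> y; apply: cvgM; first exact: (continuous_comp (cg y) (cf (g y))).
  exact: (continuous_comp (cg y) (@continuous_cutoff M (g y))).
apply: cvg_average_unif; first exact: bm_cutoff.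
move=> e e0; exists (F \o w); split; last 1 first.
- move=> x x0; suff -> : (F \o w) x = f x * cutoff M x by rewrite subrr normr0 ltW.
  rewrite /F /= /g /w /shift (max_idPl x0).
  have [xM|xM] := leP x (M + 1).
    rewrite (max_idPl _) ?invrK ?addrK// lef_pV2 ?posrE ?ltr_wpDl//; lra.
  rewrite (max_idPr _); last by rewrite lef_pV2 ?posrE ?ltr_wpDl//; lra.
  by rewrite /dl invrK [cutoff M x]cutoff0 ?(ltW xM)// cutoff0 ?mulr0//; lra.
- have [C FC] := bounded_on_segment cF.
  apply: (@bounded_measurable_continuous _ _ C) => [x|x]; last exact: FC.
  by apply: continuous_comp; [exact: continuous_shift|exact: cF].
- exact: cvg_average_comp.
Qed.

(** Tightness: what f loses by the cutoff is at most C times the average of 1 - cutoff, whose limit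
    is 0 because the limit law lives on [0, b]. *)
Lemma cvg_average_continuous (f : R -> R) : continuous f -> (exists C : R, forall x : R, `|f x| <= C) ->
  cvg_average f.
Proof.
move=> cf bf; have [C fC] := bf.
have C0 : 0 <= C by rewrite (le_trans (normr_ge0 _) (fC 0)).
(* At a given x only finitely many points enter, so cutting off at a large n changes nothing. *)
have mf k : measurable_fun setT (average k f).
  apply: (@measurable_fun_cvg _ _ _ _ (fun n => average k (fun x => f x * cutoff n%:R x))).
    by move=> n; have [mc _] := cvg_average_cutoff cf bf (ler0n R n); exact: mc.
  move=> x _; apply: cvg_near_cst; near=> n.
  congr (_ * _); apply: eq_bigr => i _; rewrite cutoff1 ?mulr1//.
  have : \sum_(i < m k) ev x i <= n%:R by near: n; exact: nbhs_infty_ger.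
  by apply: le_trans; rewrite (bigD1 i)//= lerDl sumr_ge0.
have bone : exists C, forall x : R, `|(1 : R)| <= C by exists `|1|.
have [mfc cfc] := cvg_average_cutoff cf bf b0.
(* The factors 1 give 1 - cutoff the shape of [cvg_averageZD] and [cvg_average_cutoff]. *)
have [m1c c1c] : cvg_average (fun x => 1 * 1 + (-1) * (1 * cutoff b x)).
  apply: cvg_averageZD; [exact: bounded_measurable_cst|apply: bm_cutoff => //|
    exact: cvg_average_cst|apply: cvg_average_cutoff => //]; exact: cst_continuous.
split => // e e0.
apply: (@squeeze _ (fun k => event k (e / 2) (fun x => f x * cutoff b x))
  (fun k => event k (e / 2 / (C + 1)) (fun x => 1 * 1 + (-1) * (1 * cutoff b x)))).
- by move=> k; exact: measurable_event.
- by move=> k; exact: measurable_event.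
- by move=> k; exact: measurable_event.
- move=> k x; rewrite /event /= => ex.
  have i1 : \int[L]_y f y = \int[L]_y (f y * cutoff b y).
    apply/eqP; rewrite -subr_eq0 -normr_le0; apply: (Rintegral_dist L1 Lb).
    + exact: (bounded_measurable_continuous cf fC).
    + exact: bm_cutoff.
    + by move=> y /andP[_ yb]; rewrite cutoff1// mulr1 subrr normr0.
  have i2 : \int[L]_y (1 * 1 + (-1) * (1 * cutoff b y)) = 0.
    apply/eqP; rewrite -normr_le0 -[X in `|X|]subr0 -[X in _ - X](Rintegral_cst1 L1 0).
    apply: (Rintegral_dist L1 Lb).
    + apply: bounded_measurableZD; first exact: bounded_measurable_cst.
      by apply: bm_cutoff => //; exact: cst_continuous.
    + exact: bounded_measurable_cst.
    + by move=> y /andP[_ yb]; rewrite cutoff1// !mulr1 subrr subr0 normr0.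
  rewrite i2 subr0 -i1.
  have [h1|h1] := ltP (e / 2) `|average k (fun x => f x * cutoff b x) x - \int[L]_y f y|.
    by left.
  right; rewrite ltr_pdivrMr ?ltr_wpDl//.
  have h2 : `|average k f x - average k (fun x => f x * cutoff b x) x| <=
      C * average k (fun x => 1 * 1 + (-1) * (1 * cutoff b x)) x.
    have -> : average k f x - average k (fun x => f x * cutoff b x) x =
        average k (fun x => f x * (1 - cutoff b x)) x.
      have := averageZD f (fun x => f x * cutoff b x) 1 (-1) x; rewrite mul1r mulN1r => <-.
      by congr average; apply/funext => y; ring.
    rewrite (le_trans (average_norm _ _))//.
    have -> : C * average k (fun x => 1 * 1 + (-1) * (1 * cutoff b x)) x =
        average k (fun x => C * (1 - cutoff b x)) x.
      have := averageZD (fun x => 1 * 1 + (-1) * (1 * cutoff b x)) (fun=> 0) C 0 x.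
      rewrite [0 * average _ _ _]mul0r addr0 => <-.
      by congr average; apply/funext => y; ring.
    apply: average_le => y y0; have /andP[_ c1] := cutoff_itv b y.
    by rewrite normrM [X in _ * X]ger0_norm ?subr_ge0// ler_wpM2r ?subr_ge0.
  have h3 : `|average k f x - \int[L]_y f y| <=
      `|average k f x - average k (fun x => f x * cutoff b x) x| +
      `|average k (fun x => f x * cutoff b x) x - \int[L]_y f y|.
    by rewrite (le_trans _ (ler_normD _ _))// subrKA.
  have h4 := ler_norm (average k (fun x => 1 * 1 + -1 * (1 * cutoff b x)) x).
  have h5 := ler_wpM2l C0 h4.
  set t := `|average k (fun x => 1 * 1 + -1 * (1 * cutoff b x)) x| in h4 h5 *.
  have t0 : 0 <= t by exact: normr_ge0.
  lra.
- by apply: cfc; rewrite divr_gt0.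
- by apply: c1c; rewrite !divr_gt0// ltr_wpDl.
Unshelve. all: by end_near. Qed.

End weak_convergence.

Arguments average {R d X} m ev k f x.

(** * Choice of parameters and conclusion *)

Section stieltjes_bound_limit.
Context (R : realType).

Lemma cvg_invn (u : nat -> nat) : u @ \oo --> \oo ->
  (fun k => (u k)%:R^-1 : R) @ \oo --> (0 : R).
Proof.
move=> uoo; apply/(@gtr0_cvgV0 R); last exact/cvgrnyP.
near=> k; rewrite ltr0n; near: k.
exact: (uoo _ (nbhs_infty_gt 0)).
Unshelve. all: by end_near. Qed.

Lemma stieltjes_bound_cvg0 (kappa z : R) (m n : nat -> nat) :
  0 < kappa -> m @ \oo --> \oo -> n @ \oo --> \oo ->
  (fun k => (m k)%:R / (n k)%:R : R) @ \oo --> kappa ->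
  exists e : nat -> R, (forall k, (0 < n k)%N -> 0 < e k) /\
    (fun k => z^-1 * ((m k)%:R^-1 * ((n k)%:R * (e k / 2 +
        (m k)%:R / (e k * (n k)%:R ^+ 2 * z ^+ 2)) + z^-1)
      + `|kappa - (m k)%:R / (n k)%:R| / z ^+ 2) + 2 / z / (m k)%:R) @ \oo --> (0 : R).
Proof.
move=> k0 moo noo kcvg.
(* With e = n^(-1/2) the term of order e balances the term of order 1/(e n). *)
pose s k : R := Num.sqrt (n k)%:R^-1; exists s; split.
  by move=> k nk; rewrite sqrtr_gt0 invr_gt0 ltr0n.
have m0 := cvg_invn moo; have n0 := cvg_invn noo.
have s0 : s @ \oo --> (0 : R).
  by rewrite -[X in _ --> X](@sqrtr0 R); apply: (cvg_comp _ _ n0 (@sqrt_continuous R _)).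
have ki : (fun k => ((m k)%:R / (n k)%:R)^-1 : R) @ \oo --> kappa^-1.
  by apply: cvgV => //; exact: lt0r_neq0.
have d0 : (fun k => `|kappa - (m k)%:R / (n k)%:R|) @ \oo --> (0 : R).
  rewrite (_ : 0 = `|kappa - kappa|); last by rewrite subrr normr0.
  by apply: cvg_norm; apply: cvgB => //; exact: cvg_cst.
pose G k : R := z^-1 * (((m k)%:R / (n k)%:R)^-1 * (s k / 2) + s k / z ^+ 2
  + (m k)%:R^-1 / z + `|kappa - (m k)%:R / (n k)%:R| / z ^+ 2) + 2 / z * (m k)%:R^-1.
have mg : \forall k \near \oo, (0 < m k)%N by exact: (moo _ (nbhs_infty_gt 0)).
have ng : \forall k \near \oo, (0 < n k)%N by exact: (noo _ (nbhs_infty_gt 0)).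
(* At z = 0 the convention that 0 has inverse 0 makes every term vanish. *)
have [->|z0] := eqVneq z 0.
  by rewrite invr0; under eq_fun do rewrite mul0r mulr0 mul0r addr0; exact: cvg_cst.
apply: (@cvg_trans _ (G @ \oo)).
  apply: near_eq_cvg; near=> k.
  have mk : (m k)%:R != 0 :> R by rewrite pnatr_eq0 -lt0n; near: k.
  have nk : (n k)%:R != 0 :> R by rewrite pnatr_eq0 -lt0n; near: k.
  have sk : 0 < s k by rewrite sqrtr_gt0 invr_gt0 lt0r pnatr_eq0 ler0n andbT -(pnatr_eq0 R).
  have s2 : (n k)%:R = s k ^- 2 by rewrite sqr_sqrtr ?invr_ge0// invrK.
  have skn := lt0r_neq0 sk.
  have h : (n k)%:R * (s k / 2 + (m k)%:R / (s k * (n k)%:R ^+ 2 * z ^+ 2)) =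
      (n k)%:R * (s k / 2) + (m k)%:R * (s k / z ^+ 2).
    by rewrite mulrDr; congr (_ + _); rewrite s2; field; rewrite z0 skn.
  rewrite /G h; field.
  by rewrite z0 mk nk.
rewrite /G (_ : 0 = z^-1 * (kappa^-1 * (0 / 2) + 0 / z ^+ 2 + 0 / z + 0 / z ^+ 2) + 2 / z * 0 :> R).
  have s1 (c : R) : (fun k => s k * c) @ \oo --> 0 * c by apply: cvgM => //; exact: cvg_cst.
  have m1 (c : R) : (fun k => (m k)%:R^-1 * c) @ \oo --> 0 * c by apply: cvgM => //; exact: cvg_cst.
  have d1 (c : R) : (fun k => `|kappa - (m k)%:R / (n k)%:R| * c) @ \oo --> 0 * c.
    by apply: cvgM => //; exact: cvg_cst.
  have S := cvgD (cvgD (cvgD (cvgM ki (s1 2^-1)) (s1 (z ^+ 2)^-1)) (m1 z^-1)) (d1 (z ^+ 2)^-1).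
  by apply: cvgD; apply: cvgM; [exact: cvg_cst|exact: S|exact: cvg_cst|exact: m0].
by rewrite !(mul0r, mulr0, addr0).
Unshelve. all: by end_near. Qed.

End stieltjes_bound_limit.

Theorem corollary1p35 (R : realType)
    (lam : forall m n : nat, R.-ker (margin R m n) ~> 'M[R]_(m, n))
    (lam_disint : forall m n : nat,
       is_disintegration (iid_mx (std_gaussian R) m n) (lam m n)
         (@margin_of R m n)) :
  exists E : forall m n : nat, set (margin R m n),
    (forall m n, (margin_law (std_gaussian R) m n).-negligible (E m n)) /\
    forall (kappa : R) (m n : nat -> nat)
      (rm : forall k, 'cV[R]_(m k)) (cn : forall k, 'rV[R]_(n k))
      (r c : R -> R),
    0 < kappa ->
    m @ \oo --> \oo -> n @ \oo --> \oo ->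
    (fun k => (m k)%:R / (n k)%:R : R) @ \oo --> kappa ->
    (forall k, \sum_i rm k i 0 = \sum_j cn k 0 j) ->
    (forall k, ~ E (m k) (n k) (rm k, cn k)) ->
    continuum_margin r c ->
    margins_cvg_L1 rm cn r c ->
    cvg_weakly_in_prob (fun k => lam (m k) (n k) (rm k, cn k))
      (fun k (x : 'M[R]_(m k, n k)) =>
         let y := x - margin_mean (rm k) (cn k) in
         esd ((n k)%:R^-1 *: (y *m y^T)))
      (mp_law kappa).
Proof.
exists (exceptional lam); split; first exact: exceptional_negligible.
move=> kappa m n rm cn r c k0 moo noo kcvg _ good _ _ f cf bf e e0.
pose A k (x : 'M[R]_(m k, n k)) : 'M[R]_(m k) :=
  (n k)%:R^-1 *: ((x - margin_mean (rm k) (cn k)) *m (x - margin_mean (rm k) (cn k))^T).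
have pA k x : psdmx (@A k x) by apply: psdmx_gram; rewrite invr_ge0.
pose ev k (x : 'M[R]_(m k, n k)) (i : nat) : R := (eigenvalues (A k x))`_i.
have ev0 k (x : 'M[R]_(m k, n k)) i : 0 <= ev k x i.
  (* Indices beyond the list read the default value 0. *)
  have [im|im] := ltnP i (size (eigenvalues (A k x))); last by rewrite /ev nth_default.
  by apply: (eigenvalues_ge0 (pA k x)); exact: mem_nth.
have mg : \forall k \near \oo, (0 < m k)%N by exact: (moo _ (nbhs_infty_gt 0)).
have ng : \forall k \near \oo, (0 < n k)%N by exact: (noo _ (nbhs_infty_gt 0)).
pose P k : {measure set 'M[R]_(m k, n k) -> \bar R} := lam (m k) (n k) (rm k, cn k).
have averageE k (g : R -> R) x : measurable_fun setT g ->
    average m ev k g x = \int[esd (A k x)]_y g y.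
  by move=> mgg; rewrite esd_Rintegral.
have res_stieltjes k (z : R) x : 0 < z ->
    average m ev k (fun y => (Num.max y 0 + z)^-1) x =
    stieltjes z (x - margin_mean (rm k) (cn k)).
  move=> z0; rewrite /average /stieltjes mxtrace_resolvent_eigenvalues//; last exact: pA.
  congr (_ * _); apply: eq_bigr => i _; congr (_ + _)^-1.
  by apply/max_idPl; exact: ev0.
have b0 : 0 <= mp_upper kappa by exact: sqr_ge0.
have [|_] := @cvg_average_continuous R (mp_law kappa) (mp_upper kappa) b0 (mp_law_setT k0)
  (@mp_law_support R kappa) _ _ P m ev ev0 mg _ f cf bf; last first.
  move=> /(_ e e0); apply: cvg_trans; apply: near_eq_cvg; apply: nearW => k.
  congr (P k _).
  by apply/seteqP; split => x /=; rewrite averageE//; exact: continuous_measurable_fun.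
move=> a a0; have z0 : 0 < ratr a :> R by rewrite ltr0q.
have mS k : measurable_fun setT (fun x : 'M[R]_(m k, n k) =>
    stieltjes (ratr a : R) (x - margin_mean (rm k) (cn k))).
  apply: (@measurableT_comp _ _ _ _ _ _ (@stieltjes R (m k) (n k) (ratr a))).
    exact: measurable_stieltjes.
  apply: measurable_fun_mxP => i j.
  under eq_fun do rewrite mxE.
  by apply: measurable_funD => //; exact: measurable_mx_coef.
have resE k : average m ev k (fun y => (Num.max y 0 + ratr a)^-1) =
    fun x => stieltjes (ratr a : R) (x - margin_mean (rm k) (cn k)).
  by apply/funext => x; exact: res_stieltjes.
split; first by move=> k; rewrite resE; exact: mS.
have IE : \int[mp_law kappa]_y (Num.max y 0 + ratr a)^-1 = mp_stieltjes kappa (ratr a).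
  by rewrite /Rintegral integral_mp_stieltjes.
move=> {}e {}e0.
rewrite IE; under eq_fun do rewrite resE.
set t := mp_stieltjes kappa (ratr a).
have [d [d0 Bcvg]] := stieltjes_bound_cvg0 (ratr a) k0 moo noo kcvg.
set B := (X in X @ _ --> _) in Bcvg.
(* Markov's inequality bounds the probability by 1/e times an L1 distance, which for a good margin
   is controlled under the unconditional Gaussian law. *)
apply: (@squeeze_cvge _ _ _ _ (fun=> 0%E) _ (fun k => (e^-1 * B k)%:E)).
- near=> k; rewrite measure_ge0 /=.
  have mk : (0 < m k)%N by near: k.
  have nk : (0 < n k)%N by near: k.
  have gm : good_margin lam (rm k, cn k).
    by apply: contrapT => ngm; apply: (good k).
  have b1 := good_marginP t mk nk a0 gm.
  have b2 := stieltjes_mean_bound mk nk z0 (ltW k0) (mp_stieltjes_ge0 k0 z0)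
     (mp_stieltjes_eq k0 z0) (d0 k nk).
  have b3 := le_trans b1 b2.
  rewrite EFinM -lee_pdivrMl ?invr_gt0// invrK.
  apply: le_trans b3.
  have mD : measurable_fun setT (fun x : 'M[R]_(m k, n k) =>
      (stieltjes (ratr a : R) (x - margin_mean (rm k) (cn k)) - t)%:E).
    by apply/measurable_EFinP; apply: measurable_funB; [exact: mS|exact: measurable_cst].
  have := le_integral_abse (P k) measurableT mD e0.
  apply: le_trans.
  rewrite setTI; rewrite lee_pmul2l//.
  have mN : measurable_fun setT (fun x : 'M[R]_(m k, n k) =>
      `|stieltjes (ratr a : R) (x - margin_mean (rm k) (cn k)) - t|).
    by apply: measurableT_comp => //; apply: measurable_funB; [exact: mS|exact: measurable_cst].
  apply: le_measure; rewrite ?inE.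
  + move: (mN measurableT `]e, +oo[%classic (measurable_itv _)); rewrite setTI.
    by congr measurable; apply/seteqP; split => x; rewrite /= in_itv /= andbT.
  + move: (mN measurableT `[e, +oo[%classic (measurable_itv _)); rewrite setTI.
    by congr measurable; apply/seteqP; split => x; rewrite /= in_itv /= andbT.
  + by move=> x /= /ltW; rewrite lee_fin.
- exact: cvg_cst.
- apply: cvg_EFin; first exact: nearW.
  by rewrite -[X in _ --> X](mulr0 e^-1); apply: cvgM => //; exact: cvg_cst.
Unshelve. all: by end_near. Qed.
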